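(* Consider the type-1 solution $(y,z,u)$ with parameters $(\varphi,\delta,\hat u)$ described in the context. Denote $$i\,\Theta_{01}\equiv\hat\gamma=1-\Theta_0-\Theta_1\quad\text{and}\quad i\,\omega_1\equiv\nu_1=1+\Theta_\infty-4\varphi .$$ Assume that $\Theta_{01}$ and $\omega_1$, as well as the coefficients $\hat\alpha$ and $\hat\beta$ of the fifth Painlevé equation (given in the context), are real and $$\Big(\frac{\omega_1-\Theta_{01}}2\Big)^2>2\hat\beta .$$ Then the type-1 solution is real for pure imaginary values of $t$, namely, $y(t)\equiv\tilde y(\tau)$, $t=i\tau$, $\tilde y(\tau)\in\mathbb R$ for $\tau\in\mathbb R$, and its asymptotics as $t\to\infty$ and $\arg t\to\epsilon\pi/2$ $(\epsilon=\pm1)$ can be rewritten as follows: $$\tilde y(\tau)\underset{\tau\to\epsilon\infty}=\frac1\tau\left(\frac{\omega_1-\Theta_{01}}2+\sqrt{\Big(\frac{\omega_1-\Theta_{01}}2\Big)^2-2\hat\beta}\;\sin\big(\tau+\omega_1\ln|\tau|+\arg\delta\big)+\mathcal O\Big(\frac{\ln\tau}{\tau}\Big)\right),$$ where $\delta$ is the parameter of the type-1 solution. For real solutions with these asymptotics, $|\delta|$ is given by the relation $$2|\delta|\,e^{-\frac{\epsilon\pi\omega_1}2}=\sqrt{\Big(\frac{\omega_1-\Theta_{01}}2\Big)^2-2\hat\beta}\;>\;0 .$$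
   Context: Let $\Theta_0,\Theta_1,\Theta_\infty\in\mathbb C$. The function $y$ satisfies the fifth Painlevé equation $$y''=\Big(\frac1{2y}+\frac1{y-1}\Big)(y')^2-\frac{y'}t+\frac{(y-1)^2}{t^2}\Big(\hat\alpha y+\frac{\hat\beta}y\Big)+\hat\gamma\frac yt-\frac12\,\frac{y(y+1)}{y-1},$$ $$\hat\alpha=\tfrac12\Big(\tfrac{\Theta_0-\Theta_1+\Theta_\infty}2\Big)^2,\quad\hat\beta=-\tfrac12\Big(\tfrac{\Theta_0-\Theta_1-\Theta_\infty}2\Big)^2,\quad\hat\gamma=1-\Theta_0-\Theta_1,$$ as a consequence of the isomonodromy deformation system \begin{align*} t\frac{dy}{dt}&=ty-2z(y-1)^2-(y-1)\Big(\tfrac{\Theta_0-\Theta_1+\Theta_\infty}2y-\tfrac{3\Theta_0+\Theta_1+\Theta_\infty}2\Big),\\ t\frac{dz}{dt}&=yz\Big(z+\tfrac{\Theta_0-\Theta_1+\Theta_\infty}2\Big)-\frac1y(z+\Theta_0)\Big(z+\tfrac{\Theta_0+\Theta_1+\Theta_\infty}2\Big),\\ t\frac{d}{dt}\log u&=-2z-\Theta_0+y\Big(z+\tfrac{\Theta_0-\Theta_1+\Theta_\infty}2\Big)+\frac1y\Big(z+\tfrac{\Theta_0+\Theta_1+\Theta_\infty}2\Big). \end{align*} **Type-1 solution.** Let $\varphi\in\mathbb C$ with $\varphi\mp\frac{\Theta_0}2,\ \varphi-\frac{\Theta_\infty}2\mp\frac{\Theta_1}2\ne0,-1,-2,\ldots$,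 let $\delta,\hat u\in\mathbb C\setminus\{0\}$, $\nu_1=1+\Theta_\infty-4\varphi$, $-\frac12<\Re\nu_1<1$, and $R_1(t;\vartheta)=1-\frac{\varphi-\vartheta}{\delta t^{\nu_1}e^t}$. For each sign $\pm$, the type-1 solution is the unique solution of the system with, as $t\to\infty$, $\arg t\to\pm\frac\pi2$, $t\in\mathcal D^1$, \begin{align*} yt&=\delta t^{\nu_1}e^tR_1(t;\tfrac{\Theta_0}2)R_1(t;\tfrac{\Theta_1+\Theta_\infty}2)+\mathcal O(t^{-3\nu_1-1}\ln t)+\mathcal O(t^{\nu_1-1}\ln t),\\ z&=-\Theta_0-(\varphi-\tfrac{\Theta_0}2)R_1(t;\tfrac{\Theta_1+\Theta_\infty}2)+\mathcal O(t^{-1})+\mathcal O(t^{-3\nu_1-1}\ln t),\\ u&=\frac{\hat u}\delta\,\frac{t^{2\varphi}(1+\mathcal O(t^{-1}\ln t)+\mathcal O(t^{-2\nu_1-1}\ln t))}{R_1(t;\frac{\Theta_1+\Theta_\infty}2)+\mathcal O(t^{-\nu_1-1}\ln t)+\mathcal O(t^{-3\nu_1-1}\ln t)}. \end{align*} Here $\mathcal D^1=\{|\Re t|<r_1,\ -\pi<\arg t<\pi,\ |t-t_n|\ge r_2|t|^{\varepsilon-1}\}$ with arbitrary $r_1,r_2>0$, $0<\varepsilon\le1$, where $t_n$ runs over the infinite sequences (if they exist) of zeros in $|\Re t|<r_1$ of $R_1(t;\frac{\Theta_0}2)$ and $R_1(t;\frac{\Theta_1+\Theta_\infty}2)$. The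 power $t^\nu$ equals $e^{\pm i\pi\nu/2}|t|^\nu$ for $t\in\pm i\mathbb R_{>0}$ and is extended by analytic continuation.
   Formalization: The relation for |δ| is taken as the condition for reality (for other δ the leading term of y is not real) and is proved necessary; ''real for τ∈ℝ'' is stated on the half-axis ετ>0 where the asymptotics hold, poles excepted, since t=0 is a branch point. *)

(* Defs.v *)
From Stdlib Require Export Reals.
From Coquelicot Require Export Coquelicot.
Open Scope C_scope.

(* Principal argument, with values in (-PI, PI]; the half-angle formula covers
   everything except the negative real axis. *)
Definition Carg (t : C) : R :=
  if Rlt_dec (Re t) 0 then
    if Req_EM_T (Im t) 0 then PI else (2 * atan (Im t / (Cmod t + Re t)))%R
  else (2 * atan (Im t / (Cmod t + Re t)))%R.

Definition Cexp (t : C) : C :=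
  RtoC (exp (Re t)) * (RtoC (cos (Im t)) + Ci * RtoC (sin (Im t))).

Definition Clog (t : C) : C := RtoC (ln (Cmod t)) + Ci * RtoC (Carg t).

(* On the rays t = i tau, tau of sign s, this is e^{s i PI nu / 2} |t|^nu. *)
Definition Cpower (t nu : C) : C := Cexp (nu * Clog t).

(* The plane cut along the negative real axis: -PI < arg t < PI. *)
Definition slit (t : C) : Prop := t <> 0 /\ (- PI < Carg t < PI)%R.

Definition analytic_at (f : C -> C) (t0 : C) : Prop :=
  exists a : nat -> C,
    @locally C_UniformSpace t0 (fun t => is_pseries a (t - t0) (f t)).

Definition pole_at (f : C -> C) (t0 : C) : Prop :=
  exists (n : nat) (g : C -> C),
    (0 < n)%nat /\ analytic_at g t0 /\ g t0 <> 0 /\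
    @locally' C_UniformSpace t0 (fun t => f t = g t / pow_n (t - t0) n).

(* A meromorphic function is a total function C -> C whose value at a pole is
   irrelevant; removable singularities are required to be removed. *)
Definition meromorphic_at (f : C -> C) (t0 : C) : Prop :=
  analytic_at f t0 \/ pole_at f t0.

Definition alpha_hat (T0 T1 Too : C) : C :=
  RtoC (1/2) * (((T0 - T1 + Too) / 2) * ((T0 - T1 + Too) / 2)).
Definition beta_hat (T0 T1 Too : C) : C :=
  RtoC (-1/2) * (((T0 - T1 - Too) / 2) * ((T0 - T1 - Too) / 2)).
Definition gamma_hat (T0 T1 : C) : C := 1 - T0 - T1.

(* The isomonodromy deformation system, as an identity between meromorphic
   functions on the cut plane: it is imposed wherever both sides make sense,
   and t d(log u)/dt is written t u'/u. *)
Definition isomonodromy_solution (T0 T1 Too : C) (y z u : C -> C) : Prop :=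
  (forall t, slit t ->
     meromorphic_at y t /\ meromorphic_at z t /\ meromorphic_at u t) /\
  (forall t, slit t ->
     analytic_at y t -> analytic_at z t -> analytic_at u t ->
     y t <> 0 -> u t <> 0 ->
     exists dy dz du : C,
       is_derive y t dy /\ is_derive z t dz /\ is_derive u t du /\
       t * dy = t * y t - 2 * z t * ((y t - 1) * (y t - 1))
                - (y t - 1) * ((T0 - T1 + Too) / 2 * y t
                               - (3 * T0 + T1 + Too) / 2) /\
       t * dz = y t * z t * (z t + (T0 - T1 + Too) / 2)
                - 1 / y t * (z t + T0) * (z t + (T0 + T1 + Too) / 2) /\
       t * (du / u t) = - (2 * z t) - T0
                + y t * (z t + (T0 - T1 + Too) / 2)
                + 1 / y t * (z t + (T0 + T1 + Too) / 2)).

Definition nu1 (Too phi : C) : C := 1 + Too - 4 * phi.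

Definition type1_parameters (T0 T1 Too phi delta uhat : C) : Prop :=
  (forall n : nat,
     phi - T0 / 2 <> - RtoC (INR n) /\
     phi + T0 / 2 <> - RtoC (INR n) /\
     phi - Too / 2 - T1 / 2 <> - RtoC (INR n) /\
     phi - Too / 2 + T1 / 2 <> - RtoC (INR n)) /\
  delta <> 0 /\ uhat <> 0 /\
  (- (1/2) < Re (nu1 Too phi) < 1)%R.

Definition R1 (Too phi delta t theta : C) : C :=
  1 - (phi - theta) / (delta * Cpower t (nu1 Too phi) * Cexp t).

(* The strip |Re t| < r1 without the discs around the zeros t_n = s. *)
Definition D1 (T0 T1 Too phi delta : C) (r1 r2 e : R) (t : C) : Prop :=
  (Rabs (Re t) < r1)%R /\ slit t /\
  forall s : C, (Rabs (Re s) < r1)%R -> slit s ->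
    R1 Too phi delta s (T0 / 2) = 0 \/
    R1 Too phi delta s ((T1 + Too) / 2) = 0 ->
    (r2 * Rpower (Cmod t) (e - 1) <= Cmod (t - s))%R.

(* t -> oo, arg t -> sigma PI / 2, t in D. *)
Definition vertical_end (sigma : R) (D : C -> Prop) (P : C -> Prop) : Prop :=
  exists M eta : R, (0 < eta)%R /\
    forall t : C, D t -> (M < Cmod t)%R ->
      (Rabs (Carg t - sigma * PI / 2) < eta)%R -> P t.

Definition bigO (F : (C -> Prop) -> Prop) (f g : C -> C) : Prop :=
  exists K : R, F (fun t => (Cmod (f t) <= K * Cmod (g t))%R).

Definition type1_asymptotics (T0 T1 Too phi delta uhat : C)
    (F : (C -> Prop) -> Prop) (y z u : C -> C) : Prop :=
  let nu := nu1 Too phi in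
  let Ra t := R1 Too phi delta t (T0 / 2) in
  let Rb t := R1 Too phi delta t ((T1 + Too) / 2) in
  (exists o1 o2 : C -> C,
     bigO F o1 (fun t => Cpower t (- (3 * nu) - 1) * Clog t) /\
     bigO F o2 (fun t => Cpower t (nu - 1) * Clog t) /\
     F (fun t => y t * t
                 = delta * Cpower t nu * Cexp t * Ra t * Rb t
                   + o1 t + o2 t)) /\
  (exists o1 o2 : C -> C,
     bigO F o1 (fun t => / t) /\
     bigO F o2 (fun t => Cpower t (- (3 * nu) - 1) * Clog t) /\
     F (fun t => z t = - T0 - (phi - T0 / 2) * Rb t + o1 t + o2 t)) /\
  (exists o1 o2 o3 o4 : C -> C,
     bigO F o1 (fun t => / t * Clog t) /\
     bigO F o2 (fun t => Cpower t (- (2 * nu) - 1) * Clog t) /\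
     bigO F o3 (fun t => Cpower t (- nu - 1) * Clog t) /\
     bigO F o4 (fun t => Cpower t (- (3 * nu) - 1) * Clog t) /\
     F (fun t => u t = uhat / delta
                   * (Cpower t (2 * phi) * (1 + o1 t + o2 t)
                      / (Rb t + o3 t + o4 t)))).

(* The type-1 solution for the sign sigma = 1 or -1.  The asymptotics hold for
   arbitrary r1, r2, e (for one fixed choice D^1 may be bounded). *)
Definition type1_solution (sigma : R) (T0 T1 Too phi delta uhat : C)
    (y z u : C -> C) : Prop :=
  type1_parameters T0 T1 Too phi delta uhat /\
  isomonodromy_solution T0 T1 Too y z u /\
  forall r1 r2 e : R, (0 < r1)%R -> (0 < r2)%R -> (0 < e <= 1)%R ->
    type1_asymptotics T0 T1 Too phi delta uhat
      (vertical_end sigma (D1 T0 T1 Too phi delta r1 r2 e)) y z u.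

(* y(i tau) = yt(tau) is real on the half-axis sigma tau > 0, poles excepted. *)
Definition real_on_axis (sigma : R) (y : C -> C) (yt : R -> R) : Prop :=
  forall tau : R, (0 < sigma * tau)%R ->
    analytic_at y (Ci * RtoC tau) -> y (Ci * RtoC tau) = RtoC (yt tau).

(* yt(tau) = (b + A sin(tau + omega ln|tau| + theta) + O(ln|tau|/tau)) / tau as
   tau -> sigma oo; in particular y has no poles i tau with sigma tau large. *)
Definition real_asymptotics (sigma : R) (y : C -> C) (yt : R -> R)
    (b A omega theta : R) : Prop :=
  exists (K T : R) (o : R -> R),
    forall tau : R, (T < sigma * tau)%R ->
      analytic_at y (Ci * RtoC tau) /\
      (yt tau
       = / tau * (b + A * sin (tau + omega * ln (Rabs tau) + theta) + o tau))%R /\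
      (Rabs (o tau) <= K * Rabs (ln (Rabs tau) / tau))%R.

(* Main.v *)
Require Import Defs.
From Stdlib Require Import Arith Lra Lia Psatz Ranalysis5 Classical FunctionalExtensionality Wf_nat.
Open Scope C_scope.

(** On the ray t = i tau the function y satisfies a Painleve equation with real coefficients.
    In the unknowns q = tau y, V = tau y' and a Hamiltonian-like quantity c this equation is
    regular at y = 0, and to leading order it is q' = V, V' = c - q, c' = 0. The type-1
    asymptotics are assumed only away from the zeros of R1, but they hold at a sequence of
    points of the ray with bounded gaps, namely where the exponential delta t^nu e^t takes one
    well-chosen value; from there a Gronwall estimate for the regular system carries them over
    the gaps, which also excludes poles. The leading term of q is real exactly under the
    modulus relation, and then it is b + A sin(...). In that case the imaginary part of
    (q, V, c) tends to 0. It solves a linear system whose solutions grow or decay at most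
    logarithmically, after averaging the terms of order 1/tau, so it vanishes for large tau,
    and then on the whole half-axis by analytic continuation: Im y is given by real Laurent
    series along the ray. *)

(** Classically reality follows by reflection: the conjugate solution has the same asymptotics, so
    uniqueness identifies the two. [type1_solution] states only the asymptotics, so a rigidity
    estimate replaces uniqueness. Plain Gronwall fails there: coefficients of size 1/s allow growth
    like a power of s, while the imaginary part is only known to be O(ln s / s). Hence the averaged
    quantities. With t = v s, v = i sigma, ka = phi - T0/2, kb = phi - (T1+Too)/2 and carrier E =
    delta t^nu e^t, the leading term of t y is (E - ka)(E - kb)/E = E - (ka + kb) + ka kb/E. So the
    excluded discs surround exactly its zeros, where the system, which contains 1/y, is singular
    too; this is why one regular system serves both difficulties. The product ka kb is real and
    equals -(b^2 - 2 beta)/4, with beta the real coefficient and b = (omega1 - Theta01)/2. On the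
    ray |E| is a constant rho, so ka kb/E is a real multiple of the conjugate of E. The two
    exponentials combine to a real sine exactly when their moduli agree, which is 4 rho^2 = b^2 - 2
    beta. *)

(** The test for a bound already in the context makes the [repeat] in [minmax] terminate. *)
Ltac minmax_bounds a b :=
  first [match goal with _ : (Rmin a b <= a)%R |- _ => idtac end; fail 1
        |pose proof (Rmin_l a b); pose proof (Rmin_r a b); pose proof (Rmax_l a b); pose proof (Rmax_r a b)].
Ltac minmax :=
  repeat match goal with
  | _ : context [Rmin ?a ?b] |- _ => minmax_bounds a b
  | |- context [Rmin ?a ?b] => minmax_bounds a b
  | _ : context [Rmax ?a ?b] |- _ => minmax_bounds a b
  | |- context [Rmax ?a ?b] => minmax_bounds a b
  end.

Lemma Re_minus (a b : C) : Re (a - b) = (Re a - Re b)%R.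
Proof. reflexivity. Qed.
Lemma Im_minus (a b : C) : Im (a - b) = (Im a - Im b)%R.
Proof. reflexivity. Qed.

Lemma le_div_of_mul_le (a b c : R) : (0 < c -> a * c <= b -> a <= b / c)%R.
Proof. intros Hc H. now apply (Rle_div_r a b c Hc). Qed.

Lemma div_le_of_le_mul (a b c : R) : (0 < c -> a <= b * c -> a / c <= b)%R.
Proof. intros Hc H. now apply (Rle_div_l a b c Hc). Qed.

Lemma mul_lt_of_lt_div (a b c : R) : (0 < c -> a < b / c -> a * c < b)%R.
Proof. intros Hc H. now apply (Rlt_div_r a b c Hc). Qed.

Lemma lt_div_of_mul_lt (a b c : R) : (0 < c -> a * c < b -> a < b / c)%R.
Proof. intros Hc H. now apply (Rlt_div_r a b c Hc). Qed.

(** * Power series *)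

Lemma pow_n_Cpow (x : C) (k : nat) : pow_n x k = x ^ k.
Proof.
  induction k as [|k IH]; [reflexivity|].
  change (x * pow_n x k = x * x ^ k); now rewrite IH.
Qed.

Definition psum (a : nat -> C) (h : C) (n : nat) : C :=
  sum_n (fun k => a k * h ^ k) n.

Lemma psum_S a h n : psum a h (S n) = psum a h n + a (S n) * h ^ S n.
Proof. unfold psum; now rewrite sum_Sn. Qed.

Lemma psum_0 a h : psum a h 0 = a 0%nat.
Proof. unfold psum; rewrite sum_O; simpl; ring. Qed.

Lemma is_pseries_C (a : nat -> C) (h l : C) :
  is_pseries a h l <->
  forall eps : R, (0 < eps)%R ->
    exists N, forall n, (N <= n)%nat -> (Cmod (psum a h n - l) < eps)%R.
Proof.
  unfold is_pseries, is_series.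
  assert (E : forall n, sum_n (fun k => scal (pow_n h k) (a k)) n = psum a h n).
  { intro n; apply sum_n_ext; intro k.
    change (h ^ k * a k = a k * h ^ k); ring. }
  split.
  - intros H eps Heps.
    pose proof (proj1 (filterlim_locally_ball_norm (U := C_NormedModule) _ l) H (mkposreal _ Heps)) as [N HN].
    exists N; intros n Hn. specialize (HN n Hn). rewrite E in HN. exact HN.
  - intros H. apply (filterlim_locally_ball_norm (U := C_NormedModule)).
    intros [eps Heps]. destruct (H eps Heps) as [N HN].
    exists N; intros n Hn. rewrite E. exact (HN n Hn).
Qed.

(** A Cauchy estimate, used as a quantitative form of positive radius of convergence. The series is
    then used on |h| <= r/2, where its tails are dominated by a geometric series of ratio at most
    1/2. *)
Definition coef_bound (a : nat -> C) (M r : R) : Prop :=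
  (0 < r)%R /\ forall k, (Cmod (a k) * r ^ k <= M)%R.

Lemma coef_bound_nonneg a M r : coef_bound a M r -> (0 <= M)%R.
Proof.
  intros [Hr H]. specialize (H 0%nat). simpl in H.
  pose proof (Cmod_ge_0 (a 0%nat)); lra.
Qed.

Lemma coef_bound_term a M r h k :
  coef_bound a M r -> (Cmod (a k * h ^ k) <= M * (Cmod h / r) ^ k)%R.
Proof.
  intros [Hr H]. rewrite Cmod_mult, Cmod_pow.
  assert (E : (Cmod h ^ k = r ^ k * (Cmod h / r) ^ k)%R).
  { rewrite <- Rpow_mult_distr. f_equal. field; lra. }
  rewrite E. rewrite <- Rmult_assoc. apply Rmult_le_compat_r; [|apply H].
  apply pow_le, Rdiv_le_0_compat; [apply Cmod_ge_0|exact Hr].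
Qed.

(** The bound is kept in telescoping form so that induction on n closes: for x <= 1/2 a new term M
    x^(n+1) is at most 2 M (x^(n+1) - x^(n+2)). *)
Lemma psum_diff_bound a M r h m n :
  coef_bound a M r -> (Cmod h <= r / 2)%R -> (m <= n)%nat ->
  (Cmod (psum a h n - psum a h m)
   <= 2 * M * ((Cmod h / r) ^ S m - (Cmod h / r) ^ S n))%R.
Proof.
  intros Hb Hh Hmn. pose proof (coef_bound_nonneg _ _ _ Hb) as HM.
  pose proof (proj1 Hb) as Hr.
  set (x := (Cmod h / r)%R).
  assert (Hx0 : (0 <= x)%R) by (apply Rdiv_le_0_compat; [apply Cmod_ge_0|exact Hr]).
  assert (Hx1 : (x <= 1 / 2)%R).
  { unfold x. apply div_le_of_le_mul; [exact Hr|]. lra. }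
  induction Hmn as [|n Hmn IH].
  - replace (psum a h m - psum a h m) with (RtoC 0) by ring. rewrite Cmod_0.
     nra.
  - rewrite psum_S. pose proof (coef_bound_term a M r h (S n) Hb) as Ht. fold x in Ht.
    pose proof (Cmod_triangle (psum a h n - psum a h m) (a (S n) * h ^ S n)) as Htr.
    replace (psum a h n + a (S n) * h ^ S n - psum a h m)
      with (psum a h n - psum a h m + a (S n) * h ^ S n) by ring.
    pose proof (pow_le x (S n) Hx0) as Hp.
    assert ((x ^ S (S n) <= 1 / 2 * x ^ S n)%R).
    { change (x ^ S (S n))%R with (x * x ^ S n)%R. nra. }
    nra.
Qed.

Lemma pseries_tail a M r (h l : C) m :
  coef_bound a M r -> (Cmod h <= r / 2)%R -> is_pseries a h l ->
  (Cmod (l - psum a h m) <= 2 * M * (Cmod h / r) ^ S m)%R.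
Proof.
  intros Hb Hh Hl. rewrite is_pseries_C in Hl.
  apply le_epsilon. intros eps Heps.
  destruct (Hl eps Heps) as [N HN].
  specialize (HN (N + m)%nat ltac:(lia)).
  pose proof (psum_diff_bound a M r h m (N + m) Hb Hh ltac:(lia)) as Hd.
  pose proof (Cmod_triangle (-(psum a h (N + m) - l)) (psum a h (N + m) - psum a h m)) as Htr.
  rewrite Cmod_opp in Htr.
  replace (-(psum a h (N + m) - l) + (psum a h (N + m) - psum a h m))
    with (l - psum a h m) in Htr by ring.
  pose proof (coef_bound_nonneg _ _ _ Hb) as HM.
  assert (0 <= (Cmod h / r) ^ S (N + m))%R.
  { apply pow_le, Rdiv_le_0_compat; [apply Cmod_ge_0|apply Hb]. }
  nra.
Qed.

Lemma pseries_bound a M r (h l : C) :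
  coef_bound a M r -> (Cmod h <= r / 2)%R -> is_pseries a h l ->
  (Cmod l <= 2 * M)%R.
Proof.
  intros Hb Hh Hl. pose proof (pseries_tail a M r h l 0 Hb Hh Hl) as H.
  rewrite psum_0 in H. simpl in H.
  pose proof (proj2 Hb 0%nat) as H0. simpl in H0.
  pose proof (Cmod_triangle (l - a 0%nat) (a 0%nat)) as Ht.
  replace (l - a 0%nat + a 0%nat) with l in Ht by ring.
  pose proof (coef_bound_nonneg _ _ _ Hb) as HM. pose proof (proj1 Hb) as Hr.
  assert ((Cmod h / r <= 1 / 2)%R) by (apply div_le_of_le_mul; lra).
  nra.
Qed.

Lemma geom_half_lim (K : R) (eps : R) : (0 < eps)%R ->
  exists N, forall n, (N <= n)%nat -> (K * (1 / 2) ^ n < eps)%R.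
Proof.
  intros He. destruct (pow_lt_1_zero (1 / 2) ltac:(rewrite Rabs_right; lra) (eps / (Rabs K + 1)))
    as [N HN].
  { apply Rdiv_lt_0_compat; [lra|]. pose proof (Rabs_pos K); lra. }
  exists N. intros n Hn. specialize (HN n Hn).
  pose proof (Rabs_pos K). pose proof (pow_le (1/2) n ltac:(lra)) as Hp.
  rewrite Rabs_right in HN by lra.
  apply Rlt_div_r in HN; [|lra].
  pose proof (Rle_abs K). nra.
Qed.

Lemma ex_pseries_bound a M r (h : C) :
  coef_bound a M r -> (Cmod h <= r / 2)%R ->
  exists l : C, is_pseries a h l.
Proof.
  intros Hb Hh.
  assert (Hex : ex_series (V := C_CompleteNormedModule) (fun k => a k * h ^ k)).
  { apply (ex_series_le (V := C_CompleteNormedModule) _ (fun k => M * (Cmod h / r) ^ k)%R).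
    - intro k. apply coef_bound_term, Hb.
    - apply (ex_series_scal (V := R_NormedModule) M (fun k => ((Cmod h / r) ^ k)%R)). apply ex_series_geom.
      pose proof (proj1 Hb). rewrite Rabs_right.
      + apply Rlt_div_l; lra.
      + apply Rle_ge, Rdiv_le_0_compat; [apply Cmod_ge_0|lra]. }
  destruct Hex as [l Hl]. exists l.
  unfold is_pseries. refine (is_series_ext _ _ _ _ Hl).
  intro k. change (a k * h ^ k = h ^ k * a k). apply Cmult_comm.
Qed.

(** A total sum function, so that series can be rewritten as terms; [Series] is total on the reals,
    hence the split into parts. The value means something only where the series converges, as in
    [PS_correct]. *)
Definition PS (a : nat -> C) (h : C) : C :=
  (Series (fun k => Re (a k * h ^ k)), Series (fun k => Im (a k * h ^ k))).

Lemma sum_n_Re (u : nat -> C) n : Re (sum_n u n) = sum_n (fun k => Re (u k)) n.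
Proof. induction n as [|n IH]; [now rewrite !sum_O|]. rewrite !sum_Sn, <- IH. reflexivity. Qed.
Lemma sum_n_Im (u : nat -> C) n : Im (sum_n u n) = sum_n (fun k => Im (u k)) n.
Proof. induction n as [|n IH]; [now rewrite !sum_O|]. rewrite !sum_Sn, <- IH. reflexivity. Qed.

Lemma im_le_Cmod (c : C) : (Rabs (Im c) <= Cmod c)%R.
Proof. pose proof (Rmax_Cmod c). pose proof (Rmax_r (Rabs (fst c)) (Rabs (snd c))). unfold Im; lra. Qed.

Lemma PS_unique (a : nat -> C) (h l : C) : is_pseries a h l -> PS a h = l.
Proof.
  rewrite is_pseries_C. intro H. unfold PS.
  assert (E : forall x y : C, Re x = Re y -> Im x = Im y -> x = y).
  { intros [? ?] [? ?]; simpl; intros; congruence. }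
  apply E; cbn [Re Im fst snd]; apply is_series_unique; unfold is_series;
    apply filterlim_locally; intros [eps Heps]; destruct (H eps Heps) as [N HN];
    exists N; intros n Hn; specialize (HN n Hn); unfold psum in HN.
  - change (Rabs (sum_n (fun k => Re (a k * h ^ k)) n - Re l) < eps)%R.
    rewrite <- sum_n_Re. pose proof (re_le_Cmod (sum_n (fun k => a k * h ^ k) n - l)).
    rewrite Re_minus in *. lra.
  - change (Rabs (sum_n (fun k => Im (a k * h ^ k)) n - Im l) < eps)%R.
    rewrite <- sum_n_Im. pose proof (im_le_Cmod (sum_n (fun k => a k * h ^ k) n - l)).
    rewrite Im_minus in *. lra.
Qed.

Lemma PS_correct a M r h :
  coef_bound a M r -> (Cmod h <= r / 2)%R -> is_pseries a h (PS a h).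
Proof.
  intros Hb Hh. destruct (ex_pseries_bound a M r h Hb Hh) as [l Hl].
  now rewrite (PS_unique a h l Hl).
Qed.

Lemma PS_shift a M r h :
  coef_bound a M r -> (Cmod h <= r / 2)%R ->
  PS a h = a 0%nat + h * PS (fun k => a (S k)) h.
Proof.
  intros Hb Hh.
  assert (Hb' : coef_bound (fun k => a (S k)) (M / r) r).
  { destruct Hb as [Hr Hb]. split; [exact Hr|]. intro k. specialize (Hb (S k)). simpl in Hb.
    apply le_div_of_mul_le; [exact Hr|]. replace (Cmod (a (S k)) * r ^ k * r)%R with (Cmod (a (S k)) * (r * r ^ k))%R by ring. exact Hb. }
  apply PS_unique. apply is_pseries_C. intros eps He.
  pose proof (PS_correct _ _ _ h Hb' Hh) as H1. rewrite is_pseries_C in H1.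
  pose proof (Cmod_ge_0 h) as Hh0.
  destruct (H1 (eps / (Cmod h + 1))%R) as [N HN].
  { apply Rdiv_lt_0_compat; lra. }
  exists (S N). intros n Hn. destruct n as [|n]; [lia|].
  specialize (HN n ltac:(lia)).
  assert (E : forall n, psum a h (S n) = a 0%nat + h * psum (fun k => a (S k)) h n).
  { clear. induction n as [|n IH].
    - rewrite psum_S, !psum_0. simpl. ring.
    - rewrite psum_S, IH, psum_S. simpl. ring. }
  rewrite E.
  replace (a 0%nat + h * psum (fun k => a (S k)) h n - (a 0%nat + h * PS (fun k => a (S k)) h))
    with (h * (psum (fun k => a (S k)) h n - PS (fun k => a (S k)) h)) by ring.
  rewrite Cmod_mult.
  apply Rlt_div_r in HN; [|lra].
   nra.
Qed.

(** Coefficients of the divided difference (f(x) - f(d))/(x - d) in powers of x, read off from (x^n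
    - d^n)/(x - d) = sum of x^j d^(n-1-j). Derivatives, recentring and quadratic remainders all come
    from this one construction, without double series. *)
Definition qcoef (a : nat -> C) (d : C) (j : nat) : C := PS (fun i => a (S j + i)%nat) d.

Lemma coef_bound_drop a M r j :
  coef_bound a M r -> coef_bound (fun i => a (j + i)%nat) (M / r ^ j) r.
Proof.
  intros [Hr Hb]. split; [exact Hr|]. intro k. specialize (Hb (j + k)%nat).
  rewrite pow_add in Hb. apply le_div_of_mul_le; [apply pow_lt, Hr|]. lra.
Qed.

Lemma qcoef_bound a M r d :
  coef_bound a M r -> (Cmod d <= r / 2)%R -> coef_bound (qcoef a d) (2 * M / r) r.
Proof.
  intros Hb Hd. pose proof (proj1 Hb) as Hr. split; [exact Hr|]. intro j.
  pose proof (coef_bound_drop a M r (S j) Hb) as Hj.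
  pose proof (pseries_bound _ _ _ d _ Hj Hd (PS_correct _ _ _ d Hj Hd)) as H.
  fold (qcoef a d j) in H.
  apply Rle_trans with (2 * (M / r ^ S j) * r ^ j)%R.
  - apply Rmult_le_compat_r; [apply pow_le; lra|exact H].
  - apply Req_le. simpl. field. split; [lra|apply pow_nonzero; lra].
Qed.

Lemma qcoef_rec a M r d j :
  coef_bound a M r -> (Cmod d <= r / 2)%R ->
  qcoef a d j = a (S j) + d * qcoef a d (S j).
Proof.
  intros Hb Hd. unfold qcoef.
  rewrite (PS_shift _ _ _ d (coef_bound_drop a M r (S j) Hb) Hd).
  replace (S j + 0)%nat with (S j) by lia.
  replace (fun k => a (S j + S k)%nat) with (fun k => a (S (S j) + k)%nat); [reflexivity|].
  apply functional_extensionality; intro i; f_equal; lia.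
Qed.

Lemma PS_rec a M r d :
  coef_bound a M r -> (Cmod d <= r / 2)%R -> PS a d = a 0%nat + d * qcoef a d 0.
Proof. intros Hb Hd. apply (PS_shift a M r d Hb Hd). Qed.

Lemma PS_quotient a M r x d :
  coef_bound a M r -> (Cmod d <= r / 2)%R -> (Cmod x <= r / 2)%R ->
  PS a x - PS a d = (x - d) * PS (qcoef a d) x.
Proof.
  intros Hb Hd Hx.
  assert (E : PS a x = PS a d + (x - d) * PS (qcoef a d) x); [|rewrite E; ring].
  apply PS_unique, is_pseries_C. intros eps He.
  pose proof (qcoef_bound a M r d Hb Hd) as Hq.
  pose proof (proj1 Hb) as Hr.
  set (L := PS (qcoef a d) x).
  pose proof (PS_correct _ _ _ x Hq Hx) as H1. fold L in H1. rewrite is_pseries_C in H1.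
  pose proof (Cmod_ge_0 (x - d)) as Hxd.
  destruct (H1 (eps / 2 / (Cmod (x - d) + 1))%R) as [N1 HN1].
  { apply Rdiv_lt_0_compat; lra. }
  destruct (geom_half_lim (r * (2 * M / r)) (eps / 2) ltac:(lra)) as [N2 HN2].
  exists (S (N1 + N2)). intros n Hn.
  (* Summation by parts with [qcoef_rec]: the partial sums satisfy the identity up to one boundary
     term, which is O(2^(-n)). *)
  assert (E : forall n, psum a x n
     = PS a d + (x - d) * psum (qcoef a d) x n - x * (qcoef a d n * x ^ n)
       + d * 0).
  { clear - Hb Hd. induction n as [|n IH].
    - rewrite !psum_0. rewrite (PS_rec a M r d Hb Hd). simpl. ring.
    - rewrite !psum_S, IH. rewrite (qcoef_rec a M r d n Hb Hd). simpl. ring. }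
  rewrite E.
  specialize (HN1 n ltac:(lia)). specialize (HN2 n ltac:(lia)).
  apply Rlt_div_r in HN1; [|lra].
  pose proof (coef_bound_term _ _ _ x n Hq) as Ht.
  replace (PS a d + (x - d) * psum (qcoef a d) x n - x * (qcoef a d n * x ^ n) + d * 0
     - (PS a d + (x - d) * L))
    with ((x - d) * (psum (qcoef a d) x n - L) + - (x * (qcoef a d n * x ^ n))) by ring.
  eapply Rle_lt_trans; [apply Cmod_triangle|].
  rewrite Cmod_opp, !(Cmod_mult x), (Cmod_mult (x - d)).
  assert (Hxr : (0 <= Cmod x / r <= 1 / 2)%R).
  { split; [apply Rdiv_le_0_compat; [apply Cmod_ge_0|lra]|apply div_le_of_le_mul; lra]. }
  assert (Hpw : ((Cmod x / r) ^ n <= (1 / 2) ^ n)%R) by (apply pow_incr, Hxr).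
  pose proof (coef_bound_nonneg _ _ _ Hq) as HM.
  pose proof (Cmod_ge_0 x). pose proof (Cmod_ge_0 (qcoef a d n * x ^ n)).
  assert ((Cmod x * Cmod (qcoef a d n * x ^ n) <= r * (2 * M / r) * (1 / 2) ^ n)%R).
  { rewrite Rmult_assoc. apply Rmult_le_compat; try lra. nra. }
  nra.
Qed.

Definition dcoef (a : nat -> C) (n : nat) : C := RtoC (INR (S n)) * a (S n).

Lemma INR_le_pow2 n : (INR (S n) <= 2 ^ n)%R.
Proof.
  induction n as [|n IH]; [simpl; lra|].
  rewrite S_INR. simpl pow. pose proof (pow_R1_Rle 2 n ltac:(lra)). lra.
Qed.

(** The factor n + 1 from differentiation is at most 2^n, so halving the radius absorbs it. *)
Lemma dcoef_bound a M r : coef_bound a M r -> coef_bound (dcoef a) (M / r) (r / 2).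
Proof.
  intros [Hr Hb]. split; [lra|]. intro k. unfold dcoef.
  rewrite Cmod_mult, Cmod_R, Rabs_right by (apply Rle_ge, pos_INR).
  specialize (Hb (S k)). simpl pow in Hb.
  apply le_div_of_mul_le; [exact Hr|].
  replace ((r / 2) ^ k)%R with (r ^ k / 2 ^ k)%R.
  2:{ unfold Rdiv. rewrite Rpow_mult_distr, pow_inv. reflexivity. }
  pose proof (INR_le_pow2 k) as Hi. pose proof (pow_lt 2 k ltac:(lra)) as H2.
  pose proof (pow_lt r k Hr) as Hrk. pose proof (Cmod_ge_0 (a (S k))) as Ha.
  replace (INR (S k) * Cmod (a (S k)) * (r ^ k / 2 ^ k) * r)%R
    with (INR (S k) / 2 ^ k * (Cmod (a (S k)) * (r * r ^ k)))%R by (field; lra).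
  assert ((INR (S k) / 2 ^ k <= 1)%R) by (apply div_le_of_le_mul; lra).
  assert (0 <= INR (S k) / 2 ^ k)%R by (apply Rdiv_le_0_compat; [apply pos_INR|lra]).
  assert (0 <= Cmod (a (S k)) * (r * r ^ k))%R by (repeat apply Rmult_le_pos; lra). nra.
Qed.

(** The divided difference on the diagonal is the derivative. The partial sums differ by a boundary
    term carrying a factor n + 1; |d| <= r/4 supplies 4^(-n), of which one 2^(-n) beats that factor
    and the other tends to 0. *)
Lemma PS_dcoef a M r d :
  coef_bound a M r -> (Cmod d <= r / 4)%R -> PS (qcoef a d) d = PS (dcoef a) d.
Proof.
  intros Hb Hd'. assert (Hr : (0 < r)%R) by apply Hb.
  assert (Hd : (Cmod d <= r / 2)%R) by lra.
  pose proof (qcoef_bound a M r d Hb Hd) as Hq.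
  pose proof (dcoef_bound a M r Hb) as Hdc.
  apply PS_unique, is_pseries_C. intros eps He.
  pose proof (PS_correct _ _ _ d Hdc ltac:(lra)) as H1. rewrite is_pseries_C in H1.
  destruct (H1 (eps / 2)%R ltac:(lra)) as [N1 HN1].
  destruct (geom_half_lim (2 * M / r) (eps / 2) ltac:(lra)) as [N2 HN2].
  exists (S (N1 + N2)). intros n Hn.
  assert (E : forall n, psum (qcoef a d) d n
     = psum (dcoef a) d n + RtoC (INR (S n)) * (qcoef a d (S n) * d ^ (S n))).
  { clear - Hb Hd. induction n as [|n IH].
    - rewrite !psum_0. unfold dcoef. rewrite (qcoef_rec a M r d 0 Hb Hd). change (INR 1) with 1%R. rewrite Cpow_S. change (d ^ 0) with (RtoC 1). ring.
    - rewrite !psum_S, IH. change (dcoef a (S n)) with (RtoC (INR (S (S n))) * a (S (S n))).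
      rewrite (qcoef_rec a M r d (S n) Hb Hd).
      rewrite (S_INR (S n)), RtoC_plus. rewrite !Cpow_S. ring. }
  rewrite E. specialize (HN1 n ltac:(lia)). specialize (HN2 (S n) ltac:(lia)).
  replace (psum (dcoef a) d n + RtoC (INR (S n)) * (qcoef a d (S n) * d ^ S n) - PS (dcoef a) d)
    with ((psum (dcoef a) d n - PS (dcoef a) d) + RtoC (INR (S n)) * (qcoef a d (S n) * d ^ S n))
    by ring.
  eapply Rle_lt_trans; [apply Cmod_triangle|].
  rewrite (Cmod_mult (RtoC (INR (S n)))), Cmod_R, Rabs_right by (apply Rle_ge, pos_INR).
  pose proof (coef_bound_term _ _ _ d (S n) Hq) as Ht.
  pose proof (coef_bound_nonneg _ _ _ Hq) as HM.
  assert (Hxr : (0 <= Cmod d / r <= 1 / 4)%R).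
  { split; [apply Rdiv_le_0_compat; [apply Cmod_ge_0|lra]|apply div_le_of_le_mul; lra]. }
  assert (Hpw : ((Cmod d / r) ^ S n <= (1 / 4) ^ S n)%R) by (apply pow_incr, Hxr).
  assert (E4 : ((1 / 4) ^ S n = (1 / 2) ^ S n * (1 / 2) ^ S n)%R).
  { rewrite <- Rpow_mult_distr. f_equal; lra. }
  pose proof (INR_le_pow2 n) as Hi.
  assert (E2 : (2 ^ n * (1 / 2) ^ S n = 1 / 2)%R).
  { simpl. replace (2 ^ n * (1 / 2 * (1 / 2) ^ n))%R with (1/2 * (2 ^ n * (1/2) ^ n))%R by ring.
    rewrite <- Rpow_mult_distr. replace (2 * (1 / 2))%R with 1%R by field. rewrite pow1. ring. }
  pose proof (pow_lt (1/2) (S n) ltac:(lra)) as Hp2.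
  pose proof (pos_INR (S n)).
  set (w := ((1/2) ^ S n)%R) in *. set (I := INR (S n)) in *.
  assert ((I * w <= 1 / 2)%R) by nra.
  set (X := Cmod (qcoef a d (S n) * d ^ S n)) in *.
  assert (HX : (X <= (2 * M / r) * (w * w))%R) by (rewrite <- E4; nra).
  set (MM := (2 * M / r)%R) in *.
  assert ((I * X <= MM * w * (I * w))%R) by nra.
  assert (0 <= MM * w)%R by nra.
  assert (MM * w * (I * w) <= MM * w * (1/2))%R by (apply Rmult_le_compat_l; assumption).
  lra.
Qed.

(* The k-th Taylor coefficient at d is PS (iter_q a d k) d, by iterating PS_quotient. *)
Fixpoint iter_q (a : nat -> C) (d : C) (k : nat) : nat -> C :=
  match k with O => a | S k => qcoef (iter_q a d k) d end.

Lemma iter_q_bound a M r d k :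
  coef_bound a M r -> (Cmod d <= r / 2)%R -> coef_bound (iter_q a d k) (M * (2 / r) ^ k) r.
Proof.
  intros Hb Hd. induction k as [|k IH]; simpl.
  - now rewrite Rmult_1_r.
  - replace (M * (2 / r * (2 / r) ^ k))%R with (2 * (M * (2 / r) ^ k) / r)%R.
    + now apply qcoef_bound.
    + unfold Rdiv. ring.
Qed.

(** Iterating the divided difference at d gives Taylor's formula with remainder h^(n+1) times a
    series bounded by 2 M (2/r)^(n+1); for |h| <= r/8 this is at most 2 M 4^(-(n+1)). *)
Lemma PS_recenter a M r d :
  coef_bound a M r -> (Cmod d <= r / 4)%R ->
  exists b, coef_bound b (2 * M) (r / 2) /\
    forall h, (Cmod h <= r / 8)%R -> is_pseries b h (PS a (d + h)).
Proof.
  intros Hb Hd. assert (Hr : (0 < r)%R) by apply Hb.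
  assert (Hd2 : (Cmod d <= r / 2)%R) by lra.
  pose proof (fun k => iter_q_bound a M r d k Hb Hd2) as Hk.
  exists (fun k => PS (iter_q a d k) d). split.
  - split; [lra|]. intro k.
    pose proof (pseries_bound _ _ _ d _ (Hk k) Hd2 (PS_correct _ _ _ d (Hk k) Hd2)) as H.
    apply Rle_trans with (2 * (M * (2 / r) ^ k) * (r / 2) ^ k)%R.
    + apply Rmult_le_compat_r; [apply pow_le; lra|exact H].
    + replace (2 * (M * (2 / r) ^ k) * (r / 2) ^ k)%R with (2 * M * ((2 / r) ^ k * (r / 2) ^ k))%R by ring.
      rewrite <- Rpow_mult_distr. replace (2 / r * (r / 2))%R with 1%R by (field; lra).
      rewrite pow1. lra.
  - intros h Hh. apply is_pseries_C. intros eps He.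
    assert (Hx : (Cmod (d + h) <= r / 2)%R).
    { eapply Rle_trans; [apply Cmod_triangle|]. lra. }
    assert (E : forall n, PS a (d + h) = psum (fun k => PS (iter_q a d k) d) h n
               + h ^ S n * PS (iter_q a d (S n)) (d + h)).
    { induction n as [|n IH].
      - rewrite psum_0. simpl. pose proof (PS_quotient a M r (d + h) d Hb Hd2 Hx) as Q.
        replace (d + h - d) with h in Q by ring.
        replace (PS a (d + h)) with (PS a d + (PS a (d + h) - PS a d)) by ring.
        rewrite Q. ring.
      - rewrite IH, psum_S.
        pose proof (PS_quotient _ _ r (d + h) d (Hk (S n)) Hd2 Hx) as Q.
        replace (d + h - d) with h in Q by ring.
        change (qcoef (iter_q a d (S n)) d) with (iter_q a d (S (S n))) in Q.
        replace (PS (iter_q a d (S n)) (d + h)) with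
          (PS (iter_q a d (S n)) d + (PS (iter_q a d (S n)) (d + h) - PS (iter_q a d (S n)) d)) by ring.
        rewrite Q. rewrite !Cpow_S. ring. }
    destruct (geom_half_lim (2 * M) eps He) as [N HN].
    exists N. intros n Hn. rewrite (E n).
    set (p := psum _ h n).
    replace (p - (p + h ^ S n * PS (iter_q a d (S n)) (d + h)))
      with (- (h ^ S n * PS (iter_q a d (S n)) (d + h))) by ring.
    rewrite Cmod_opp, Cmod_mult, Cmod_pow.
    pose proof (pseries_bound _ _ _ (d + h) _ (Hk (S n)) Hx (PS_correct _ _ _ _ (Hk (S n)) Hx)) as HB.
    specialize (HN (S n) ltac:(lia)).
    pose proof (Cmod_ge_0 h). pose proof (coef_bound_nonneg _ _ _ Hb) as HM.
    eapply Rle_lt_trans; [|exact HN].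
    apply Rle_trans with (Cmod h ^ S n * (2 * (M * (2 / r) ^ S n)))%R.
    + apply Rmult_le_compat_l; [apply pow_le; lra|exact HB].
    + replace (Cmod h ^ S n * (2 * (M * (2 / r) ^ S n)))%R
        with (2 * M * (Cmod h ^ S n * (2 / r) ^ S n))%R by ring.
      apply Rmult_le_compat_l; [lra|].
      rewrite <- Rpow_mult_distr. apply pow_incr. split.
      * apply Rmult_le_pos; [lra|]. apply Rdiv_le_0_compat; lra.
      * replace (Cmod h * (2 / r))%R with (2 * Cmod h / r)%R by (field; lra).
        apply div_le_of_le_mul; lra.
Qed.

(** * Analytic and meromorphic functions *)

(** The uniform structure on C has square balls; the factor sqrt 2 compares them with discs. *)
Lemma locally_C (t0 : C) (P : C -> Prop) :
  @locally C_UniformSpace t0 P <->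
  exists eps : R, (0 < eps)%R /\ forall t, (Cmod (t - t0) < eps)%R -> P t.
Proof.
  split.
  - intros [[eps He] H]. exists eps. split; [exact He|]. intros t Ht. apply H.
    exact (C_NormedModule_mixin_compat1 t0 t eps Ht).
  - intros [eps [He H]]. assert (Hs : (0 < sqrt 2)%R) by (apply sqrt_lt_R0; lra).
    assert (He2 : (0 < eps / sqrt 2)%R) by now apply Rdiv_lt_0_compat.
    exists (mkposreal _ He2). intros t Ht. apply H.
    pose proof (C_NormedModule_mixin_compat2 t0 t (mkposreal _ He2) Ht) as K. simpl in K.
    replace (sqrt 2 * (eps / sqrt 2))%R with eps in K by (field; lra). exact K.
Qed.

Lemma coef_bound_of_convergence (a : nat -> C) (r : R) (l : C) :
  (0 < r)%R -> is_pseries a (RtoC r) l -> exists M, coef_bound a M r.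
Proof.
  intros Hr H. rewrite is_pseries_C in H. destruct (H 1%R ltac:(lra)) as [N HN].
  assert (Hfin : forall n, exists M, forall k, (k <= n)%nat -> (Cmod (a k) * r ^ k <= M)%R).
  { induction n as [|n [M IH]].
    - exists (Cmod (a 0%nat) * r ^ 0)%R. intros k Hk. replace k with 0%nat by lia. lra.
    - exists (Rmax M (Cmod (a (S n)) * r ^ S n)). intros k Hk.
      destruct (Nat.eq_dec k (S n)) as [->|Hne]; [apply Rmax_r|].
      eapply Rle_trans; [apply IH; lia|apply Rmax_l]. }
  destruct (Hfin N) as [M HM]. exists (Rmax M 2). split; [exact Hr|]. intro k.
  destruct (le_lt_dec k N) as [Hk|Hk].
  - eapply Rle_trans; [apply HM, Hk|apply Rmax_l].
  - eapply Rle_trans; [|apply Rmax_r]. destruct k as [|k]; [lia|].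
    pose proof (HN k ltac:(lia)) as H1. pose proof (HN (S k) ltac:(lia)) as H2.
    rewrite psum_S in H2.
    pose proof (Cmod_triangle (psum a r k + a (S k) * r ^ S k - l) (- (psum a r k - l))) as Ht.
    rewrite Cmod_opp in Ht.
    replace (psum a r k + a (S k) * r ^ S k - l + - (psum a r k - l)) with (a (S k) * r ^ S k) in Ht by ring.
    rewrite Cmod_mult, Cmod_pow, Cmod_R, (Rabs_right r) in Ht by lra. lra.
Qed.

Lemma analytic_at_PS (f : C -> C) (t0 : C) :
  analytic_at f t0 <->
  exists a M r, coef_bound a M r /\ forall t, (Cmod (t - t0) <= r / 2)%R -> f t = PS a (t - t0).
Proof.
  split.
  - intros [a Ha]. apply locally_C in Ha. destruct Ha as [eps [He H]].
    pose proof (H (t0 + RtoC (eps / 2))) as H1.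
    replace (t0 + RtoC (eps / 2) - t0) with (RtoC (eps / 2)) in H1 by ring.
    rewrite Cmod_R, Rabs_right in H1 by lra. specialize (H1 ltac:(lra)).
    destruct (coef_bound_of_convergence a (eps / 2) _ ltac:(lra) H1) as [M HM].
    exists a, M, (eps / 2)%R. split; [exact HM|]. intros t Ht.
    symmetry. apply PS_unique. apply H. lra.
  - intros [a [M [r [Hb H]]]]. exists a. apply locally_C. assert (Hr : (0 < r)%R) by apply Hb.
    exists (r / 2)%R. split; [lra|]. intros t Ht. rewrite H by lra.
    apply (PS_correct a M r); [exact Hb|lra].
Qed.

Lemma analytic_at_ext (f g : C -> C) (t0 : C) (eps : R) :
  (0 < eps)%R -> (forall t, (Cmod (t - t0) < eps)%R -> f t = g t) ->
  analytic_at g t0 -> analytic_at f t0.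
Proof.
  intros He E [a Ha]. exists a. apply locally_C in Ha. destruct Ha as [e2 [He2 H]].
  apply locally_C. exists (Rmin eps e2). split; [now apply Rmin_pos|]. intros t Ht.
  minmax.
  rewrite E by lra. apply H. lra.
Qed.

Lemma analytic_at_open (f : C -> C) (t0 : C) :
  analytic_at f t0 ->
  exists eps, (0 < eps)%R /\ forall t, (Cmod (t - t0) < eps)%R -> analytic_at f t.
Proof.
  intro Hf. apply analytic_at_PS in Hf. destruct Hf as [a [M [r [Hb H]]]].
  assert (Hr : (0 < r)%R) by apply Hb.
  exists (r / 4)%R. split; [lra|]. intros t1 Ht1.
  destruct (PS_recenter a M r (t1 - t0) Hb ltac:(lra)) as [b [_ Hbs]].
  exists b. apply locally_C. exists (r / 8)%R. split; [lra|]. intros t Ht.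
  rewrite H.
  - replace (t - t0) with ((t1 - t0) + (t - t1)) by ring. apply Hbs. lra.
  - replace (t - t0) with ((t1 - t0) + (t - t1)) by ring.
    eapply Rle_trans; [apply Cmod_triangle|]. lra.
Qed.

(** Differentiability with a quadratic remainder. Analytic functions satisfy it at once, the
    remainder being a second divided difference, and it restricts to lines without filters. *)
Definition cder (f : C -> C) (t d : C) : Prop :=
  exists K eps, (0 < eps)%R /\ forall t', (Cmod (t' - t) < eps)%R ->
    (Cmod (f t' - f t - d * (t' - t)) <= K * Cmod (t' - t) ^ 2)%R.

Lemma analytic_at_derivative (f : C -> C) (t0 : C) :
  analytic_at f t0 ->
  exists g eps, (0 < eps)%R /\ analytic_at g t0 /\
    forall t, (Cmod (t - t0) < eps)%R -> cder f t (g t).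
Proof.
  intro Hf. apply analytic_at_PS in Hf. destruct Hf as [a [M [r [Hb H]]]].
  assert (Hr : (0 < r)%R) by apply Hb.
  exists (fun t => PS (dcoef a) (t - t0)), (r / 4)%R. split; [lra|]. split.
  - apply analytic_at_PS. exists (dcoef a), (M / r)%R, (r / 2)%R.
    split; [now apply dcoef_bound|]. reflexivity.
  - intros t Ht. set (d := t - t0) in *.
    assert (Hd : (Cmod d <= r / 2)%R) by lra.
    pose proof (qcoef_bound a M r d Hb Hd) as Hq.
    pose proof (qcoef_bound _ _ r d Hq Hd) as Hqq.
    exists (2 * (2 * (2 * M / r) / r))%R, (r / 4)%R. split; [lra|]. intros t' Ht'.
    assert (Hx : (Cmod (t' - t0) <= r / 2)%R).
    { replace (t' - t0) with ((t' - t) + d) by (unfold d; ring).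
      eapply Rle_trans; [apply Cmod_triangle|]. lra. }
    rewrite !H by (fold d; lra). fold d.
    rewrite <- (PS_dcoef a M r d Hb ltac:(lra)).
    pose proof (PS_quotient a M r (t' - t0) d Hb Hd Hx) as Q1.
    pose proof (PS_quotient _ _ r (t' - t0) d Hq Hd Hx) as Q2.
    replace (t' - t0 - d) with (t' - t) in * by (unfold d; ring).
    replace (PS a (t' - t0) - PS a d - PS (qcoef a d) d * (t' - t))
      with ((t' - t) * (t' - t) * PS (qcoef (qcoef a d) d) (t' - t0)).
    2:{ rewrite Q1. replace (PS (qcoef a d) (t' - t0)) with
          (PS (qcoef a d) d + (PS (qcoef a d) (t' - t0) - PS (qcoef a d) d)) by ring.
        rewrite Q2. ring. }
    rewrite !Cmod_mult.
    pose proof (pseries_bound _ _ _ _ _ Hqq Hx (PS_correct _ _ _ _ Hqq Hx)) as HB.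
     simpl pow.
    assert (0 <= Cmod (t' - t) * Cmod (t' - t))%R by nra. nra.
Qed.

Lemma cder_continuous f t d : cder f t d ->
  forall eps, (0 < eps)%R -> exists del, (0 < del)%R /\
    forall t', (Cmod (t' - t) < del)%R -> (Cmod (f t' - f t) < eps)%R.
Proof.
  intros [K [e0 [He0 H]]] eps He.
  set (L := (Rabs K + Cmod d + 1)%R).
  assert (HL : (0 < L)%R) by (unfold L; pose proof (Rabs_pos K); pose proof (Cmod_ge_0 d); lra).
  exists (Rmin e0 (Rmin 1 (eps / L))). split.
  { repeat apply Rmin_pos; try lra. now apply Rdiv_lt_0_compat. }
  intros t' Ht'. minmax.
  specialize (H t' ltac:(lra)).
  set (x := Cmod (t' - t)) in *. assert (Hx : (0 <= x)%R) by apply Cmod_ge_0.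
  assert (HxL : (x * L < eps)%R).
  { apply mul_lt_of_lt_div; [exact HL|]. lra. }
  pose proof (Cmod_triangle (f t' - f t - d * (t' - t)) (d * (t' - t))) as Ht.
  replace (f t' - f t - d * (t' - t) + d * (t' - t)) with (f t' - f t) in Ht by ring.
  rewrite (Cmod_mult d) in Ht. fold x in Ht.
  pose proof (Rle_abs K). pose proof (Rabs_pos K). unfold L in HxL.
  assert (Hxx : (x ^ 2 <= x)%R) by (simpl; nra).
  assert ((K * x ^ 2 <= Rabs K * x)%R).
  { apply Rle_trans with (Rabs K * x ^ 2)%R; [|nra].
    apply Rmult_le_compat_r; [simpl; nra|lra]. }
  nra.
Qed.

Lemma analytic_at_continuous f t0 : analytic_at f t0 ->
  forall eps, (0 < eps)%R -> exists del, (0 < del)%R /\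
    forall t, (Cmod (t - t0) < del)%R -> (Cmod (f t - f t0) < eps)%R.
Proof.
  intro Hf. destruct (analytic_at_derivative f t0 Hf) as [g [e [He [_ H]]]].
  apply (cder_continuous f t0 (g t0)). apply H.
  replace (t0 - t0) with (RtoC 0) by ring. rewrite Cmod_0. exact He.
Qed.

(** If some coefficient is nonzero, the first such term a_m h^m dominates the tail near 0. This is
    the source of every identity-theorem argument below. *)
Lemma PS_zero_dichotomy a M r :
  coef_bound a M r ->
  (forall h, PS a h = 0) \/
  (exists eps, (0 < eps <= r / 2)%R /\ forall h, (0 < Cmod h < eps)%R -> PS a h <> 0).
Proof.
  intro Hb. assert (Hr : (0 < r)%R) by apply Hb.
  destruct (classic (exists m, a m <> 0)) as [Hex|Hno].
  - right.
    destruct (dec_inh_nat_subset_has_unique_least_element (fun m => a m <> 0)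
      (fun m => classic (a m <> 0)) Hex) as [m [[Hm Hmin] _]].
    assert (Hlow : forall k, (k < m)%nat -> a k = 0).
    { intros k Hk. apply NNPP. intro Hc. specialize (Hmin k Hc). lia. }
    pose proof (coef_bound_nonneg _ _ _ Hb) as HM.
    assert (Hps : forall h n, (n < m)%nat -> psum a h n = 0).
    { intros h n Hn. induction n as [|n IH].
      - rewrite psum_0. now apply Hlow.
      - rewrite psum_S, IH, (Hlow (S n)) by lia. ring. }
    assert (Hpm : forall h, psum a h m = a m * h ^ m).
    { intro h. destruct m as [|m]; [rewrite psum_0; simpl; ring|].
      rewrite psum_S, Hps by lia. ring. }
    apply Cmod_gt_0 in Hm.
    (* The tail after a_m h^m is less than Q |h|^(m+1), so |h| Q < |a_m| forbids a zero. *)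
    set (Q := (2 * M / r ^ S m + 1)%R).
    assert (HQ : (0 < Q)%R).
    { unfold Q. assert (0 <= 2 * M / r ^ S m)%R; [|lra].
      apply Rdiv_le_0_compat; [lra|apply pow_lt; lra]. }
    exists (Rmin (r / 2) (Cmod (a m) / Q)). split.
    { split; [apply Rmin_pos; [lra|now apply Rdiv_lt_0_compat]|apply Rmin_l]. }
    intros h [Hh0 Hh] E0.
    minmax.
    assert (Hh2 : (Cmod h <= r / 2)%R) by lra.
    pose proof (pseries_tail a M r h _ m Hb Hh2 (PS_correct a M r h Hb Hh2)) as Ht.
    rewrite Hpm, E0 in Ht.
    replace (0 - a m * h ^ m) with (- (a m * h ^ m)) in Ht by ring.
    rewrite Cmod_opp, Cmod_mult, Cmod_pow in Ht.
    replace (2 * M * (Cmod h / r) ^ S m)%R with (2 * M / r ^ S m * Cmod h * Cmod h ^ m)%R in Ht.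
    2:{ unfold Rdiv. rewrite Rpow_mult_distr, pow_inv. simpl. field. split; [apply pow_nonzero; lra|lra]. }
    pose proof (pow_lt (Cmod h) m Hh0) as Hp.
    apply Rmult_le_reg_r in Ht; [|exact Hp].
    assert (HQh : (Cmod h * Q < Cmod (a m))%R) by (apply mul_lt_of_lt_div; lra).
    unfold Q in HQh. nra.
  - left. intro h. apply PS_unique, is_pseries_C. intros eps He. exists 0%nat. intros n _.
    assert (Hz : forall k, a k = 0) by (intro k; apply NNPP; intro Hc; apply Hno; now exists k).
    replace (psum a h n) with (RtoC 0); [replace (0 - 0) with (RtoC 0) by ring; now rewrite Cmod_0|].
    induction n as [|n IH]; [now rewrite psum_0|]. rewrite psum_S, <- IH, Hz. ring.
Qed.

Lemma analytic_zero_dichotomy (f : C -> C) (t0 : C) :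
  analytic_at f t0 ->
  (exists eps, (0 < eps)%R /\ forall t, (Cmod (t - t0) < eps)%R -> f t = 0) \/
  (exists eps, (0 < eps)%R /\ forall t, (0 < Cmod (t - t0) < eps)%R -> f t <> 0).
Proof.
  intro Hf. apply analytic_at_PS in Hf. destruct Hf as [a [M [r [Hb H]]]].
  assert (Hr : (0 < r)%R) by apply Hb.
  destruct (PS_zero_dichotomy a M r Hb) as [H0|[e [[He He2] H0]]].
  - left. exists (r / 2)%R. split; [lra|]. intros t Ht. rewrite H by lra. apply H0.
  - right. exists e. split; [exact He|]. intros t Ht. rewrite H by lra. apply H0. exact Ht.
Qed.

(* The Taylor coefficients of g/(t - t0) at t1, from (d + h) * quotient = g with d = t1 - t0. *)
Fixpoint div_coef (b : nat -> C) (d : C) (k : nat) : C :=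
  match k with O => b 0%nat / d | S k => (b (S k) - div_coef b d k) / d end.

Lemma analytic_at_div_linear (g : C -> C) (t0 t1 : C) :
  t1 <> t0 -> analytic_at g t1 -> analytic_at (fun t => g t / (t - t0)) t1.
Proof.
  intros Hne Hg. apply analytic_at_PS in Hg. destruct Hg as [b [M [r [Hb H]]]].
  assert (Hr : (0 < r)%R) by apply Hb.
  set (d := t1 - t0).
  assert (Hd : d <> 0). { intro E. apply Hne. replace t1 with (d + t0) by (unfold d; ring). rewrite E. ring. }
  assert (Hd0 : (0 < Cmod d)%R) by now apply Cmod_gt_0.
  (* With q <= |d|/2 the recursion for [div_coef] contracts by 1/2 in the weighted norm, so the
     bound 2 M / |d| reproduces itself. *)
  set (q := Rmin r (Cmod d / 2)).
  assert (Hq : (0 < q)%R) by (apply Rmin_pos; lra).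
  assert (Hqr : (q <= r)%R) by apply Rmin_l.
  assert (Hqd : (q <= Cmod d / 2)%R) by apply Rmin_r.
  pose proof (coef_bound_nonneg _ _ _ Hb) as HM.
  assert (Hbq : forall k, (Cmod (b k) * q ^ k <= M)%R).
  { intro k. eapply Rle_trans; [|apply (proj2 Hb k)]. apply Rmult_le_compat_l; [apply Cmod_ge_0|].
    apply pow_incr. lra. }
  assert (Hc : coef_bound (div_coef b d) (2 * M / Cmod d) q).
  { split; [exact Hq|]. induction k as [|k IH].
    - simpl. rewrite Cmod_div by exact Hd. specialize (Hbq 0%nat). simpl in Hbq.
      rewrite Rmult_1_r in *. apply Rmult_le_compat_r; [left; now apply Rinv_0_lt_compat|].
       lra.
    - cbn [div_coef]. rewrite Cmod_div by exact Hd.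
      pose proof (Cmod_triangle (b (S k)) (- div_coef b d k)) as Ht. rewrite Cmod_opp in Ht.
      change (b (S k) + - div_coef b d k) with (b (S k) - div_coef b d k) in Ht.
      specialize (Hbq (S k)). pose proof (pow_lt q k Hq) as Hp.
      apply Rle_trans with ((M + q * (2 * M / Cmod d)) / Cmod d)%R.
      + unfold Rdiv. rewrite Rmult_assoc, (Rmult_comm (/ Cmod d)), <- Rmult_assoc.
        apply Rmult_le_compat_r; [left; now apply Rinv_0_lt_compat|].
        change (q ^ S k)%R with (q * q ^ k)%R in *.
        apply Rle_trans with ((Cmod (b (S k)) + Cmod (div_coef b d k)) * (q * q ^ k))%R.
        * apply Rmult_le_compat_r; [nra|exact Ht].
        * unfold Rdiv in IH. nra.
      + apply Rmult_le_compat_r; [left; now apply Rinv_0_lt_compat|].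
        assert (q * (2 * M / Cmod d) <= M)%R; [|lra].
        replace (q * (2 * M / Cmod d))%R with (2 * q * M / Cmod d)%R by (field; lra).
        apply div_le_of_le_mul; [exact Hd0|]. nra. }
  apply analytic_at_PS. exists (div_coef b d), (2 * M / Cmod d)%R, q. split; [exact Hc|].
  intros t Ht. rewrite H by lra. set (h := t - t1) in *.
  replace (t - t0) with (d + h) by (unfold d, h; ring).
  assert (Hdh : d + h <> 0).
  { apply Cmod_gt_0. pose proof (Cmod_triangle (d + h) (- h)) as K. rewrite Cmod_opp in K.
    replace (d + h + - h) with d in K by ring. lra. }
  assert (E : PS b h = (d + h) * PS (div_coef b d) h); [|rewrite E; field; exact Hdh].
  apply PS_unique, is_pseries_C. intros eps He.
  pose proof (PS_correct _ _ _ h Hc Ht) as H1. rewrite is_pseries_C in H1.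
  pose proof (Cmod_ge_0 (d + h)) as Hn.
  destruct (H1 (eps / 2 / (Cmod (d + h) + 1))%R) as [N1 HN1].
  { apply Rdiv_lt_0_compat; lra. }
  destruct (geom_half_lim (q * (2 * M / Cmod d)) (eps / 2) ltac:(lra)) as [N2 HN2].
  exists (N1 + N2)%nat. intros n Hnn.
  assert (Ep : forall n, psum b h n = (d + h) * psum (div_coef b d) h n - h * (div_coef b d n * h ^ n)).
  { clear - Hd. induction n as [|n IH].
    - rewrite !psum_0. simpl. field. exact Hd.
    - rewrite !psum_S, IH. cbn [div_coef]. rewrite Cpow_S. field. exact Hd. }
  rewrite Ep. specialize (HN1 n ltac:(lia)). specialize (HN2 n ltac:(lia)).
  apply Rlt_div_r in HN1; [|lra].
  set (L := PS (div_coef b d) h) in *.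
  replace ((d + h) * psum (div_coef b d) h n - h * (div_coef b d n * h ^ n) - (d + h) * L)
    with ((d + h) * (psum (div_coef b d) h n - L) + - (h * (div_coef b d n * h ^ n))) by ring.
  eapply Rle_lt_trans; [apply Cmod_triangle|].
  rewrite Cmod_opp, (Cmod_mult h), (Cmod_mult (d + h)).
  pose proof (coef_bound_term _ _ _ h n Hc) as Htm.
  assert (Hxr : (0 <= Cmod h / q <= 1 / 2)%R).
  { split; [apply Rdiv_le_0_compat; [apply Cmod_ge_0|lra]|apply div_le_of_le_mul; lra]. }
  assert (Hpw : ((Cmod h / q) ^ n <= (1 / 2) ^ n)%R) by (apply pow_incr, Hxr).
  pose proof (coef_bound_nonneg _ _ _ Hc) as HM2.
  pose proof (Cmod_ge_0 h). pose proof (Cmod_ge_0 (div_coef b d n * h ^ n)).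
  assert ((Cmod h * Cmod (div_coef b d n * h ^ n) <= q * (2 * M / Cmod d) * (1 / 2) ^ n)%R).
  { rewrite Rmult_assoc. apply Rmult_le_compat; try lra. nra. }
  nra.
Qed.

Lemma analytic_at_div_pow (g : C -> C) (t0 t1 : C) (n : nat) :
  t1 <> t0 -> analytic_at g t1 -> analytic_at (fun t => g t / (t - t0) ^ n) t1.
Proof.
  intros Hne Hg. assert (Hd : (0 < Cmod (t1 - t0))%R).
  { apply Cmod_gt_0. intro E. apply Hne. replace t1 with (t1 - t0 + t0) by ring. rewrite E; ring. }
  induction n as [|n IH].
  - apply (analytic_at_ext _ g t1 1 ltac:(lra)); [|exact Hg].
    intros t _. simpl. field.
  - apply (analytic_at_ext _ (fun t => g t / (t - t0) ^ n / (t - t0)) t1 _ Hd).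
    + intros t Ht. assert (t - t0 <> 0).
      { intro E. replace (t - t1) with (- (t1 - t0)) in Ht.
        - rewrite Cmod_opp in Ht. lra.
        - replace t with (t - t0 + t0) by ring. rewrite E. ring. }
      rewrite Cpow_S. field. split; [now apply Cpow_nz|assumption].
    + now apply analytic_at_div_linear.
Qed.

Lemma locally'_C (t0 : C) (P : C -> Prop) :
  @locally' C_UniformSpace t0 P <->
  exists eps : R, (0 < eps)%R /\ forall t, (0 < Cmod (t - t0) < eps)%R -> P t.
Proof.
  unfold locally', within. rewrite locally_C. split.
  - intros [e [He H]]. exists e. split; [exact He|]. intros t [H1 H2]. apply H; [exact H2|].
    intro E. rewrite E in H1. replace (t0 - t0) with (RtoC 0) in H1 by ring. rewrite Cmod_0 in H1. lra.
  - intros [e [He H]]. exists e. split; [exact He|]. intros t Ht Hne. apply H. split; [|exact Ht].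
    apply Cmod_gt_0. intro E. apply Hne. replace t with (t - t0 + t0) by ring. rewrite E.
    change (0 + t0 = t0). ring.
Qed.

Lemma pole_at_punctured (f : C -> C) (t0 : C) :
  pole_at f t0 ->
  exists eps, (0 < eps)%R /\
    forall t, (0 < Cmod (t - t0) < eps)%R -> analytic_at f t /\ f t <> 0.
Proof.
  intros [n [g [Hn [Hg [Hg0 Hf]]]]].
  destruct (analytic_at_open g t0 Hg) as [e1 [He1 H1]].
  apply locally'_C in Hf. destruct Hf as [e2 [He2 H2]].
  destruct (analytic_at_continuous g t0 Hg (Cmod (g t0))) as [e3 [He3 H3]]; [now apply Cmod_gt_0|].
  exists (Rmin e1 (Rmin e2 e3)). split; [now repeat apply Rmin_pos|]. intros t Ht.
  minmax.
  assert (Hne : t <> t0).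
  { intro E. rewrite E in Ht. replace (t0 - t0) with (RtoC 0) in Ht by ring. rewrite Cmod_0 in Ht. lra. }
  assert (Hz : t - t0 <> 0) by (apply Cmod_gt_0; lra).
  assert (Hp : pow_n (t - t0) n <> RtoC 0).
  { rewrite pow_n_Cpow. now apply Cpow_nz. }
  split.
  - apply (analytic_at_ext _ (fun t => g t / (t - t0) ^ n) t (Rmin (Cmod (t - t0)) (e2 - Cmod (t - t0)))).
    + apply Rmin_pos; lra.
    + intros t' Ht'. minmax.
      rewrite H2, pow_n_Cpow; [reflexivity|].
      pose proof (Cmod_triangle (t' - t) (t - t0)) as K1.
      replace (t' - t + (t - t0)) with (t' - t0) in K1 by ring.
      pose proof (Cmod_triangle (- (t' - t)) (t' - t0)) as K2. rewrite Cmod_opp in K2.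
      replace (- (t' - t) + (t' - t0)) with (t - t0) in K2 by ring. lra.
    + apply analytic_at_div_pow; [exact Hne|]. apply H1. lra.
  - rewrite H2 by lra. specialize (H3 t ltac:(lra)).
    intro E.
    assert (Eg : g t = 0).
    { replace (g t) with (g t / pow_n (t - t0) n * pow_n (t - t0) n) by (field; exact Hp).
      rewrite E. ring. }
    rewrite Eg in H3. replace (0 - g t0) with (- g t0) in H3 by ring. rewrite Cmod_opp in H3. lra.
Qed.

Lemma pole_at_unbounded (f : C -> C) (t0 : C) (B : R) :
  pole_at f t0 ->
  exists eps, (0 < eps)%R /\ forall t, (0 < Cmod (t - t0) < eps)%R -> (B < Cmod (f t))%R.
Proof.
  intros [n [g [Hn [Hg [Hg0 Hf]]]]].
  apply locally'_C in Hf. destruct Hf as [e2 [He2 H2]].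
  assert (Hg0' : (0 < Cmod (g t0))%R) by now apply Cmod_gt_0.
  destruct (analytic_at_continuous g t0 Hg (Cmod (g t0) / 2)) as [e3 [He3 H3]]; [lra|].
  (* Near t0 one has |g| > |g(t0)|/2, and |t - t0|^n <= |t - t0| since n >= 1; for |t - t0| < q the
     quotient exceeds B. *)
  set (q := (Cmod (g t0) / 2 / (Rabs B + 1))%R).
  pose proof (Rabs_pos B) as HB.
  assert (Hq : (0 < q)%R) by (apply Rdiv_lt_0_compat; lra).
  exists (Rmin e2 (Rmin e3 (Rmin 1 q))). split; [repeat apply Rmin_pos; lra|]. intros t Ht.
  minmax.
  assert (Hz : t - t0 <> 0) by (apply Cmod_gt_0; lra).
  rewrite H2, pow_n_Cpow by lra. specialize (H3 t ltac:(lra)).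
  rewrite Cmod_div by now apply Cpow_nz. rewrite Cmod_pow.
  set (x := Cmod (t - t0)) in *.
  assert (Hxn : (0 < x ^ n <= x)%R).
  { split; [apply pow_lt; lra|]. destruct n as [|n]; [lia|]. simpl.
    assert (x ^ n <= 1)%R; [|nra]. rewrite <- (pow1 n). apply pow_incr. lra. }
  apply lt_div_of_mul_lt; [lra|].
  assert (Hgt : (Cmod (g t0) / 2 < Cmod (g t))%R).
  { pose proof (Cmod_triangle (- (g t - g t0)) (g t)) as K. rewrite Cmod_opp in K.
    replace (- (g t - g t0) + g t) with (g t0) in K by ring. lra. }
  assert (Hxq : (x * (Rabs B + 1) < Cmod (g t0) / 2)%R).
  { apply mul_lt_of_lt_div; [lra|]. unfold q in *. lra. }
  pose proof (Rle_abs B).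
  assert ((B * x ^ n <= Rabs B * x)%R).
  { apply Rle_trans with (Rabs B * x ^ n)%R; [apply Rmult_le_compat_r; lra|apply Rmult_le_compat_l; lra]. }
  nra.
Qed.

(** Along the line, Im(w g) is the sum of the real power series with coefficients Im(w a_k v^k), so
    the zero dichotomy applies to it. The weight w will be 1 at a regular point and v^(-n) at a pole
    of order n. *)
Lemma Im_along_line_dichotomy (g : C -> C) (t0 w v : C) :
  Cmod v = 1%R -> analytic_at g t0 ->
  (exists eps, (0 < eps)%R /\
     forall s : R, (Rabs s < eps)%R -> Im (w * g (t0 + v * RtoC s)) = 0%R) \/
  (exists eps, (0 < eps)%R /\
     forall s : R, (0 < Rabs s < eps)%R -> Im (w * g (t0 + v * RtoC s)) <> 0%R).
Proof.
  intros Hv Hg. apply analytic_at_PS in Hg. destruct Hg as [a [M [r [Hb H]]]].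
  assert (Hr : (0 < r)%R) by apply Hb.
  set (c := fun k => RtoC (Im (w * (a k * v ^ k)))).
  assert (Hc : coef_bound c (Cmod w * M) r).
  { split; [exact Hr|]. intro k. unfold c. rewrite Cmod_R.
    pose proof (im_le_Cmod (w * (a k * v ^ k))) as K.
    rewrite !Cmod_mult, Cmod_pow, Hv, pow1, Rmult_1_r in K.
    pose proof (proj2 Hb k). pose proof (pow_lt r k Hr).
    pose proof (Cmod_ge_0 w).
    apply Rle_trans with (Cmod w * Cmod (a k) * r ^ k)%R; [nra|].
    rewrite Rmult_assoc. now apply Rmult_le_compat_l. }
  assert (Hvs : forall s : R, Cmod (v * RtoC s) = Rabs s).
  { intro s. rewrite Cmod_mult, Hv, Cmod_R. ring. }
  assert (Hs : forall s : R, (Rabs s <= r / 2)%R ->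
             PS c (RtoC s) = RtoC (Im (w * g (t0 + v * RtoC s)))).
  { intros s Hs. apply PS_unique, is_pseries_C. intros eps He.
    assert (Hle : (Cmod (v * RtoC s) <= r / 2)%R) by now rewrite Hvs.
    pose proof (PS_correct a M r _ Hb Hle) as H1. rewrite is_pseries_C in H1.
    pose proof (Cmod_ge_0 w).
    destruct (H1 (eps / (Cmod w + 1))%R) as [N HN]; [apply Rdiv_lt_0_compat; lra|].
    exists N. intros n Hn. specialize (HN n Hn). apply Rlt_div_r in HN; [|lra].
    assert (Ep : forall n, psum c (RtoC s) n = RtoC (Im (w * psum a (v * RtoC s) n))).
    { clear. induction n as [|n IH].
      - rewrite !psum_0. unfold c. simpl Cpow. now rewrite Cmult_1_r.
      - rewrite !psum_S, IH. unfold c at 1. rewrite <- RtoC_pow, <- RtoC_mult, <- RtoC_plus. f_equal.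
        rewrite Cmult_plus_distr_l, im_plus. f_equal.
        rewrite Cpow_mult_l, <- RtoC_pow.
        replace (w * (a (S n) * (v ^ S n * RtoC (s ^ S n)))) with ((w * (a (S n) * v ^ S n)) * RtoC (s ^ S n)) by ring.
        now rewrite im_scal_r. }
    rewrite Ep, H.
    2:{ replace (t0 + v * RtoC s - t0) with (v * RtoC s) by ring. exact Hle. }
    replace (t0 + v * RtoC s - t0) with (v * RtoC s) by ring.
    rewrite <- RtoC_minus, Cmod_R, <- Im_minus.
    set (p := psum a (v * RtoC s) n) in *. set (L := PS a (v * RtoC s)) in *.
    replace (w * p - w * L) with (w * (p - L)) by ring.
    eapply Rle_lt_trans; [apply im_le_Cmod|]. rewrite Cmod_mult.
     nra. }
  destruct (PS_zero_dichotomy c _ r Hc) as [H0|[e [[He He2] H0]]].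
  - left. exists (r / 2)%R. split; [lra|]. intros s Hss. specialize (Hs s ltac:(lra)).
    rewrite H0 in Hs. now apply RtoC_inj in Hs.
  - right. exists e. split; [exact He|]. intros s Hss E.
    apply (H0 (RtoC s)); [now rewrite Cmod_R|]. rewrite Hs by lra. now rewrite E.
Qed.

(** * Complex functions of a real variable *)

Ltac as_R := lazymatch goal with |- @eq _ ?a ?b => change (@eq R a b) end.

Definition is_cderiv (f : R -> C) (x : R) (d : C) : Prop :=
  is_derive (fun s => Re (f s)) x (Re d) /\ is_derive (fun s => Im (f s)) x (Im d).

Definition ccont (f : R -> C) (x : R) : Prop :=
  continuous (fun s => Re (f s)) x /\ continuous (fun s => Im (f s)) x.

Lemma C_ext (x y : C) : Re x = Re y -> Im x = Im y -> x = y.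
Proof. destruct x, y; simpl; intros; congruence. Qed.

Lemma is_cderiv_eq f x d d' : d = d' -> is_cderiv f x d -> is_cderiv f x d'.
Proof. now intros ->. Qed.

Lemma is_cderiv_const (c : C) x : is_cderiv (fun _ => c) x 0.
Proof. split; apply (is_derive_const (V := R_NormedModule)). Qed.

Lemma is_cderiv_RtoC (f : R -> R) x d : is_derive f x d -> is_cderiv (fun s => RtoC (f s)) x (RtoC d).
Proof.
  intro H. split; simpl; [exact H|]. apply (is_derive_const (V := R_NormedModule) 0%R).
Qed.

Lemma is_cderiv_id x : is_cderiv (fun s => RtoC s) x 1.
Proof. apply (is_cderiv_RtoC (fun s => s)). apply (is_derive_id (K := R_AbsRing)). Qed.

Lemma is_cderiv_plus f g x df dg :
  is_cderiv f x df -> is_cderiv g x dg -> is_cderiv (fun s => f s + g s) x (df + dg).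
Proof.
  intros [H1 H2] [H3 H4]; split; simpl.
  - now apply (is_derive_plus (V := R_NormedModule)).
  - now apply (is_derive_plus (V := R_NormedModule)).
Qed.

Lemma is_cderiv_opp f x df : is_cderiv f x df -> is_cderiv (fun s => - f s) x (- df).
Proof.
  intros [H1 H2]; split; simpl.
  - now apply (is_derive_opp (V := R_NormedModule)).
  - now apply (is_derive_opp (V := R_NormedModule)).
Qed.

Lemma is_cderiv_minus f g x df dg :
  is_cderiv f x df -> is_cderiv g x dg -> is_cderiv (fun s => f s - g s) x (df - dg).
Proof. intros H1 H2. apply is_cderiv_plus; [exact H1|]. now apply is_cderiv_opp. Qed.

Lemma is_derive_Rmult (f g : R -> R) x df dg :
  is_derive f x df -> is_derive g x dg ->
  is_derive (fun s => f s * g s)%R x (df * g x + f x * dg)%R.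
Proof.
  intros H1 H2. apply (is_derive_mult (K := R_AbsRing) f g x df dg H1 H2).
  intros n m. apply Rmult_comm.
Qed.

Lemma is_derive_Rplus (f g : R -> R) x df dg :
  is_derive f x df -> is_derive g x dg -> is_derive (fun s => f s + g s)%R x (df + dg)%R.
Proof. apply (is_derive_plus (V := R_NormedModule)). Qed.
Lemma is_derive_Rminus (f g : R -> R) x df dg :
  is_derive f x df -> is_derive g x dg -> is_derive (fun s => f s - g s)%R x (df - dg)%R.
Proof. apply (is_derive_minus (V := R_NormedModule)). Qed.

Lemma is_derive_eq (f : R -> R) x d d' : d = d' -> is_derive f x d -> is_derive f x d'.
Proof. now intros ->. Qed.

Lemma is_cderiv_mult f g x df dg :
  is_cderiv f x df -> is_cderiv g x dg ->
  is_cderiv (fun s => f s * g s) x (df * g x + f x * dg).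
Proof.
  intros [H1 H2] [H3 H4]; split.
  - eapply is_derive_ext; [intro s; symmetry; apply re_mult|].
    eapply is_derive_eq; [|apply is_derive_Rminus; apply is_derive_Rmult; eassumption].
    as_R. rewrite re_plus, !re_mult. ring.
  - eapply is_derive_ext; [intro s; symmetry; apply im_mult|].
    eapply is_derive_eq; [|apply is_derive_Rplus; apply is_derive_Rmult; eassumption].
    as_R. rewrite im_plus, !im_mult. ring.
Qed.

Lemma is_derive_Rdiv (f g : R -> R) x df dg :
  is_derive f x df -> is_derive g x dg -> g x <> 0%R ->
  is_derive (fun s => f s / g s)%R x ((df * g x - f x * dg) / (g x) ^ 2)%R.
Proof. intros. now apply is_derive_div. Qed.

Lemma norm2_nz (c : C) : c <> 0 -> (Re c * Re c + Im c * Im c)%R <> 0%R.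
Proof.
  intros H E. apply H. apply C_ext; simpl; nra.
Qed.

Lemma is_cderiv_inv (f : R -> C) x df : f x <> 0 -> is_cderiv f x df ->
  is_cderiv (fun s => / f s) x (- df / (f x * f x)).
Proof.
  intros Hne [H1 H2].
  assert (HN : is_derive (fun s => (Re (f s) * Re (f s) + Im (f s) * Im (f s))%R) x
     (Re df * Re (f x) + Re (f x) * Re df + (Im df * Im (f x) + Im (f x) * Im df))%R).
  { apply is_derive_Rplus; now apply is_derive_Rmult. }
  pose proof (norm2_nz _ Hne) as Hnz.
  assert (E : - df / (f x * f x) = - df * (Cconj (f x) * Cconj (f x)) / (RtoC ((Re (f x) * Re (f x) + Im (f x) * Im (f x)) ^ 2))).
  { rewrite RtoC_pow.
    replace (RtoC (Re (f x) * Re (f x) + Im (f x) * Im (f x))) with (f x * Cconj (f x)).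
    - assert (Cconj (f x) <> 0).
      { intro E. apply Hne. rewrite <- (Cconj_conj (f x)), E. apply C_ext; simpl; ring. }
      field. now split.
    - apply C_ext; simpl; unfold Re, Im; ring. }
  rewrite E. clear E. unfold Cdiv. rewrite <- RtoC_inv by (now apply pow_nonzero).
  set (u := Re (f x)) in *. set (w := Im (f x)) in *.
  split.
  - apply (is_derive_ext (fun s => (Re (f s) / (Re (f s) * Re (f s) + Im (f s) * Im (f s)))%R)).
    { intro s. unfold Re, Im, Cinv. cbn [fst snd]. as_R. f_equal; ring. }
    eapply is_derive_eq; [|apply is_derive_Rdiv; eassumption].
    fold u w. rewrite re_scal_r. destruct df as [p q]. unfold Cconj. unfold Re, Im in *. simpl. fold u w.
    change (fst (f x)) with u. change (snd (f x)) with w. field. exact Hnz.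
  - apply (is_derive_ext (fun s => (- Im (f s) / (Re (f s) * Re (f s) + Im (f s) * Im (f s)))%R)).
    { intro s. unfold Re, Im, Cinv. cbn [fst snd]. as_R. f_equal; ring. }
    eapply is_derive_eq; [|apply is_derive_Rdiv; [apply (is_derive_opp (V := R_NormedModule)); eassumption|eassumption|eassumption]].
    fold u w. rewrite im_scal_r. destruct df as [p q]. unfold Cconj. unfold Re, Im in *. simpl. fold u w.
    change (fst (f x)) with u. change (snd (f x)) with w. unfold opp. simpl. field. exact Hnz.
Qed.

Lemma is_cderiv_div (f g : R -> C) x df dg : g x <> 0 ->
  is_cderiv f x df -> is_cderiv g x dg ->
  is_cderiv (fun s => f s / g s) x ((df * g x - f x * dg) / (g x * g x)).
Proof.
  intros Hne H1 H2.
  eapply is_cderiv_eq; [|apply is_cderiv_mult; [exact H1|apply is_cderiv_inv; [exact Hne|exact H2]]].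
  cbv beta; field. exact Hne.
Qed.

Ltac cderiv := cbv beta;
  lazymatch goal with
  | H : is_cderiv ?f ?x _ |- is_cderiv ?f ?x _ => exact H
  | |- is_cderiv (fun _ => ?c) _ _ => apply is_cderiv_const
  | |- is_cderiv (fun s => RtoC s) _ _ => apply is_cderiv_id
  | |- is_cderiv (fun s => (@?f s + @?g s)%C) _ _ => apply (is_cderiv_plus f g); cderiv
  | |- is_cderiv (fun s => (@?f s - @?g s)%C) _ _ => apply (is_cderiv_minus f g); cderiv
  | |- is_cderiv (fun s => (- @?f s)%C) _ _ => apply (is_cderiv_opp f); cderiv
  | |- is_cderiv (fun s => (@?f s * @?g s)%C) _ _ => apply (is_cderiv_mult f g); cderiv
  | |- is_cderiv (fun s => (@?f s / @?g s)%C) _ _ => apply (is_cderiv_div f g); [try assumption|cderiv|cderiv]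
  | |- is_cderiv _ _ _ => eassumption
  end.

Lemma locally_R (x : R) (P : R -> Prop) :
  locally x P <-> exists eps, (0 < eps)%R /\ forall s, (Rabs (s - x) < eps)%R -> P s.
Proof.
  split.
  - intros [[e He] H]. exists e. split; [exact He|]. intros s Hs. now apply H.
  - intros [e [He H]]. exists (mkposreal e He). intros s Hs. now apply H.
Qed.

Lemma is_cderiv_ext_loc f g x d eps :
  (0 < eps)%R -> (forall s, (Rabs (s - x) < eps)%R -> f s = g s) ->
  is_cderiv f x d -> is_cderiv g x d.
Proof.
  intros He E [H1 H2]. split.
  - apply (is_derive_ext_loc (fun s => Re (f s))); [|exact H1]. apply locally_R. exists eps.
    split; [exact He|]. intros s Hs. now rewrite E.
  - apply (is_derive_ext_loc (fun s => Im (f s))); [|exact H2]. apply locally_R. exists eps.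
    split; [exact He|]. intros s Hs. now rewrite E.
Qed.

Lemma is_derive_Rcontinuous (f : R -> R) x d : is_derive f x d -> continuous f x.
Proof. intro H. apply (ex_derive_continuous f x). now exists d. Qed.

Lemma is_cderiv_ccont f x d : is_cderiv f x d -> ccont f x.
Proof. intros [H1 H2]. split; eapply is_derive_Rcontinuous; eassumption. Qed.

Lemma ccont_plus f g x : ccont f x -> ccont g x -> ccont (fun s => f s + g s) x.
Proof. intros [H1 H2] [H3 H4]. split; now apply (continuous_plus (V := R_NormedModule)). Qed.

Lemma ccont_opp f x : ccont f x -> ccont (fun s => - f s) x.
Proof. intros [H1 H2]. split; now apply (continuous_opp (V := R_NormedModule)). Qed.

Lemma ccont_minus f g x : ccont f x -> ccont g x -> ccont (fun s => f s - g s) x.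
Proof. intros H1 H2. apply ccont_plus; [exact H1|]. now apply ccont_opp. Qed.

Lemma ccont_mult f g x : ccont f x -> ccont g x -> ccont (fun s => f s * g s) x.
Proof.
  intros [H1 H2] [H3 H4]. split.
  - apply (continuous_minus (V := R_NormedModule)); now apply (continuous_mult (K := R_AbsRing)).
  - apply (continuous_plus (V := R_NormedModule)); now apply (continuous_mult (K := R_AbsRing)).
Qed.

Lemma continuous_R_eps (f : R -> R) x :
  continuous f x <-> forall eps, (0 < eps)%R -> exists del, (0 < del)%R /\
    forall s, (Rabs (s - x) < del)%R -> (Rabs (f s - f x) < eps)%R.
Proof.
  split.
  - intros H eps He. unfold continuous in H.
    assert (K : locally (f x) (fun y => (Rabs (y - f x) < eps)%R)).
    { apply locally_R. exists eps. now split. }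
    specialize (H _ K). now apply locally_R in H.
  - intros H P HP. apply locally_R in HP. destruct HP as [e [He HP]].
    destruct (H e He) as [d [Hd K]]. apply locally_R. exists d. split; [exact Hd|].
    intros s Hs. apply HP. now apply K.
Qed.

Lemma ccont_eps (f : R -> C) x :
  ccont f x <-> forall eps, (0 < eps)%R -> exists del, (0 < del)%R /\
    forall s, (Rabs (s - x) < del)%R -> (Cmod (f s - f x) < eps)%R.
Proof.
  split.
  - intros [H1 H2] eps He. rewrite continuous_R_eps in H1, H2.
    destruct (H1 (eps / 2)%R ltac:(lra)) as [d1 [Hd1 K1]].
    destruct (H2 (eps / 2)%R ltac:(lra)) as [d2 [Hd2 K2]].
    exists (Rmin d1 d2). split; [now apply Rmin_pos|]. intros s Hs.
    minmax.
    specialize (K1 s ltac:(lra)). specialize (K2 s ltac:(lra)).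
    set (w := f s - f x). replace (Re (f s) - Re (f x))%R with (Re w) in K1 by reflexivity.
    replace (Im (f s) - Im (f x))%R with (Im w) in K2 by reflexivity.
    assert (E : w = RtoC (Re w) + Ci * RtoC (Im w)) by (apply C_ext; simpl; ring).
    rewrite E. eapply Rle_lt_trans; [apply Cmod_triangle|].
    rewrite Cmod_mult, Cmod_Ci, !Cmod_R. lra.
  - intro H. split; apply continuous_R_eps; intros eps He; destruct (H eps He) as [d [Hd K]];
      exists d; split; try exact Hd; intros s Hs; specialize (K s Hs).
    + rewrite <- Re_minus. pose proof (re_le_Cmod (f s - f x)). lra.
    + rewrite <- Im_minus. pose proof (im_le_Cmod (f s - f x)). lra.
Qed.

Lemma is_derive_littleo (f : R -> R) (x d : R) :
  (forall eps, (0 < eps)%R -> exists del, (0 < del)%R /\ forall s, (Rabs (s - x) < del)%R ->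
     (Rabs (f s - f x - d * (s - x)) <= eps * Rabs (s - x))%R) ->
  is_derive f x d.
Proof.
  intro H. split; [apply is_linear_scal_l|].
  intros x' Hx'.
  pose proof (is_filter_lim_locally_unique (K := R_AbsRing) (V := AbsRing_NormedModule R_AbsRing) x x' Hx') as Ex. subst x'.
  intros [eps He]. destruct (H eps He) as [del [Hd K]].
  apply locally_R. exists del. split; [exact Hd|]. intros s Hs. specialize (K s Hs).
  change (Rabs (f s - f x - (s - x) * d) <= eps * Rabs (s - x))%R.
  now rewrite (Rmult_comm (s - x) d).
Qed.

Lemma is_cderiv_littleo (f : R -> C) (x : R) (d : C) :
  (forall eps, (0 < eps)%R -> exists del, (0 < del)%R /\ forall s, (Rabs (s - x) < del)%R ->
     (Cmod (f s - f x - d * RtoC (s - x)) <= eps * Rabs (s - x))%R) ->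
  is_cderiv f x d.
Proof.
  intro H. split; apply is_derive_littleo; intros eps He; destruct (H eps He) as [del [Hd K]];
    exists del; (split; [exact Hd|]); intros s Hs; specialize (K s Hs);
    (eapply Rle_trans; [|exact K]).
  - rewrite <- re_scal_r, <- !Re_minus. apply re_le_Cmod.
  - rewrite <- im_scal_r, <- !Im_minus. apply im_le_Cmod.
Qed.

Lemma Cmod_line (v : C) (s x : R) : Cmod v = 1%R -> Cmod (v * RtoC s - v * RtoC x) = Rabs (s - x).
Proof.
  intro Hv. replace (v * RtoC s - v * RtoC x) with (v * RtoC (s - x)) by (rewrite RtoC_minus; ring).
  rewrite Cmod_mult, Hv, Cmod_R. ring.
Qed.

Lemma cder_line (f : C -> C) (v : C) (x : R) (d : C) :
  Cmod v = 1%R -> cder f (v * RtoC x) d -> is_cderiv (fun s => f (v * RtoC s)) x (v * d).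
Proof.
  intros Hv [K [e [He H]]]. apply is_cderiv_littleo. intros eps Heps.
  pose proof (Rabs_pos K) as HK0.
  exists (Rmin e (eps / (Rabs K + 1))). split.
  { apply Rmin_pos; [exact He|apply Rdiv_lt_0_compat; lra]. }
  intros s Hs. minmax.
  specialize (H (v * RtoC s)). rewrite (Cmod_line v s x Hv) in H. specialize (H ltac:(lra)).
  replace (v * d * RtoC (s - x)) with (d * (v * RtoC s - v * RtoC x)) by (rewrite RtoC_minus; ring).
  eapply Rle_trans; [exact H|].
  set (w := Rabs (s - x)) in *. assert (Hw : (0 <= w)%R) by apply Rabs_pos.
  assert ((w * (Rabs K + 1) < eps)%R) by (apply mul_lt_of_lt_div; lra).
  pose proof (Rle_abs K). simpl.
  apply Rle_trans with (Rabs K * (w * (w * 1)))%R; [apply Rmult_le_compat_r; nra|]. nra.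
Qed.

(** Counterpart of [cder_line] for the filter notion of derivative, in which the isomonodromy system
    is stated. *)
Lemma is_derive_line (f : C -> C) (v : C) (x : R) (d : C) :
  Cmod v = 1%R -> @is_derive C_AbsRing C_NormedModule f (v * RtoC x) d ->
  is_cderiv (fun s => f (v * RtoC s)) x (v * d).
Proof.
  intros Hv [_ H]. specialize (H (v * RtoC x) (fun P HP => HP)).
  apply is_cderiv_littleo. intros eps Heps.
  specialize (H (mkposreal eps Heps)).
  pose proof (locally_le_locally_norm (V := AbsRing_NormedModule C_AbsRing) _ _ H) as [[del Hd] K].
  exists del. split; [exact Hd|]. intros s Hs.
  specialize (K (v * RtoC s)).
  assert (Hb : (Cmod (v * RtoC s - v * RtoC x) < del)%R) by now rewrite Cmod_line.
  specialize (K Hb). simpl in K.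
  change (Cmod (f (v * RtoC s)%C - f (v * RtoC x)%C - (v * RtoC s - v * RtoC x) * d)
          <= eps * Cmod (v * RtoC s - v * RtoC x))%R in K.
  rewrite Cmod_line in K by exact Hv.
  replace (v * d * RtoC (s - x)) with ((v * RtoC s - v * RtoC x) * d) by (rewrite RtoC_minus; ring).
  exact K.
Qed.

(** * Mean values and induction along an interval *)

Lemma MVT_bound (f df : R -> R) (a b : R) : (a <= b)%R ->
  (forall x, (a <= x <= b)%R -> is_derive f x (df x)) ->
  exists c, (a <= c <= b)%R /\ (f b - f a = df c * (b - a))%R.
Proof.
  intros Hab H. destruct (MVT_gen f a b df) as [c [Hc E]].
  - rewrite Rmin_left, Rmax_right by lra. intros x Hx. apply H. lra.
  - rewrite Rmin_left, Rmax_right by lra. intros x Hx. apply continuity_pt_filterlim.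
    apply (is_derive_Rcontinuous f x (df x)). now apply H.
  - rewrite Rmin_left, Rmax_right in Hc by lra. exists c. now split.
Qed.

Lemma decreasing_of_derive (f df : R -> R) (a b : R) : (a <= b)%R ->
  (forall x, (a <= x <= b)%R -> is_derive f x (df x)) ->
  (forall x, (a <= x <= b)%R -> (df x <= 0)%R) -> (f b <= f a)%R.
Proof.
  intros Hab H Hn. destruct (MVT_bound f df a b Hab H) as [c [Hc E]].
  specialize (Hn c Hc). nra.
Qed.

(** By the mean value theorem, a derivative formula known off x extends to x once both sides are
    continuous there. This carries the ray system across zeros of y and across isolated bad points
    of z and u. *)
Lemma is_derive_extend (f g : R -> R) (x eps : R) :
  (0 < eps)%R -> continuous f x -> continuous g x ->
  (forall s, (0 < Rabs (s - x) < eps)%R -> is_derive f s (g s)) ->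
  is_derive f x (g x).
Proof.
  intros He Hf Hg H. apply is_derive_littleo. intros e0 He0.
  rewrite continuous_R_eps in Hg. destruct (Hg e0 He0) as [d [Hd K]].
  exists (Rmin d eps). split; [now apply Rmin_pos|]. intros s Hs.
  minmax.
  assert (Habs : forall c, (Rmin x s <= c <= Rmax x s)%R -> (Rabs (c - x) <= Rabs (s - x))%R).
  { intros c Hc. unfold Rmin, Rmax in Hc. destruct (Rle_dec x s); unfold Rabs; repeat destruct Rcase_abs; lra. }
  destruct (MVT_gen f x s g) as [c [Hc E]].
  - intros c Hc. apply H. split; [|specialize (Habs c ltac:(lra)); lra].
    apply Rabs_pos_lt. unfold Rmin, Rmax in Hc. destruct (Rle_dec x s); lra.
  - intros c Hc. apply continuity_pt_filterlim. destruct (Req_dec c x) as [->|Hne]; [exact Hf|].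
    apply (is_derive_Rcontinuous f c (g c)). apply H. specialize (Habs c Hc).
    split; [apply Rabs_pos_lt; lra|lra].
  - rewrite E. specialize (Habs c Hc). specialize (K c ltac:(lra)).
    replace (g c * (s - x) - g x * (s - x))%R with ((g c - g x) * (s - x))%R by ring.
    rewrite Rabs_mult. apply Rmult_le_compat_r; [apply Rabs_pos|lra].
Qed.

Lemma is_cderiv_extend (f g : R -> C) (x eps : R) :
  (0 < eps)%R -> ccont f x -> ccont g x ->
  (forall s, (0 < Rabs (s - x) < eps)%R -> is_cderiv f s (g s)) ->
  is_cderiv f x (g x).
Proof.
  intros He [F1 F2] [G1 G2] H. split.
  - apply (is_derive_extend _ (fun s => Re (g s)) x eps); auto. intros s Hs. now apply H.
  - apply (is_derive_extend _ (fun s => Im (g s)) x eps); auto. intros s Hs. now apply H.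
Qed.

(** Induction over the reals: the supremum of the initial segments on which P holds can neither be
    missed (closedness) nor stop before b (openness). It drives both the bootstrap estimate and the
    connectedness argument. *)
Lemma interval_induction (P : R -> Prop) (a b : R) :
  (a <= b)%R -> P a ->
  (forall x, (a <= x < b)%R -> (forall s, (a <= s <= x)%R -> P s) ->
     exists eps, (0 < eps)%R /\ forall s, (x <= s < x + eps)%R -> (s <= b)%R -> P s) ->
  (forall x, (a < x <= b)%R -> (forall s, (a <= s < x)%R -> P s) -> P x) ->
  forall x, (a <= x <= b)%R -> P x.
Proof.
  intros Hab Ha Hop Hcl.
  set (E := fun x => (a <= x <= b)%R /\ forall s, (a <= s <= x)%R -> P s).
  assert (Ea : E a).
  { split; [lra|]. intros s Hs. replace s with a by lra. exact Ha. }
  destruct (completeness E) as [m [Hm1 Hm2]].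
  { exists b. intros x Hx. apply Hx. }
  { now exists a. }
  assert (Ham : (a <= m)%R) by now apply Hm1.
  assert (Hmb : (m <= b)%R) by (apply Hm2; intros x Hx; apply Hx).
  assert (Hlt : forall s, (a <= s < m)%R -> P s).
  { intros s Hs. apply NNPP. intro Hn.
    assert (m <= s)%R; [|lra]. apply Hm2. intros x [Hx HP].
    destruct (Rle_dec x s) as [|Hc]; [assumption|]. exfalso. apply Hn, HP. lra. }
  assert (Em : E m).
  { split; [lra|]. intros s Hs. destruct (Rlt_dec s m) as [Hsm|Hsm]; [apply Hlt; lra|].
    replace s with m by lra. destruct (Req_dec m a) as [->|Hne]; [exact Ha|]. apply Hcl; [lra|exact Hlt]. }
  destruct (Req_dec m b) as [Emb|Hne].
  - rewrite Emb in Em. intros x Hx. apply Em. exact Hx.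
  - exfalso. destruct (Hop m ltac:(lra) (proj2 Em)) as [e [He K]].
    set (m' := Rmin b (m + e / 2)).
    assert (Hm' : (m < m' <= b)%R) by (unfold m'; split; [apply Rmin_glb_lt; lra|apply Rmin_l]).
    assert (Hm'e : (m' <= m + e / 2)%R) by apply Rmin_r.
    assert (E m'); [|assert (m' <= m)%R by (now apply Hm1); lra].
    split; [lra|]. intros s Hs. destruct (Rle_dec s m) as [Hsm|Hsm]; [apply Em; lra|].
    apply K; lra.
Qed.

(** Connectedness of the open half-line, in the form used for analytic continuation along the
    ray. *)
Lemma locally_constant (P : R -> Prop) :
  (forall x, (0 < x)%R -> exists eps, (0 < eps)%R /\
     forall s, (Rabs (s - x) < eps)%R -> (P s <-> P x)) ->
  forall a b, (0 < a)%R -> (0 < b)%R -> P a -> P b.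
Proof.
  intros H.
  assert (K : forall a b, (0 < a)%R -> (a <= b)%R -> (P a <-> P b)).
  { intros a b Ha Hab.
    apply (interval_induction (fun x => P a <-> P x) a b Hab); [tauto| | |lra].
    - intros x Hx Hs. destruct (H x ltac:(lra)) as [e [He Hx2]]. exists e. split; [exact He|].
      intros s Hss _. rewrite (Hs x ltac:(lra)). symmetry. apply Hx2.
      rewrite Rabs_right; lra.
    - intros x Hx Hs. destruct (H x ltac:(lra)) as [e [He Hx2]].
      set (s := Rmax a (x - e / 2)).
      assert (a <= s)%R by apply Rmax_l. assert (x - e / 2 <= s)%R by apply Rmax_r.
      assert (s < x)%R by (apply Rmax_lub_lt; lra).
      rewrite (Hs s ltac:(lra)). apply Hx2. rewrite Rabs_left; lra. }
  intros a b Ha Hb HP. destruct (Rle_dec a b) as [Hab|Hab].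
  - now apply (K a b).
  - apply (K b a); [exact Hb|lra|exact HP].
Qed.

(** * The fifth Painleve equation on a ray *)

(** A total derivative, so that V and c are defined for every Y before any differentiability is
    known. *)
Definition CD (f : R -> C) (s : R) : C :=
  (Derive (fun x => Re (f x)) s, Derive (fun x => Im (f x)) s).

Lemma CD_unique f x d : is_cderiv f x d -> CD f x = d.
Proof. intros [H1 H2]. apply C_ext; simpl; now apply is_derive_unique. Qed.

Lemma analytic_line_jets (y : C -> C) (v : C) (s0 : R) :
  Cmod v = 1%R -> analytic_at y (v * RtoC s0) ->
  let Y := fun s : R => y (v * RtoC s) in
  exists eps, (0 < eps)%R /\ forall s, (Rabs (s - s0) < eps)%R ->
    is_cderiv Y s (CD Y s) /\ is_cderiv (CD Y) s (CD (CD Y) s) /\ ccont (CD (CD Y)) s.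
Proof.
  intros Hv Hy Y.
  destruct (analytic_at_derivative y _ Hy) as [g [e1 [He1 [Hg H1]]]].
  destruct (analytic_at_derivative g _ Hg) as [g2 [e2 [He2 [Hg2 H2]]]].
  destruct (analytic_at_derivative g2 _ Hg2) as [g3 [e3 [He3 [_ H3]]]].
  set (e := Rmin e1 (Rmin e2 e3)).
  assert (He : (0 < e)%R) by (now repeat apply Rmin_pos).
  pose proof (Rmin_l e1 (Rmin e2 e3)) as L1. pose proof (Rmin_r e1 (Rmin e2 e3)) as L2. fold e in L1, L2.
  minmax.
  assert (D1 : forall s, (Rabs (s - s0) < e)%R -> is_cderiv Y s (v * g (v * RtoC s))).
  { intros s Hs. apply (cder_line y v s _ Hv), H1. rewrite Cmod_line by exact Hv. lra. }
  assert (Hnb : forall s x, (Rabs (s - s0) < e)%R -> (Rabs (x - s) < e - Rabs (s - s0))%R -> (Rabs (x - s0) < e)%R).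
  { intros s x Hs Hx. pose proof (Rabs_triang (x - s) (s - s0)) as K.
    replace (x - s + (s - s0))%R with (x - s0)%R in K by ring. lra. }
  assert (D2 : forall s, (Rabs (s - s0) < e)%R -> is_cderiv (CD Y) s (v * (v * g2 (v * RtoC s)))).
  { intros s Hs. apply (is_cderiv_ext_loc (fun x => v * g (v * RtoC x)) _ s _ (e - Rabs (s - s0))); [lra| |].
    - intros x Hx. symmetry. apply CD_unique, D1. now apply (Hnb s).
    - eapply is_cderiv_eq; [|apply is_cderiv_mult; [apply is_cderiv_const|apply (cder_line g v s (g2 (v * RtoC s)) Hv), H2]].
      + cbv beta. ring.
      + rewrite Cmod_line by exact Hv. lra. }
  exists e. split; [exact He|]. intros s Hs. split; [|split].
  - rewrite (CD_unique _ _ _ (D1 s Hs)). now apply D1.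
  - rewrite (CD_unique _ _ _ (D2 s Hs)). now apply D2.
  - assert (K : is_cderiv (CD (CD Y)) s (v * (v * (v * g3 (v * RtoC s))))); [|exact (is_cderiv_ccont _ _ _ K)].
    apply (is_cderiv_ext_loc (fun x => v * (v * g2 (v * RtoC x))) _ s _ (e - Rabs (s - s0))); [lra| |].
    + intros x Hx. symmetry. apply CD_unique, D2. now apply (Hnb s).
    + eapply is_cderiv_eq; [|apply is_cderiv_mult; [apply is_cderiv_const|
         apply is_cderiv_mult; [apply is_cderiv_const|apply (cder_line g2 v s (g3 (v * RtoC s)) Hv), H3]]].
      * cbv beta. ring.
      * rewrite Cmod_line by exact Hv. lra.
Qed.

(* On the ray t = v s (v^2 = -1) let q = s Y and V = s Y'. To leading order PV is q' = V,
   V' = c - q with the first integral c = (V^2 + q^2 + 2 be) / (2 q). Taking c as a third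
   unknown turns PV into s Y' = V, V' = rhsV, c' = rhsC, which is regular at Y = 0. *)
Definition rhsV (T al be s Y c : C) : C :=
  (Y - 1) * (3 * Y - 1) * (c + T)
  + (2 * al * Y * (Y - 1) * (2 * Y - 1) - 2 * be * (Y - 1)) / s
  + T * (2 * Y - 1) - s * Y.

Definition rhsC (T s Y c : C) : C :=
  (- (T / (Y - 1)) + s * Y / ((Y - 1) * (Y - 1)) - (c + T)) / s.

Definition raySpeed (Y : R -> C) (s : R) : C := RtoC s * CD Y s.

(* V' = rhsV solved for c. *)
Definition rayInvariant (T al be : C) (Y : R -> C) (s : R) : C :=
  (CD Y s + RtoC s * CD (CD Y) s
   - (2 * al * Y s * (Y s - 1) * (2 * Y s - 1) - 2 * be * (Y s - 1)) / RtoC s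
   - T * (2 * Y s - 1) + RtoC s * Y s) / ((Y s - 1) * (3 * Y s - 1)) - T.

(** Right-hand sides of the system for y and z at t = v s, with a = (T0 - T1 + Too)/2 and d = (T0 -
    T1 - Too)/2. In these terms (3 T0 + T1 + Too)/2 = 2 T0 - d and (T0 + T1 + Too)/2 = T0 - d. *)
Definition isoA (T0 a d v : C) (s : R) (Y Z : C) : C :=
  v * RtoC s * Y - 2 * Z * ((Y - 1) * (Y - 1)) - (Y - 1) * (a * Y - (2 * T0 - d)).
Definition isoB (T0 a d : C) (Y Z : C) : C :=
  Y * Z * (Z + a) - 1 / Y * (Z + T0) * (Z + (T0 - d)).

(* c in terms of the isomonodromy variables; T0 = (1 + a + d - v T)/2. *)
Definition isoInvariant (T0 a d v T : C) (s : R) (Y Z : C) : C :=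
  let Q := 2 * Z * (Y - 1) + a * Y - (2 * T0 - d) in
  (- (2 * (v * RtoC s) * (Q - v * T) / (Y - 1)) + (Q * Q - a * a * Y * Y - d * d) / Y)
  / (2 * RtoC s) - T.

(** The left side is the derivative of [isoA] along the flow Y' = A, Z' = B. After eliminating T0
    this is an identity of rational functions modulo v^2 = -1. *)
Lemma isoA_deriv_algebra (T0 a d v T : C) (s : R) (Y Z : C) :
  v * v = - (1) -> 2 * T0 = 1 + a + d - v * T ->
  RtoC s <> 0 -> Y <> 0 -> Y - 1 <> 0 ->
  let A := isoA T0 a d v s Y Z / RtoC s in
  let B := isoB T0 a d Y Z / RtoC s in
  v * Y + v * RtoC s * A - (2 * B * ((Y - 1) * (Y - 1)) + 2 * Z * (A * (Y - 1) + (Y - 1) * A))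
   - (A * (a * Y - (2 * T0 - d)) + (Y - 1) * (a * A))
  = rhsV T (a * a / 2) (- (d * d) / 2) (RtoC s) Y (isoInvariant T0 a d v T s Y Z).
Proof.
  intros Hv HT Hs HY HY1 A B. unfold A, B, isoA, isoB, rhsV, isoInvariant.
  assert (ET0 : T0 = (1 + a + d - v * T) / 2) by (rewrite <- HT; field).
  rewrite ET0. clear ET0 HT A B.
  field_simplify_eq [Hv]; [|repeat split; assumption].
  ring [Hv].
Qed.

Lemma isoInvariant_deriv_algebra (T0 a d v T : C) (s : R) (Y Z : C) :
  v * v = - (1) -> 2 * T0 = 1 + a + d - v * T ->
  RtoC s <> 0 -> Y <> 0 -> Y - 1 <> 0 ->
  let A := isoA T0 a d v s Y Z / RtoC s in
  let B := isoB T0 a d Y Z / RtoC s in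
  let Q := 2 * Z * (Y - 1) + a * Y - (2 * T0 - d) in
  let Q' := 2 * (B * (Y - 1) + Z * A) + a * A in
  let N := - (2 * (v * RtoC s) * (Q - v * T) / (Y - 1)) + (Q * Q - a * a * Y * Y - d * d) / Y in
  let N' := - (2 * v * (Q - v * T) / (Y - 1)
               + 2 * (v * RtoC s) * (Q' * (Y - 1) - (Q - v * T) * A) / ((Y - 1) * (Y - 1)))
            + ((2 * Q * Q' - 2 * (a * a) * Y * A) * Y - (Q * Q - a * a * Y * Y - d * d) * A) / (Y * Y) in
  N' / (2 * RtoC s) - N / (2 * RtoC s * RtoC s)
  = rhsC T (RtoC s) Y (isoInvariant T0 a d v T s Y Z).
Proof.
  intros Hv HT Hs HY HY1 A B Q Q' N N'. unfold N', N, Q', Q, A, B, isoA, isoB, rhsC, isoInvariant.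
  assert (ET0 : T0 = (1 + a + d - v * T) / 2) by (rewrite <- HT; field).
  rewrite ET0. clear ET0 HT A B Q Q' N N'.
  field_simplify_eq [Hv]; [|repeat split; assumption].
  ring [Hv].
Qed.

(** The threshold 1/3 used throughout is the modulus at which the denominator 3 Y - 1 of
    [rayInvariant] can vanish. *)
Lemma Cmod_lt1_minus1_nz (Y : C) : (Cmod Y < 1 / 3)%R -> Y - 1 <> 0 /\ 3 * Y - 1 <> 0.
Proof.
  intro H. split; intro E.
  - assert (EY : Y = 1) by (replace Y with (Y - 1 + 1) by ring; rewrite E; ring).
    rewrite EY, Cmod_1 in H. lra.
  - assert (EY : 3 * Y = 1) by (replace (3 * Y) with (3 * Y - 1 + 1) by ring; rewrite E; ring).
    assert (E3 : Cmod (3 * Y) = 1%R) by (rewrite EY; apply Cmod_1).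
    rewrite Cmod_mult, Cmod_R, Rabs_right in E3 by lra. lra.
Qed.

Lemma near_shrink (s0 s x eps : R) :
  (Rabs (x - s) < eps - Rabs (s - s0))%R -> (Rabs (x - s0) < eps)%R.
Proof.
  intro Hx. pose proof (Rabs_triang (x - s) (s - s0)) as K.
  replace (x - s + (s - s0))%R with (x - s0)%R in K by ring. lra.
Qed.

Lemma RtoC_pos_neq_0 (s : R) : (0 < s)%R -> RtoC s <> 0.
Proof. intros Hs E. apply RtoC_inj in E. lra. Qed.

(** Where Y is nonzero: [rhsV] is affine in c with coefficient (Y - 1)(3 Y - 1), so comparing its
    value from [isoA_deriv_algebra] with the definition of [rayInvariant] identifies that with
    [isoInvariant], whose derivative is then known. *)
Lemma iso_ray_system (T0 a d v T : C) (Y Z : R -> C) (s0 eps : R) :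
  v * v = - (1) -> 2 * T0 = 1 + a + d - v * T -> (0 < s0)%R -> (0 < eps)%R ->
  (forall s, (Rabs (s - s0) < eps)%R ->
     (0 < s)%R /\ Y s <> 0 /\ (Cmod (Y s) < 1 / 3)%R /\
     is_cderiv Y s (isoA T0 a d v s (Y s) (Z s) / RtoC s) /\
     is_cderiv Z s (isoB T0 a d (Y s) (Z s) / RtoC s)) ->
  let al := a * a / 2 in let be := - (d * d) / 2 in
  raySpeed Y s0 = isoA T0 a d v s0 (Y s0) (Z s0) /\
  rayInvariant T al be Y s0 = isoInvariant T0 a d v T s0 (Y s0) (Z s0) /\
  is_cderiv (raySpeed Y) s0 (rhsV T al be (RtoC s0) (Y s0) (rayInvariant T al be Y s0)) /\
  is_cderiv (rayInvariant T al be Y) s0 (rhsC T (RtoC s0) (Y s0) (rayInvariant T al be Y s0)).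
Proof.
  intros Hv HT Hs0 He H al be.
  set (A := fun s => isoA T0 a d v s (Y s) (Z s)).
  set (B := fun s => isoB T0 a d (Y s) (Z s)).
  assert (H00 : (Rabs (s0 - s0) < eps)%R) by (rewrite Rminus_diag, Rabs_R0; exact He).
  assert (HA : forall s, (Rabs (s - s0) < eps)%R ->
     is_cderiv A s (rhsV T al be (RtoC s) (Y s) (isoInvariant T0 a d v T s (Y s) (Z s)))).
  { intros s Hs. destruct (H s Hs) as [Hsp [HY [HY3 [DY DZ]]]].
    destruct (Cmod_lt1_minus1_nz _ HY3) as [HY1 _].
    eapply is_cderiv_eq.
    { exact (isoA_deriv_algebra T0 a d v T s (Y s) (Z s) Hv HT (RtoC_pos_neq_0 s Hsp) HY HY1). }
    unfold A, isoA. eapply is_cderiv_eq; [|cderiv].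
    cbv beta. fold (isoA T0 a d v s (Y s) (Z s)). ring. }
  assert (HCD : forall s, (Rabs (s - s0) < eps)%R -> CD Y s = A s / RtoC s).
  { intros s Hs. apply CD_unique. now apply H. }
  assert (HV : forall s, (Rabs (s - s0) < eps)%R -> raySpeed Y s = A s).
  { intros s Hs. unfold raySpeed. rewrite HCD by exact Hs.
    field. apply RtoC_pos_neq_0. now apply H. }
  assert (HI : forall s, (Rabs (s - s0) < eps)%R ->
     rayInvariant T al be Y s = isoInvariant T0 a d v T s (Y s) (Z s)).
  { intros s Hs. destruct (H s Hs) as [Hsp [HY [HY3 [DY DZ]]]].
    destruct (Cmod_lt1_minus1_nz _ HY3) as [HY1 HY31].
    pose proof (RtoC_pos_neq_0 s Hsp) as Hsn.
    assert (E2 : CD (CD Y) s = (rhsV T al be (RtoC s) (Y s) (isoInvariant T0 a d v T s (Y s) (Z s)) * RtoC s - A s * 1) / (RtoC s * RtoC s)).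
    { apply CD_unique. apply (is_cderiv_ext_loc (fun x => A x / RtoC x) _ s _ (eps - Rabs (s - s0))); [lra| |].
      - intros x Hx. symmetry. apply HCD. now apply (near_shrink s0 s).
      - apply (is_cderiv_div A (fun x => RtoC x)); [exact Hsn|now apply HA|apply is_cderiv_id]. }
    unfold rayInvariant. rewrite E2, HCD by exact Hs. unfold rhsV. field. now repeat split. }
  split; [now apply HV|]. split; [now apply HI|]. rewrite HI by exact H00.
  split.
  - apply (is_cderiv_ext_loc A _ s0 _ eps He); [|now apply HA].
    intros s Hs. symmetry. now apply HV.
  - destruct (H s0 H00) as [Hsp [HY [HY3 [DY DZ]]]].
    destruct (Cmod_lt1_minus1_nz _ HY3) as [HY1 HY31].
    pose proof (RtoC_pos_neq_0 s0 Hsp) as Hsn.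
    apply (is_cderiv_ext_loc (fun s => isoInvariant T0 a d v T s (Y s) (Z s)) _ s0 _ eps He).
    { intros s Hs. symmetry. now apply HI. }
    eapply is_cderiv_eq.
    { exact (isoInvariant_deriv_algebra T0 a d v T s0 (Y s0) (Z s0) Hv HT Hsn HY HY1). }
    cbv zeta. unfold isoInvariant.
    assert (DQ : is_cderiv (fun s => 2 * Z s * (Y s - 1) + a * Y s - (2 * T0 - d)) s0
      (2 * (B s0 / RtoC s0 * (Y s0 - 1) + Z s0 * (A s0 / RtoC s0)) + a * (A s0 / RtoC s0))).
    { eapply is_cderiv_eq; [|cderiv].
      cbv beta. unfold A, B. ring. }
    assert (Hs2 : 2 * RtoC s0 <> 0) by (apply Cmult_neq_0; [intro E0; apply RtoC_inj in E0; lra|exact Hsn]).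
    eapply is_cderiv_eq; [|cderiv].
    cbv beta. fold (A s0) (B s0). generalize (A s0) (B s0). intros A0 B0. field. now repeat split.
Qed.

(** * Meromorphic functions and the isomonodromy system on the half-axes *)

Lemma Cmod_Ci_sign (sigma : R) : sigma = 1%R \/ sigma = (-1)%R -> Cmod (Ci * RtoC sigma) = 1%R.
Proof.
  intro Hs. rewrite Cmod_mult, Cmod_Ci, Cmod_R. destruct Hs as [-> | ->]; unfold Rabs; destruct Rcase_abs; lra.
Qed.

Lemma Carg_imaginary_axis (sigma s : R) : sigma = 1%R \/ sigma = (-1)%R -> (0 < s)%R ->
  Carg (Ci * RtoC sigma * RtoC s) = (sigma * PI / 2)%R.
Proof.
  intros Hsg Hs. unfold Carg.
  rewrite Cmod_mult, Cmod_Ci_sign, Cmod_R, Rabs_right by (assumption || lra).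
  replace (Re (Ci * RtoC sigma * RtoC s)) with 0%R by (simpl; ring).
  replace (Im (Ci * RtoC sigma * RtoC s)) with (sigma * s)%R by (simpl; ring).
  destruct (Rlt_dec 0 0) as [H|_]; [lra|].
  replace (sigma * s / (1 * s + 0))%R with sigma by (field; lra).
  destruct Hsg as [-> | ->].
  - rewrite atan_1. field.
  - replace (atan (-1)) with (- atan 1)%R by (rewrite <- atan_opp; f_equal; ring).
    rewrite atan_1. field.
Qed.

Lemma imaginary_axis_slit (sigma s : R) : sigma = 1%R \/ sigma = (-1)%R -> (0 < s)%R ->
  slit (Ci * RtoC sigma * RtoC s).
Proof.
  intros Hsg Hs. split.
  - apply Cmod_gt_0. rewrite Cmod_mult, Cmod_Ci_sign, Cmod_R, Rabs_right by (assumption || lra). lra.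
  - rewrite Carg_imaginary_axis by assumption. pose proof PI_RGT_0.
    destruct Hsg as [-> | ->]; lra.
Qed.

Definition punctured_ray (P : R -> Prop) (s0 : R) : Prop :=
  exists eps, (0 < eps)%R /\ forall s, (0 < Rabs (s - s0) < eps)%R -> P s.

Lemma punctured_ray_and (P Q : R -> Prop) s0 :
  punctured_ray P s0 -> punctured_ray Q s0 -> punctured_ray (fun s => P s /\ Q s) s0.
Proof.
  intros [e1 [He1 H1]] [e2 [He2 H2]]. exists (Rmin e1 e2). split; [now apply Rmin_pos|].
  intros s Hs. minmax. split; [apply H1|apply H2]; lra.
Qed.

Lemma punctured_ray_impl (P Q : R -> Prop) s0 :
  (forall s, P s -> Q s) -> punctured_ray P s0 -> punctured_ray Q s0.
Proof. intros H [e [He K]]. exists e. split; [exact He|]. intros s Hs. now apply H, K. Qed.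

Lemma punctured_ray_inside (P : R -> Prop) s0 eps s :
  (forall s, (0 < Rabs (s - s0) < eps)%R -> P s) -> (0 < Rabs (s - s0) < eps)%R ->
  exists e, (0 < e)%R /\ forall x, (Rabs (x - s) < e)%R -> P x.
Proof.
  intros H Hs. exists (Rmin (Rabs (s - s0)) (eps - Rabs (s - s0))). split; [apply Rmin_pos; lra|].
  intros x Hx. minmax.
  apply H. pose proof (Rabs_triang (x - s) (s - s0)) as K1.
  replace (x - s + (s - s0))%R with (x - s0)%R in K1 by ring.
  pose proof (Rabs_triang (- (x - s)) (x - s0)) as K2. rewrite Rabs_Ropp in K2.
  replace (- (x - s) + (x - s0))%R with (s - s0)%R in K2 by ring. lra.
Qed.

Lemma meromorphic_ray_analytic (f : C -> C) (v : C) (s0 : R) : Cmod v = 1%R ->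
  meromorphic_at f (v * RtoC s0) -> punctured_ray (fun s => analytic_at f (v * RtoC s)) s0.
Proof.
  intros Hv [Hf|Hf].
  - destruct (analytic_at_open f _ Hf) as [e [He H]]. exists e. split; [exact He|].
    intros s Hs. apply H. rewrite Cmod_line by exact Hv. lra.
  - destruct (pole_at_punctured f _ Hf) as [e [He H]]. exists e. split; [exact He|].
    intros s Hs. apply H. rewrite Cmod_line by exact Hv. lra.
Qed.

(** Identity theorem along the ray. At each point f either vanishes on an interval or has no zero on
    a punctured one; both alternatives are open, so the second spreads from s1 to the whole
    half-line. *)
Lemma meromorphic_ray_nonzero (f : C -> C) (v : C) (s1 : R) : Cmod v = 1%R ->
  (forall s, (0 < s)%R -> meromorphic_at f (v * RtoC s)) ->
  (0 < s1)%R -> f (v * RtoC s1) <> 0 ->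
  forall s0, (0 < s0)%R -> punctured_ray (fun s => f (v * RtoC s) <> 0) s0.
Proof.
  intros Hv Hm Hs1 Hf1 s0 Hs0.
  set (NZ := punctured_ray (fun s => f (v * RtoC s) <> 0)).
  assert (Hd : forall s, (0 < s)%R ->
    (exists e, (0 < e)%R /\ forall x, (Rabs (x - s) < e)%R -> f (v * RtoC x) = 0) \/ NZ s).
  { intros s Hs. destruct (Hm s Hs) as [Hf|Hf].
    - destruct (analytic_zero_dichotomy f _ Hf) as [[e [He H]]|[e [He H]]].
      + left. exists e. split; [exact He|]. intros x Hx. apply H. now rewrite Cmod_line.
      + right. exists e. split; [exact He|]. intros x Hx. apply H. now rewrite Cmod_line.
    - right. destruct (pole_at_punctured f _ Hf) as [e [He H]]. exists e. split; [exact He|].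
      intros x Hx. apply H. now rewrite Cmod_line. }
  assert (Hzero : forall s e, (0 < e)%R -> (forall x, (Rabs (x - s) < e)%R -> f (v * RtoC x) = 0) -> ~ NZ s).
  { intros s e He H0 [e2 [He2 H2]]. set (x := (s + Rmin e e2 / 2)%R).
    assert (Hm0 : (0 < Rmin e e2)%R) by now apply Rmin_pos.
    minmax.
    assert (Hx : Rabs (x - s) = (Rmin e e2 / 2)%R).
    { unfold x. replace (s + Rmin e e2 / 2 - s)%R with (Rmin e e2 / 2)%R by ring. apply Rabs_right. lra. }
    apply (H2 x); [lra|]. apply H0. lra. }
  apply (locally_constant NZ) with (a := s1); [|exact Hs1|exact Hs0|].
  - intros x Hx. destruct (Hd x Hx) as [[e [He H]]|[e [He H]]].
    + exists e. split; [exact He|]. intros s Hs.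
      assert (N1 : ~ NZ s).
      { apply (Hzero s (e - Rabs (s - x))%R); [lra|]. intros w Hw. apply H. now apply (near_shrink x s). }
      assert (N2 : ~ NZ x) by now apply (Hzero x e).
      tauto.
    + exists e. split; [exact He|]. intros s Hs.
      assert (N1 : NZ x) by now exists e.
      destruct (Req_dec s x) as [->|Hne]; [tauto|].
      assert (N2 : NZ s); [|tauto].
      destruct (punctured_ray_inside _ x e s H) as [e2 [He2 H2]].
      { split; [apply Rabs_pos_lt; lra|exact Hs]. }
      exists e2. split; [exact He2|]. intros w Hw. apply H2. lra.
  - destruct (Hd s1 Hs1) as [[e [He H]]|H]; [|exact H]. exfalso. apply Hf1, H.
    rewrite Rminus_diag, Rabs_R0. exact He.
Qed.

(** The conditions under which [isomonodromy_solution] asserts the differential equations at a point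
    of the cut plane. *)
Definition good_point (y z u : C -> C) (t : C) : Prop :=
  analytic_at y t /\ analytic_at z t /\ analytic_at u t /\ y t <> 0 /\ u t <> 0.

(** For t = v s the Euler operators agree, s d/ds = t d/dt, so no stray powers of v appear. *)
Lemma isomonodromy_ray (sigma : R) (T0 T1 Too : C) (y z u : C -> C) (s : R) :
  let v := Ci * RtoC sigma in
  let a := (T0 - T1 + Too) / 2 in let d := (T0 - T1 - Too) / 2 in
  sigma = 1%R \/ sigma = (-1)%R -> (0 < s)%R ->
  isomonodromy_solution T0 T1 Too y z u -> good_point y z u (v * RtoC s) ->
  let Y := fun s : R => y (v * RtoC s) in let Z := fun s : R => z (v * RtoC s) in
  is_cderiv Y s (isoA T0 a d v s (Y s) (Z s) / RtoC s) /\
  is_cderiv Z s (isoB T0 a d (Y s) (Z s) / RtoC s).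
Proof.
  intros v a d Hsg Hs [_ Hsol] [Ay [Az [Au [Hy Hu]]]] Y Z.
  destruct (Hsol _ (imaginary_axis_slit sigma s Hsg Hs) Ay Az Au Hy Hu)
    as [dy [dz [du [Dy [Dz [_ [Ey [Ez _]]]]]]]].
  pose proof (Cmod_Ci_sign sigma Hsg) as Hv. fold v in Hv, Ey, Ez, Dy, Dz.
  pose proof (RtoC_pos_neq_0 s Hs) as Hsn.
  change (z (v * RtoC s)) with (Z s) in *. change (y (v * RtoC s)) with (Y s) in *.
  split.
  - apply (is_cderiv_eq _ _ (v * dy)); [|now apply is_derive_line].
    replace (v * dy) with (v * RtoC s * dy / RtoC s) by (field; exact Hsn).
    rewrite Ey. unfold isoA, a, d. field. now repeat split.
  - apply (is_cderiv_eq _ _ (v * dz)); [|now apply is_derive_line].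
    replace (v * dz) with (v * RtoC s * dz / RtoC s) by (field; exact Hsn).
    rewrite Ez. unfold isoB, a, d. field. now repeat split.
Qed.

Record ray_params (sigma : R) (T0 T1 Too : C) (T01 al be : R) : Prop := {
  rp_sign : sigma = 1%R \/ sigma = (-1)%R;
  rp_gamma : gamma_hat T0 T1 = Ci * RtoC T01;
  rp_alpha : alpha_hat T0 T1 Too = RtoC al;
  rp_beta : beta_hat T0 T1 Too = RtoC be
}.

Lemma ray_params_facts sigma T0 T1 Too T01 al be :
  ray_params sigma T0 T1 Too T01 al be ->
  let v := Ci * RtoC sigma in
  let a := (T0 - T1 + Too) / 2 in let d := (T0 - T1 - Too) / 2 in
  v * v = - (1) /\ 2 * T0 = 1 + a + d - v * RtoC (sigma * T01) /\
  RtoC al = a * a / 2 /\ RtoC be = - (d * d) / 2.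
Proof.
  intros [Hsg Hg Ha Hb] v a d.
  assert (Hss : RtoC sigma * RtoC sigma = 1).
  { rewrite <- RtoC_mult. f_equal. destruct Hsg as [-> | ->]; ring. }
  assert (Hii : Ci * Ci = - (1)) by (apply C_ext; simpl; ring).
  unfold gamma_hat in Hg. unfold alpha_hat in Ha. unfold beta_hat in Hb.
  split; [|split; [|split]].
  - unfold v. replace (Ci * RtoC sigma * (Ci * RtoC sigma)) with (Ci * Ci * (RtoC sigma * RtoC sigma)) by ring.
    rewrite Hss, Hii. ring.
  - unfold v. rewrite RtoC_mult.
    replace (Ci * RtoC sigma * (RtoC sigma * RtoC T01)) with (Ci * RtoC T01 * (RtoC sigma * RtoC sigma)) by ring.
    rewrite Hss, <- Hg. unfold a, d. field.
  - rewrite <- Ha. fold a. rewrite RtoC_div by lra. field.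
  - rewrite <- Hb. fold d. replace (-1 / 2)%R with (- (1 / 2))%R by field.
    rewrite RtoC_opp, RtoC_div by lra. field.
Qed.

(** No differential equation enters: the formula for V' holds by the definition of c. It is
    therefore valid at zeros of y as well, and c is continuous there because Y'' is. *)
Lemma raySpeed_deriv (T al be : C) (y : C -> C) (v : C) (s : R) :
  let Y := fun s : R => y (v * RtoC s) in
  Cmod v = 1%R -> (0 < s)%R -> analytic_at y (v * RtoC s) -> (Cmod (Y s) < 1 / 3)%R ->
  is_cderiv Y s (raySpeed Y s / RtoC s) /\
  is_cderiv (raySpeed Y) s (rhsV T al be (RtoC s) (Y s) (rayInvariant T al be Y s)) /\
  ccont (rayInvariant T al be Y) s.
Proof.
  intros Y Hv Hs Hy HY3. pose proof (RtoC_pos_neq_0 s Hs) as Hsn.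
  destruct (Cmod_lt1_minus1_nz _ HY3) as [HY1 HY31].
  destruct (analytic_line_jets y v s Hv Hy) as [e [He H]]. fold Y in H.
  destruct (H s) as [H1 [H2 H3]]; [rewrite Rminus_diag, Rabs_R0; exact He|].
  split; [|split].
  - eapply is_cderiv_eq; [|exact H1]. unfold raySpeed. field. exact Hsn.
  - unfold raySpeed. eapply is_cderiv_eq; [|apply is_cderiv_mult; [apply is_cderiv_id|exact H2]].
    unfold rhsV, rayInvariant. field. now repeat split.
  - unfold rayInvariant.
    pose proof (is_cderiv_ccont _ _ _ H1) as C1. pose proof (is_cderiv_ccont _ _ _ H2) as C2.
    pose proof (fun c : C => is_cderiv_ccont _ _ _ (is_cderiv_const c s)) as Cc.
    pose proof (is_cderiv_ccont _ _ _ (is_cderiv_id s)) as Ci0.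
    assert (Cy1 : ccont (fun s => Y s - 1) s) by now apply ccont_minus.
    apply ccont_minus; [|apply Cc]. apply ccont_mult.
    + apply ccont_plus; [|now apply ccont_mult]. apply ccont_minus; [apply ccont_minus|].
      * apply ccont_plus; [exact C2|now apply ccont_mult].
      * apply ccont_mult.
        -- apply ccont_minus; [|now apply ccont_mult].
           apply ccont_mult; [apply ccont_mult; [now apply ccont_mult|exact Cy1]|].
           apply ccont_minus; [now apply ccont_mult|apply Cc].
        -- exact (is_cderiv_ccont _ _ _ (is_cderiv_inv _ _ _ Hsn (is_cderiv_id s))).
      * apply ccont_mult; [apply Cc|]. apply ccont_minus; [now apply ccont_mult|apply Cc].
    + refine (is_cderiv_ccont _ _ _ (is_cderiv_inv (fun s => (Y s - 1) * (3 * Y s - 1)) s _ _ _)).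
      * now apply Cmult_neq_0.
      * apply is_cderiv_mult; (apply is_cderiv_minus; [|apply is_cderiv_const]); [exact H1|].
        apply is_cderiv_mult; [apply is_cderiv_const|exact H1].
Qed.

(** The equation for c comes from the isomonodromy system at nearby good points and passes to s0 by
    continuity, since [rhsC] is regular at Y = 0. *)
Lemma rayInvariant_deriv (sigma : R) (T0 T1 Too : C) (T01 al be : R) (y z u : C -> C) (s0 : R) :
  let v := Ci * RtoC sigma in
  let Y := fun s : R => y (v * RtoC s) in
  let I := rayInvariant (RtoC (sigma * T01)) (RtoC al) (RtoC be) Y in
  ray_params sigma T0 T1 Too T01 al be ->
  isomonodromy_solution T0 T1 Too y z u ->
  (0 < s0)%R -> punctured_ray (fun s => good_point y z u (v * RtoC s)) s0 ->
  analytic_at y (v * RtoC s0) -> (Cmod (Y s0) < 1 / 3)%R ->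
  is_cderiv I s0 (rhsC (RtoC (sigma * T01)) (RtoC s0) (Y s0) (I s0)).
Proof.
  intros v Y I Hp Hsol Hs0 [e [He Hgood]] Hy HY3.
  destruct (ray_params_facts _ _ _ _ _ _ _ Hp) as [Hvv [HT [Ea Eb]]]. fold v in Hvv, HT.
  pose proof (rp_sign _ _ _ _ _ _ _ Hp) as Hsg.
  pose proof (Cmod_Ci_sign sigma Hsg) as Hv. fold v in Hv.
  destruct (Cmod_lt1_minus1_nz _ HY3) as [HY1 HY31].
  pose proof (RtoC_pos_neq_0 s0 Hs0) as Hsn.
  destruct (raySpeed_deriv (RtoC (sigma * T01)) (RtoC al) (RtoC be) y v s0 Hv Hs0 Hy HY3) as [DY [_ CI]].
  fold Y in DY, CI. fold I in CI.
  pose proof (proj1 (ccont_eps _ _) (is_cderiv_ccont _ _ _ DY) (1 / 3 - Cmod (Y s0))%R ltac:(lra)) as [e2 [He2 H2]].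
  set (e3 := Rmin e (Rmin e2 s0)).
  assert (He3 : (0 < e3)%R) by (now repeat apply Rmin_pos).
  pose proof (Rmin_l e (Rmin e2 s0)) as L1. pose proof (Rmin_r e (Rmin e2 s0)) as L2. fold e3 in L1, L2.
  minmax.
  apply (is_cderiv_extend I (fun s => rhsC (RtoC (sigma * T01)) (RtoC s) (Y s) (I s)) s0 e3 He3 CI).
  - pose proof (is_cderiv_ccont _ _ _ DY) as C1.
    pose proof (fun c : C => is_cderiv_ccont _ _ _ (is_cderiv_const c s0)) as Cc.
    pose proof (is_cderiv_ccont _ _ _ (is_cderiv_id s0)) as Ci0.
    assert (D1 : is_cderiv (fun s => Y s - 1) s0 (raySpeed Y s0 / RtoC s0 - 0)).
    { apply is_cderiv_minus; [exact DY|apply is_cderiv_const]. }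
    unfold rhsC. apply ccont_mult.
    + apply ccont_minus; [apply ccont_plus|].
      * apply ccont_opp, ccont_mult; [apply Cc|].
        exact (is_cderiv_ccont _ _ _ (is_cderiv_inv _ _ _ HY1 D1)).
      * apply ccont_mult; [now apply ccont_mult|].
        refine (is_cderiv_ccont _ _ _ (is_cderiv_inv (fun s => (Y s - 1) * (Y s - 1)) s0 _ _ (is_cderiv_mult _ _ _ _ _ D1 D1))).
        now apply Cmult_neq_0.
      * apply ccont_plus; [exact CI|apply Cc].
    + exact (is_cderiv_ccont _ _ _ (is_cderiv_inv _ _ _ Hsn (is_cderiv_id s0))).
  - intros s Hs. destruct (punctured_ray_inside _ s0 e3 s (fun s Hs => conj (Hgood s (conj (proj1 Hs) (Rlt_le_trans _ _ _ (proj2 Hs) L1))) Hs) Hs)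
      as [e4 [He4 H4]].
    destruct (H4 s) as [_ Hss]; [rewrite Rminus_diag, Rabs_R0; exact He4|].
    unfold I. rewrite Ea, Eb.
    apply (iso_ray_system T0 ((T0 - T1 + Too) / 2) ((T0 - T1 - Too) / 2) v (RtoC (sigma * T01)) Y
             (fun s => z (v * RtoC s)) s e4 Hvv HT); [|exact He4|].
    + destruct Hss as [_ Hss]. apply Rabs_def2 in Hss. lra.
    + intros x Hx. destruct (H4 x Hx) as [Hgx Hxx].
      assert (Hxp : (0 < x)%R) by (destruct Hxx as [_ Hxx]; apply Rabs_def2 in Hxx; lra).
      pose proof (isomonodromy_ray sigma T0 T1 Too y z u x Hsg Hxp Hsol Hgx) as [K1 K2].
      split; [exact Hxp|]. split; [apply Hgx|]. split; [|split; [exact K1|exact K2]].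
      specialize (H2 x ltac:(lra)). pose proof (Cmod_triangle (Y x - Y s0) (Y s0)) as K.
      replace (Y x - Y s0 + Y s0) with (Y x) in K by ring. lra.
Qed.

(** * Propagation of the leading asymptotics *)

Lemma Cmod_plus_le (a b : C) A B : (Cmod a <= A -> Cmod b <= B -> Cmod (a + b) <= A + B)%R.
Proof. intros. pose proof (Cmod_triangle a b). lra. Qed.
Lemma Cmod_minus_le (a b : C) A B : (Cmod a <= A -> Cmod b <= B -> Cmod (a - b) <= A + B)%R.
Proof. intros. apply Cmod_plus_le; [assumption|]. now rewrite Cmod_opp. Qed.
Lemma Cmod_opp_le (a : C) A : (Cmod a <= A -> Cmod (- a) <= A)%R.
Proof. now rewrite Cmod_opp. Qed.
Lemma Cmod_mult_le (a b : C) A B : (Cmod a <= A -> Cmod b <= B -> Cmod (a * b) <= A * B)%R.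
Proof. intros. rewrite Cmod_mult. apply Rmult_le_compat; try assumption; apply Cmod_ge_0. Qed.
Lemma Cmod_R_le (x : R) : (Cmod (RtoC x) <= Rabs x)%R.
Proof. rewrite Cmod_R. lra. Qed.
Lemma Cmod_num_le (x : R) : (0 <= x)%R -> (Cmod (RtoC x) <= x)%R.
Proof. intro H. rewrite Cmod_R, Rabs_right; lra. Qed.

Lemma Cmod_inv_minus1_le (Y : C) : (Cmod Y < 1 / 3)%R -> (Cmod (/ (Y - 1)) <= 3 / 2)%R.
Proof.
  intro H. destruct (Cmod_lt1_minus1_nz Y H) as [H1 _].
  rewrite Cmod_inv by exact H1.
  pose proof (Cmod_triangle (- (Y - 1)) Y) as K. rewrite Cmod_opp in K.
  replace (- (Y - 1) + Y) with (RtoC 1) in K by ring. rewrite Cmod_1 in K.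
  replace (3 / 2)%R with (/ (2 / 3))%R by field.
  apply Rinv_le_contravar; lra.
Qed.

(** What remains of s (V' - (c - q)) and of s c' once s Y is written as q: bounded as long as q and
    c are bounded and |Y| < 1/3. *)
Definition remV (T al be q Y c : C) : C :=
  (-(4) * q + 3 * q * Y) * (c + T) + 2 * al * Y * (Y - 1) * (2 * Y - 1) - 2 * be * (Y - 1) + 2 * T * q.
Definition remC (T q Y c : C) : C :=
  - (T * / (Y - 1)) + q * (/ (Y - 1) * / (Y - 1)) - (c + T).

Lemma rhsV_split (T al be : C) (s : R) (Y c : C) : (0 < s)%R ->
  rhsV T al be (RtoC s) Y c = c - RtoC s * Y + remV T al be (RtoC s * Y) Y c / RtoC s.
Proof.
  intro Hs. pose proof (RtoC_pos_neq_0 s Hs). unfold rhsV, remV. field. assumption.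
Qed.

Lemma rhsC_split (T : C) (s : R) (Y c : C) : (0 < s)%R -> (Cmod Y < 1 / 3)%R ->
  rhsC T (RtoC s) Y c = remC T (RtoC s * Y) Y c / RtoC s.
Proof.
  intros Hs HY. pose proof (RtoC_pos_neq_0 s Hs). destruct (Cmod_lt1_minus1_nz Y HY).
  unfold rhsC, remC. field. now split.
Qed.

(** A crude common majorant of both remainders; what matters is that it does not depend on s. *)
Definition rem_bound (T al be K : R) : R :=
  (5 * K * (K + Rabs T) + 8 * Rabs al + 8 * Rabs be + 10 * Rabs T * (K + 1) + 10 * K)%R.

Lemma rem_bounds (T al be K : R) (q Y c : C) :
  (0 <= K)%R -> (Cmod Y < 1 / 3)%R -> (Cmod q <= K)%R -> (Cmod c <= K)%R ->
  (Cmod (remV (RtoC T) (RtoC al) (RtoC be) q Y c) <= rem_bound T al be K)%R /\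
  (Cmod (remC (RtoC T) q Y c) <= rem_bound T al be K)%R.
Proof.
  intros HK HY Hq Hc.
  assert (HYle : (Cmod Y <= 1 / 3)%R) by lra.
  pose proof (Cmod_R_le T) as HT. pose proof (Cmod_R_le al) as Hal. pose proof (Cmod_R_le be) as Hbe.
  pose proof (Cmod_num_le 1 ltac:(lra)) as H1. pose proof (Cmod_num_le 2 ltac:(lra)) as H2.
  pose proof (Cmod_num_le 3 ltac:(lra)) as H3. pose proof (Cmod_num_le 4 ltac:(lra)) as H4.
  pose proof (Cmod_inv_minus1_le Y HY) as Hi.
  pose proof (Rabs_pos T). pose proof (Rabs_pos al). pose proof (Rabs_pos be).
  unfold rem_bound. split.
  - unfold remV. eapply Rle_trans.
    { repeat first [apply Cmod_plus_le|apply Cmod_minus_le|apply Cmod_opp_le|apply Cmod_mult_le|eassumption]. }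
    nra.
  - unfold remC. eapply Rle_trans.
    { repeat first [apply Cmod_plus_le|apply Cmod_minus_le|apply Cmod_opp_le|apply Cmod_mult_le|eassumption]. }
    nra.
Qed.

Lemma is_derive_Cmod2 (g : R -> C) s d : is_cderiv g s d ->
  is_derive (fun x => Cmod (g x) ^ 2)%R s (2 * Re (Cconj (g s) * d))%R.
Proof.
  intros [H1 H2].
  apply (is_derive_ext (fun x => Re (g x) * Re (g x) + Im (g x) * Im (g x))%R).
  { intro x. as_R. rewrite Cmod2_alt. ring. }
  eapply is_derive_eq; [|apply is_derive_Rplus; apply is_derive_Rmult; eassumption].
  as_R. rewrite re_mult, re_conj, im_conj. ring.
Qed.

Lemma Re_conj_mult_le (g d : C) : (Re (Cconj g * d) <= Cmod g * Cmod d)%R.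
Proof.
  rewrite <- (Cmod_conj g), <- Cmod_mult. pose proof (re_le_Cmod (Cconj g * d)).
  pose proof (Rle_abs (Re (Cconj g * d))). lra.
Qed.

Lemma is_derive_exp_decay (k a x : R) :
  is_derive (fun x => exp (- k * (x - a)))%R x (- k * exp (- k * (x - a)))%R.
Proof. auto_derive; [trivial|]. unfold Rminus. ring. Qed.

Section Propagation.

Variables (T al be om b : R) (v m : C) (Y V c E : R -> C) (reg : R -> Prop) (S0 rho : R).

Let q (s : R) : C := RtoC s * Y s.
(** If E' = v E, then (ql, vl, b) solves q' = V, V' = c - q, c' = 0 exactly, by v^2 = -1. The drift
    om/s in E' only adds errors of order 1/s. *)
Let ql (s : R) : C := RtoC b + (E s + m / E s) / v.
Let vl (s : R) : C := E s - m / E s.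
Let x1 (s : R) := q s - ql s.
Let x2 (s : R) := V s - vl s.
Let x3 (s : R) := c s - RtoC b.

Hypothesis HS0 : (1 <= S0)%R.
Hypothesis Hrho : (0 < rho)%R.
Hypothesis Hvv : v * v = - (1).
Hypothesis Hv : Cmod v = 1%R.
Hypothesis HE : forall s, (S0 <= s)%R -> Cmod (E s) = rho.
Hypothesis HE' : forall s, (S0 <= s)%R -> is_cderiv E s (v * RtoC (1 + om / s) * E s).
Hypothesis Hreg : forall s, (S0 <= s)%R -> reg s -> (Cmod (Y s) < 1 / 3)%R ->
  is_cderiv Y s (V s / RtoC s) /\
  is_cderiv V s (rhsV (RtoC T) (RtoC al) (RtoC be) (RtoC s) (Y s) (c s)) /\
  is_cderiv c s (rhsC (RtoC T) (RtoC s) (Y s) (c s)).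
Hypothesis Hreg_cont : forall s, (S0 <= s)%R -> reg s -> ccont Y s.
Hypothesis Hreg_open : forall s, (S0 <= s)%R -> reg s ->
  exists e, (0 < e)%R /\ forall x, (Rabs (x - s) < e)%R -> reg x.
Hypothesis Hreg_pole : forall s, (S0 <= s)%R -> ~ reg s ->
  forall B : R, exists e, (0 < e)%R /\ forall x, (0 < Rabs (x - s) < e)%R -> (B < Cmod (Y x))%R.

(** K0 - 1 bounds the leading terms, so K0 bounds q and c while the deviation is at most 1. K1
    bounds the coefficients of 1/s in the equations for the deviation. In [Lam], one 3 dominates the
    cross terms 4 x1 x2 + 2 x2 x3 and the other the forcing. *)
Let K0 : R := (Rabs b + rho + Cmod m / rho + 1)%R.
Let K1 : R := (rem_bound T al be K0 + (Rabs om + 1) * (2 * K0))%R.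
Let Lam : R := (3 + 3 * K1)%R.

(** Adding eps^2 with eps >= 1/s absorbs the forcing of size 1/s, so that the energy inequality
    becomes homogeneous, f' <= Lam f. *)
Let f (eps s : R) : R := (Cmod (x1 s) ^ 2 + Cmod (x2 s) ^ 2 + Cmod (x3 s) ^ 2 + eps ^ 2)%R.

Lemma carrier_neq_0 s : (S0 <= s)%R -> E s <> 0.
Proof. intro Hs. apply Cmod_gt_0. rewrite HE; assumption. Qed.

Lemma direction_neq_0 : v <> 0.
Proof. apply Cmod_gt_0. rewrite Hv. lra. Qed.

Lemma K0_ge_1 : (1 <= K0)%R.
Proof.
  unfold K0. pose proof (Rabs_pos b).
  assert (0 <= Cmod m / rho)%R by (apply Rdiv_le_0_compat; [apply Cmod_ge_0|exact Hrho]). lra.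
Qed.

Lemma lead_bounds s : (S0 <= s)%R ->
  (Cmod (ql s) <= K0 - 1)%R /\ (Cmod (vl s) <= K0 - 1)%R /\ (Cmod (RtoC b) <= K0 - 1)%R.
Proof.
  intro Hs. pose proof (HE s Hs) as HEs.
  assert (Hm : (Cmod (m / E s) <= Cmod m / rho)%R) by (rewrite Cmod_div, HEs by (now apply carrier_neq_0); lra).
  assert (HE2 : (Cmod (E s) <= rho)%R) by lra.
  pose proof (Cmod_R_le b) as Hb. pose proof (Rabs_pos b).
  assert (0 <= Cmod m / rho)%R by (apply Rdiv_le_0_compat; [apply Cmod_ge_0|exact Hrho]).
  unfold ql, vl, K0. repeat split.
  - assert (Cmod ((E s + m / E s) / v) <= rho + Cmod m / rho)%R.
    { rewrite Cmod_div, Hv by apply direction_neq_0. unfold Rdiv at 1. rewrite Rinv_1, Rmult_1_r. now apply Cmod_plus_le. }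
    eapply Rle_trans; [apply Cmod_plus_le; eassumption|]. lra.
  - eapply Rle_trans; [apply Cmod_minus_le; eassumption|]. lra.
  - lra.
Qed.

Lemma deviation_deriv s : (S0 <= s)%R -> reg s -> (Cmod (Y s) < 1 / 3)%R ->
  is_cderiv x1 s (x2 s + (q s - RtoC om * vl s) / RtoC s) /\
  is_cderiv x2 s (x3 s - x1 s + (remV (RtoC T) (RtoC al) (RtoC be) (q s) (Y s) (c s)
                                   + RtoC om * (ql s - RtoC b)) / RtoC s) /\
  is_cderiv x3 s (remC (RtoC T) (q s) (Y s) (c s) / RtoC s).
Proof.
  intros Hs Hr HY. destruct (Hreg s Hs Hr HY) as [DY [DV DC]].
  assert (Hsp : (0 < s)%R) by lra.
  pose proof (RtoC_pos_neq_0 s Hsp) as Hsn.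
  pose proof (carrier_neq_0 s Hs) as HEn. pose proof direction_neq_0 as Hvn. pose proof (HE' s Hs) as DE.
  assert (Eom : RtoC (1 + om / s) = 1 + RtoC om / RtoC s).
  { rewrite RtoC_plus, RtoC_div by lra. reflexivity. }
  rewrite Eom in DE.
  assert (Dm : is_cderiv (fun s => m / E s) s (- (v * (1 + RtoC om / RtoC s)) * (m / E s))).
  { eapply is_cderiv_eq; [|apply (is_cderiv_div (fun _ => m)); [exact HEn|apply is_cderiv_const|exact DE]].
    field. now split. }
  split; [|split].
  - unfold x1, q, ql.
    eapply is_cderiv_eq; [|apply is_cderiv_minus; [apply is_cderiv_mult; [apply is_cderiv_id|exact DY]
      |apply is_cderiv_plus; [apply is_cderiv_const|
        apply (is_cderiv_div (fun s => E s + m / E s) (fun _ => v)); [exact Hvn|apply is_cderiv_plus; [exact DE|exact Dm]|apply is_cderiv_const]]]].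
    cbv beta. unfold x2, vl, q. field. now repeat split.
  - unfold x2, vl. rewrite rhsV_split in DV by exact Hsp. fold (q s) in DV.
    eapply is_cderiv_eq; [|apply is_cderiv_minus; [exact DV|apply is_cderiv_minus; [exact DE|exact Dm]]].
    unfold x1, x3, ql.
    replace ((E s + m / E s) / v) with (- (v * (E s + m / E s))).
    + field. now split.
    + change ((E s + m / E s) / v) with ((E s + m / E s) * / v).
      replace (/ v) with (- v); [ring|].
      replace (- v) with (/ v * (- (v * v)) * 1 * 1) by (field; exact Hvn). rewrite Hvv. ring.
  - unfold x3. rewrite rhsC_split in DC by assumption. fold (q s) in DC.
    eapply is_cderiv_eq; [|apply is_cderiv_minus; [exact DC|apply is_cderiv_const]].
    field. exact Hsn.
Qed.

Lemma K1_nonneg : (0 <= K1)%R.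
Proof.
  pose proof K0_ge_1. unfold K1, rem_bound.
  pose proof (Rabs_pos T). pose proof (Rabs_pos al). pose proof (Rabs_pos be). pose proof (Rabs_pos om). nra.
Qed.

Lemma small_deviation_bounds eps s : (S0 <= s)%R -> (3 * K0 < S0)%R -> (f eps s <= 1)%R ->
  (Cmod (q s) <= K0)%R /\ (Cmod (c s) <= K0)%R /\ (Cmod (Y s) < 1 / 3)%R.
Proof.
  intros Hs HK Hf. destruct (lead_bounds s Hs) as [B1 [B2 B3]].
  unfold f in Hf.
  assert (X1 : (Cmod (x1 s) <= 1)%R) by nra.
  assert (X3 : (Cmod (x3 s) <= 1)%R) by nra.
  assert (Q : (Cmod (q s) <= K0)%R).
  { replace (q s) with (x1 s + ql s) by (unfold x1; ring). eapply Rle_trans; [apply Cmod_plus_le; eassumption|]. lra. }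
  split; [exact Q|]. split.
  - replace (c s) with (x3 s + RtoC b) by (unfold x3; ring). eapply Rle_trans; [apply Cmod_plus_le; eassumption|]. lra.
  - unfold q in Q. rewrite Cmod_mult, Cmod_R, Rabs_right in Q by lra.
     nra.
Qed.

Lemma energy_deriv eps s : (S0 <= s)%R -> (3 * K0 < S0)%R -> (/ s <= eps)%R -> reg s -> (f eps s <= 1)%R ->
  exists df, is_derive (f eps) s df /\ (df <= Lam * f eps s)%R.
Proof.
  intros Hs HK Heps Hr Hf. destruct (small_deviation_bounds eps s Hs HK Hf) as [Q [Cc HY]].
  destruct (deviation_deriv s Hs Hr HY) as [D1 [D2 D3]].
  destruct (lead_bounds s Hs) as [B1 [B2 B3]].
  pose proof K0_ge_1 as HK0. pose proof K1_nonneg as HK1.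
  destruct (rem_bounds T al be K0 (q s) (Y s) (c s) ltac:(lra) HY Q Cc) as [R1 R2].
  pose proof (Rabs_pos om) as Hom.
  eexists. split.
  - unfold f. apply is_derive_Rplus; [|apply (is_derive_const (V := R_NormedModule))].
    apply is_derive_Rplus; [apply is_derive_Rplus|]; apply is_derive_Cmod2; eassumption.
  - assert (Hdiv : forall w : C, (Cmod w <= K1)%R -> (Cmod (w / RtoC s) <= K1 * eps)%R).
    { intros w Hw. unfold Cdiv. apply Cmod_mult_le; [exact Hw|]. rewrite <- RtoC_inv by lra.
      rewrite Cmod_R, Rabs_right; [exact Heps|]. apply Rle_ge, Rlt_le, Rinv_0_lt_compat. lra. }
    pose proof (Cmod_R_le om) as Hom2.
    assert (W1 : (Cmod ((q s - RtoC om * vl s) / RtoC s) <= K1 * eps)%R).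
    { apply Hdiv. eapply Rle_trans; [apply Cmod_minus_le; [exact Q|apply Cmod_mult_le; eassumption]|].
      unfold K1. assert (0 <= rem_bound T al be K0)%R by (eapply Rle_trans; [apply Cmod_ge_0|exact R1]). nra. }
    assert (W2 : (Cmod ((remV (RtoC T) (RtoC al) (RtoC be) (q s) (Y s) (c s) + RtoC om * (ql s - RtoC b)) / RtoC s) <= K1 * eps)%R).
    { apply Hdiv. eapply Rle_trans; [apply Cmod_plus_le; [exact R1|apply Cmod_mult_le; [exact Hom2|apply Cmod_minus_le; eassumption]]|].
      unfold K1. nra. }
    assert (W3 : (Cmod (remC (RtoC T) (q s) (Y s) (c s) / RtoC s) <= K1 * eps)%R).
    { apply Hdiv. unfold K1. nra. }
    pose proof (Re_conj_mult_le (x1 s) (x2 s + (q s - RtoC om * vl s) / RtoC s)) as M1.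
    pose proof (Re_conj_mult_le (x2 s) (x3 s - x1 s + (remV (RtoC T) (RtoC al) (RtoC be) (q s) (Y s) (c s) + RtoC om * (ql s - RtoC b)) / RtoC s)) as M2.
    pose proof (Re_conj_mult_le (x3 s) (remC (RtoC T) (q s) (Y s) (c s) / RtoC s)) as M3.
    pose proof (Cmod_plus_le (x2 s) _ (Cmod (x2 s)) _ (Rle_refl _) W1) as N1.
    pose proof (Cmod_plus_le (x3 s - x1 s) _ _ _ (Cmod_minus_le _ _ _ _ (Rle_refl _) (Rle_refl _)) W2) as N2.
    pose proof (Cmod_ge_0 (x1 s)) as P1. pose proof (Cmod_ge_0 (x2 s)) as P2. pose proof (Cmod_ge_0 (x3 s)) as P3.
    unfold zero. cbn [R_NormedModule].
    set (a1 := Cmod (x1 s)) in *. set (a2 := Cmod (x2 s)) in *. set (a3 := Cmod (x3 s)) in *.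
    assert (M1' : (a1 * Cmod (x2 s + (q s - RtoC om * vl s) / RtoC s) <= a1 * (a2 + K1 * eps))%R) by now apply Rmult_le_compat_l.
    assert (M2' : (a2 * Cmod (x3 s - x1 s + (remV (RtoC T) (RtoC al) (RtoC be) (q s) (Y s) (c s) + RtoC om * (ql s - RtoC b)) / RtoC s) <= a2 * (a3 + a1 + K1 * eps))%R) by now apply Rmult_le_compat_l.
    assert (M3' : (a3 * Cmod (remC (RtoC T) (q s) (Y s) (c s) / RtoC s) <= a3 * (K1 * eps))%R) by now apply Rmult_le_compat_l.
    unfold f. fold a1 a2 a3. unfold Lam.
    match goal with |- (2 * ?r1 + 2 * ?r2 + 2 * ?r3 + ?z <= _)%R => change z with 0%R; set (u1 := r1) in *; set (u2 := r2) in *; set (u3 := r3) in * end.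
    assert (U1 : (u1 <= a1 * a2 + K1 * (a1 * eps))%R) by lra.
    assert (U2 : (u2 <= a2 * a3 + a2 * a1 + K1 * (a2 * eps))%R) by lra.
    assert (U3 : (u3 <= K1 * (a3 * eps))%R) by lra.
    clear - U1 U2 U3 HK1. clearbody a1 a2 a3 u1 u2 u3 K1.
    pose proof (pow2_ge_0 (a1 - a2)). pose proof (pow2_ge_0 (a2 - a3)).
    pose proof (pow2_ge_0 (a1 - eps)). pose proof (pow2_ge_0 (a2 - eps)). pose proof (pow2_ge_0 (a3 - eps)).

    assert (Z : (2 * (a1 * eps + a2 * eps + a3 * eps) <= a1 ^ 2 + a2 ^ 2 + a3 ^ 2 + 3 * eps ^ 2)%R) by lra.
    assert (ZZ : (K1 * (2 * (a1 * eps + a2 * eps + a3 * eps)) <= K1 * (a1 ^ 2 + a2 ^ 2 + a3 ^ 2 + 3 * eps ^ 2))%R)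
      by now apply Rmult_le_compat_l.
    pose proof (pow2_ge_0 a1). pose proof (pow2_ge_0 a2). pose proof (pow2_ge_0 a3). pose proof (pow2_ge_0 eps).
    assert (0 <= K1 * (a1 ^ 2 + a2 ^ 2 + a3 ^ 2))%R by (apply Rmult_le_pos; lra).
    lra.
Qed.

Lemma energy_gronwall eps a s : (S0 <= a)%R -> (3 * K0 < S0)%R -> (/ a <= eps)%R -> (a <= s)%R ->
  (forall x, (a <= x <= s)%R -> reg x /\ (f eps x <= 1)%R) ->
  (f eps s <= f eps a * exp (Lam * (s - a)))%R.
Proof.
  intros Ha HK Heps Has H.
  assert (Hd : forall x, (a <= x <= s)%R -> exists df, is_derive (f eps) x df /\ (df <= Lam * f eps x)%R).
  { intros x Hx. destruct (H x Hx) as [Hr Hf]. apply energy_deriv; try assumption; try lra.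
    apply Rle_trans with (/ a)%R; [|exact Heps]. apply Rinv_le_contravar; lra. }
  set (g := fun x => (f eps x * exp (- Lam * (x - a)))%R).
  set (dg := fun x => (Derive (f eps) x * exp (- Lam * (x - a)) + f eps x * (- Lam * exp (- Lam * (x - a))))%R).
  assert (Hg : (g s <= g a)%R).
  { apply (decreasing_of_derive g dg a s Has).
    - intros x Hx. destruct (Hd x Hx) as [df [Df _]]. unfold g, dg.
      rewrite (is_derive_unique _ _ _ Df).
      apply (is_derive_Rmult (f eps) (fun x => exp (- Lam * (x - a)))%R); [exact Df|apply is_derive_exp_decay].
    - intros x Hx. destruct (Hd x Hx) as [df [Df Hle]]. unfold dg. rewrite (is_derive_unique _ _ _ Df).
      pose proof (exp_pos (- Lam * (x - a))). nra. }
  unfold g in Hg. rewrite Rminus_diag, Rmult_0_r, exp_0, Rmult_1_r in Hg.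
  apply Rmult_le_compat_r with (r := exp (Lam * (s - a))) in Hg; [|left; apply exp_pos].
  rewrite Rmult_assoc, <- exp_plus in Hg.
  replace (- Lam * (s - a) + Lam * (s - a))%R with 0%R in Hg by ring.
  rewrite exp_0, Rmult_1_r in Hg. exact Hg.
Qed.

Lemma energy_continuous eps s : (S0 <= s)%R -> reg s -> (Cmod (Y s) < 1 / 3)%R -> continuous (f eps) s.
Proof.
  intros Hs Hr HY. destruct (deviation_deriv s Hs Hr HY) as [D1 [D2 D3]].
  eapply (is_derive_Rcontinuous (f eps) s). unfold f.
  apply is_derive_Rplus; [|apply (is_derive_const (V := R_NormedModule))].
  apply is_derive_Rplus; [apply is_derive_Rplus|]; apply is_derive_Cmod2; eassumption.
Qed.

(** A bootstrap: the Gronwall bound needs f <= 1 and yields a value below 1, so it can be continued.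
    While it holds, |Y| <= K0/S0 < 1/3, which keeps the system regular. *)
Lemma propagation a L eps : (S0 <= a)%R -> (3 * K0 < S0)%R -> (/ a <= eps)%R -> (0 <= L)%R ->
  reg a -> (f eps a * exp (Lam * L) < 1)%R ->
  forall s, (a <= s <= a + L)%R -> reg s /\ (f eps s <= f eps a * exp (Lam * L))%R.
Proof.
  intros Ha HK Heps HL Hra Hfa.
  pose proof K1_nonneg as HK1.
  set (eta := (f eps a * exp (Lam * L))%R) in *.
  assert (Hf0 : (0 <= f eps a)%R).
  { unfold f. pose proof (pow2_ge_0 (Cmod (x1 a))). pose proof (pow2_ge_0 (Cmod (x2 a))).
    pose proof (pow2_ge_0 (Cmod (x3 a))). pose proof (pow2_ge_0 eps). lra. }
  assert (Hexp : forall s, (a <= s <= a + L)%R -> (f eps a * exp (Lam * (s - a)) <= eta)%R).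
  { intros s Hs. unfold eta. apply Rmult_le_compat_l; [exact Hf0|].
    assert (Hle : (Lam * (s - a) <= Lam * L)%R) by (apply Rmult_le_compat_l; unfold Lam; lra).
    destruct Hle as [Hlt|Heq]; [left; now apply exp_increasing|rewrite Heq; lra]. }
  assert (Hgr : forall s, (a <= s <= a + L)%R -> (forall x, (a <= x <= s)%R -> reg x /\ (f eps x <= 1)%R) ->
     (f eps s <= eta)%R).
  { intros s Hs H. eapply Rle_trans; [apply (energy_gronwall eps a s); try assumption; lra|]. now apply Hexp. }
  apply (interval_induction (fun s => reg s /\ (f eps s <= eta)%R) a (a + L)); [lra| | |].
  - split; [exact Hra|]. pose proof (Hexp a ltac:(lra)) as K.
    rewrite Rminus_diag, Rmult_0_r, exp_0, Rmult_1_r in K. exact K.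
  - intros x Hx Hs. destruct (Hs x ltac:(lra)) as [Hrx Hfx].
    destruct (small_deviation_bounds eps x ltac:(lra) HK ltac:(lra)) as [_ [_ HYx]].
    destruct (Hreg_open x ltac:(lra) Hrx) as [e1 [He1 H1]].
    pose proof (proj1 (continuous_R_eps _ _) (energy_continuous eps x ltac:(lra) Hrx HYx) (1 - eta)%R ltac:(lra)) as [e2 [He2 H2]].
    exists (Rmin e1 e2). split; [now apply Rmin_pos|]. intros s Hss Hsb.
    minmax.
    assert (Hnew : forall w, (x <= w <= s)%R -> reg w /\ (f eps w <= 1)%R).
    { intros w Hw. assert (Hwx : (Rabs (w - x) < Rmin e1 e2)%R) by (rewrite Rabs_right; lra).
      split; [apply H1; lra|]. specialize (H2 w ltac:(lra)). apply Rabs_def2 in H2. lra. }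
    split; [apply Hnew; lra|]. apply Hgr; [lra|]. intros w Hw.
    destruct (Rle_dec w x) as [Hwx|Hwx]; [destruct (Hs w ltac:(lra)); split; [assumption|lra]|apply Hnew; lra].
  - intros x Hx Hs.
    assert (HYb : forall s, (a <= s < x)%R -> (Cmod (Y s) <= K0 / S0)%R).
    { intros s Hss. destruct (Hs s Hss) as [_ Hfs].
      destruct (small_deviation_bounds eps s ltac:(lra) HK ltac:(lra)) as [Q _].
      unfold q in Q. rewrite Cmod_mult, Cmod_R, Rabs_right in Q by lra.
      apply le_div_of_mul_le; [lra|]. pose proof (Cmod_ge_0 (Y s)). nra. }
    assert (HK3 : (K0 / S0 < 1 / 3)%R).
    { apply Rlt_div_l; [lra|]. lra. }
    assert (Hleft : forall e, (0 < e)%R -> exists s, (a <= s < x)%R /\ (0 < Rabs (s - x) < e)%R).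
    { intros e He. exists (Rmax a (x - e / 2)).
      minmax.
      assert (Rmax a (x - e / 2) < x)%R by (apply Rmax_lub_lt; lra).
      rewrite Rabs_left by lra. lra. }
    (* A pole at x would make |Y| exceed K0/S0 at points just to the left of x. *)
    assert (Hrx : reg x).
    { apply NNPP. intro Hn. destruct (Hreg_pole x ltac:(lra) Hn (K0 / S0)%R) as [e [He H]].
      destruct (Hleft e He) as [s [Hs1 Hs2]]. specialize (H s Hs2). specialize (HYb s Hs1). lra. }
    assert (HYx : (Cmod (Y x) < 1 / 3)%R).
    { pose proof (proj1 (ccont_eps _ _) (Hreg_cont x ltac:(lra) Hrx) (1 / 3 - K0 / S0)%R ltac:(lra)) as [e [He H]].
      destruct (Hleft e He) as [s [Hs1 Hs2]]. specialize (H s ltac:(lra)). specialize (HYb s Hs1).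
      pose proof (Cmod_triangle (Y s) (- (Y s - Y x))) as K. rewrite Cmod_opp in K.
      replace (Y s + - (Y s - Y x)) with (Y x) in K by ring. lra. }
    split; [exact Hrx|]. apply le_epsilon. intros e0 He0.
    pose proof (proj1 (continuous_R_eps _ _) (energy_continuous eps x ltac:(lra) Hrx HYx) e0 He0) as [e [He H]].
    destruct (Hleft e He) as [s [Hs1 Hs2]]. specialize (H s ltac:(lra)). destruct (Hs s Hs1) as [_ Hfs].
    apply Rabs_def2 in H. lra.
Qed.

End Propagation.
(** * Real solutions *)

Open Scope R_scope.

Definition vanishes (g : R -> R) : Prop :=
  forall eps, 0 < eps -> exists X, forall s, X <= s -> Rabs (g s) < eps.

(** Integration from infinity, where g is 0: 2 M / sqrt s is the integral of M / (x sqrt x) from s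
    on. The one-sided form suffices for the quadratic quantity [N], of which only an upper bound is
    wanted. *)
Lemma decay_of_derive_ge (g : R -> R) (S M : R) :
  0 < S -> 0 <= M -> vanishes g ->
  (forall s, S <= s -> exists dg : R, is_derive g s dg /\ - (M / (s * sqrt s)) <= dg) ->
  forall s, S <= s -> g s <= 2 * M / sqrt s.
Proof.
  intros HS HM Hg Hd s Hs.
  set (h := fun x => 2 * M / sqrt x - g x).
  set (dh := fun x => - (M / (x * sqrt x)) - Derive g x).
  apply Rnot_lt_le. intro Hlt.
  assert (Hpos : 0 < g s - 2 * M / sqrt s) by lra.
  destruct (Hg _ Hpos) as [X HX].
  set (x := Rmax s X). pose proof (Rmax_l s X) as L1. pose proof (Rmax_r s X) as L2. fold x in L1, L2.
  specialize (HX x L2).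
  assert (Hh : h x <= h s).
  { apply (decreasing_of_derive h dh s x L1).
    - intros w Hw. destruct (Hd w ltac:(lra)) as [dg [Dg _]].
      assert (Hsw : 0 < sqrt w) by (apply sqrt_lt_R0; lra).
      unfold h, dh. rewrite (is_derive_unique _ _ _ Dg). apply is_derive_Rminus; [|exact Dg].
      auto_derive; [split; [lra|split; [lra|trivial]]|].
      rewrite <- (sqrt_sqrt w) at 4 by lra. field. lra.
    - intros w Hw. destruct (Hd w ltac:(lra)) as [dg [Dg Hge]]. unfold dh.
      rewrite (is_derive_unique _ _ _ Dg). lra. }
  unfold h in Hh.
  assert (0 < sqrt x) by (apply sqrt_lt_R0; lra).
  assert (0 <= 2 * M / sqrt x) by (apply Rdiv_le_0_compat; lra).
  pose proof (Rle_abs (g x)). lra.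
Qed.

Lemma vanishes_plus f g : vanishes f -> vanishes g -> vanishes (fun s => f s + g s).
Proof.
  intros Hf Hg eps He. destruct (Hf (eps / 2) ltac:(lra)) as [X1 H1]. destruct (Hg (eps / 2) ltac:(lra)) as [X2 H2].
  exists (Rmax X1 X2). intros s Hs. minmax.
  specialize (H1 s ltac:(lra)). specialize (H2 s ltac:(lra)). pose proof (Rabs_triang (f s) (g s)). lra.
Qed.

Lemma vanishes_mult_bounded f g M X0 : vanishes g -> (forall s, X0 <= s -> Rabs (f s) <= M) ->
  vanishes (fun s => f s * g s).
Proof.
  intros Hg Hf eps He.
  assert (HM : 0 <= M) by (eapply Rle_trans; [apply Rabs_pos|apply (Hf X0); lra]).
  destruct (Hg (eps / (M + 1))) as [X1 H1]; [apply Rdiv_lt_0_compat; lra|].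
  exists (Rmax X1 X0). intros s Hs. minmax.
  specialize (H1 s ltac:(lra)). specialize (Hf s ltac:(lra)). rewrite Rabs_mult.
  apply mul_lt_of_lt_div in H1; [|lra].  pose proof (Rabs_pos (f s)). nra.
Qed.

Lemma vanishes_ext f g X0 : (forall s, X0 <= s -> f s = g s) -> vanishes f -> vanishes g.
Proof.
  intros E Hf eps He. destruct (Hf eps He) as [X1 H1]. exists (Rmax X1 X0). intros s Hs.
  minmax. rewrite <- E by lra. apply H1. lra.
Qed.

Lemma vanishes_opp f : vanishes f -> vanishes (fun s => - f s).
Proof. intros Hf eps He. destruct (Hf eps He) as [X H]. exists X. intros s Hs. rewrite Rabs_Ropp. now apply H. Qed.

Section Rigidity.

(* (Q, W, C) will be the imaginary part of (q, V, c). At order 1/s the only growing mode is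
   logarithmic (C shifts the frequency of the oscillation), so a solution which tends to 0
   vanishes. Ct and N are C and the squared amplitude of the oscillation, corrected at order
   1/s so that their derivatives become integrable. *)
Variables (Q W C p : R -> R) (om K S : R).
Let D (s : R) : R := Rabs (Q s) + Rabs (W s) + Rabs (C s).

Hypothesis HK : 1 <= K.
Hypothesis HS : 1 <= S.
Hypothesis Hp : forall s, S <= s -> Rabs (p s) <= K.
Hypothesis Hom : Rabs om <= K.
Hypothesis HQ : forall s, S <= s -> is_derive Q s (W s + Q s / s).
Hypothesis HW : forall s, S <= s -> exists dW : R, is_derive W s dW /\
  Rabs (dW + (Q s - C s) + (4 * p s * C s + 2 * om * Q s) / s) <= K * D s / (s * sqrt s).
Hypothesis HC : forall s, S <= s -> exists dC : R, is_derive C s dC /\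
  Rabs (dC - (Q s - C s) / s) <= K * D s / (s * s).
Hypothesis VQ : vanishes Q.
Hypothesis VW : vanishes W.
Hypothesis VC : vanishes C.

Let Ct (s : R) : R := C s + W s / s.
Let N (s : R) : R := (1 + 2 * om / s) * ((Q s - C s) * (Q s - C s)) + W s * W s.

Lemma sqrt_ge_1 s : 1 <= s -> 1 <= sqrt s.
Proof. intro H. rewrite <- sqrt_1. now apply sqrt_le_1_alt. Qed.

Lemma sqrt_le_self s : 1 <= s -> sqrt s <= s.
Proof. intro H. pose proof (sqrt_ge_1 s H). rewrite <- (sqrt_sqrt s) at 2 by lra. nra. Qed.

(** Since W' = -(Q - C) + O(1/s), the derivative of W/s cancels the non-integrable part (Q - C)/s of
    C'. The remaining terms add up to 9 K B / s^2; 20 is a rounded majorant. *)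
Lemma rigid_Ct B s : 0 <= B -> S <= s -> D s <= B ->
  exists d, is_derive Ct s d /\ Rabs d <= 20 * K * B / (s * sqrt s).
Proof.
  intros HB Hs HD. destruct (HW s Hs) as [dW [DW BW]]. destruct (HC s Hs) as [dC [DC BC]].
  specialize (Hp s Hs).
  assert (Hs1 : 1 <= s) by lra. pose proof (sqrt_ge_1 s Hs1) as Hq1. pose proof (sqrt_le_self s Hs1) as Hqs.
  assert (HDp : Rabs (Q s) <= D s /\ Rabs (W s) <= D s /\ Rabs (C s) <= D s).
  { unfold D. pose proof (Rabs_pos (Q s)). pose proof (Rabs_pos (W s)). pose proof (Rabs_pos (C s)). lra. }
  destruct HDp as [BQ [BWs BCs]].
  eexists. split.
  - unfold Ct. apply is_derive_Rplus; [exact DC|]. apply is_derive_Rdiv; [exact DW|apply (is_derive_id (K := R_AbsRing))|lra].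
  - set (e1 := dC - (Q s - C s) / s) in *.
    set (e2 := dW + (Q s - C s) + (4 * p s * C s + 2 * om * Q s) / s) in *.
    unfold one. cbn.
    replace (dC + (dW * s - W s * 1) / (s * (s * 1))) with
      (e1 + e2 / s - (4 * p s * C s + 2 * om * Q s) / (s * s) - W s / (s * s)).
    2:{ unfold e1, e2. field. lra. }
    assert (Hss : 0 < s * s) by nra.
    assert (X : Rabs (4 * p s * C s + 2 * om * Q s) <= 6 * K * B).
    { eapply Rle_trans; [apply Rabs_triang|]. rewrite !Rabs_mult.
      rewrite (Rabs_right 4), (Rabs_right 2) by lra.
      pose proof (Rabs_pos (p s)). pose proof (Rabs_pos om). pose proof (Rabs_pos (C s)). pose proof (Rabs_pos (Q s)).
      assert (Rabs (p s) * Rabs (C s) <= K * B) by (apply Rmult_le_compat; lra).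
      assert (Rabs om * Rabs (Q s) <= K * B) by (apply Rmult_le_compat; lra). lra. }
    assert (E1 : Rabs e1 <= K * B / (s * s)).
    { eapply Rle_trans; [exact BC|]. apply Rmult_le_compat_r; [left; now apply Rinv_0_lt_compat|]. nra. }
    assert (E2 : Rabs (e2 / s) <= K * B / (s * s)).
    { unfold Rdiv at 1. rewrite Rabs_mult, (Rabs_right (/ s)).
      2:{ apply Rle_ge, Rlt_le, Rinv_0_lt_compat. lra. }
      replace (K * B / (s * s)) with (K * B / s * / s) by (field; lra).
      apply Rmult_le_compat_r; [left; apply Rinv_0_lt_compat; lra|].
      eapply Rle_trans; [exact BW|].
      apply Rmult_le_compat; [|left; apply Rinv_0_lt_compat; nra| |].
      - apply Rmult_le_pos; [lra|]. pose proof (Rabs_pos (Q s)). lra.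
      - apply Rmult_le_compat_l; lra.
      - apply Rinv_le_contravar; nra. }
    assert (E3 : Rabs ((4 * p s * C s + 2 * om * Q s) / (s * s)) <= 6 * K * B / (s * s)).
    { unfold Rdiv at 1. rewrite Rabs_mult, (Rabs_right (/ (s * s))).
      2:{ apply Rle_ge, Rlt_le, Rinv_0_lt_compat, Hss. }
      apply Rmult_le_compat_r; [left; now apply Rinv_0_lt_compat|exact X]. }
    assert (E4 : Rabs (W s / (s * s)) <= K * B / (s * s)).
    { unfold Rdiv at 1. rewrite Rabs_mult, (Rabs_right (/ (s * s))).
      2:{ apply Rle_ge, Rlt_le, Rinv_0_lt_compat, Hss. }
      apply Rmult_le_compat_r; [left; now apply Rinv_0_lt_compat|]. nra. }
    apply Rle_trans with (20 * K * B / (s * s)).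
    + set (Z := (4 * p s * C s + 2 * om * Q s) / (s * s)) in *. set (Z2 := W s / (s * s)) in *. set (Z3 := e2 / s) in *.
      pose proof (Rabs_triang (e1 + Z3 - Z) (- Z2)) as T1. pose proof (Rabs_triang (e1 + Z3) (- Z)) as T2.
      pose proof (Rabs_triang e1 Z3) as T3. rewrite Rabs_Ropp in T1, T2.
      unfold Rminus in *.
      assert (0 <= K * B / (s * s)) by (apply Rdiv_le_0_compat; nra).
      replace (20 * K * B / (s * s)) with (20 * (K * B / (s * s))) by (field; lra).
      replace (6 * K * B / (s * s)) with (6 * (K * B / (s * s))) in E3 by (field; lra). lra.
    + apply Rmult_le_compat_l; [nra|]. apply Rinv_le_contravar; nra.
Qed.

(** The one-sided decay lemma is applied to Ct and to -Ct; 41 is 2 times 20 plus 1 for the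
    correction W/s. *)
Lemma rigid_C B S1 : 0 <= B -> S <= S1 -> (forall s, S1 <= s -> D s <= B) ->
  forall s, S1 <= s -> Rabs (C s) <= 41 * K * B / sqrt s.
Proof.
  intros HB HS1 HD.
  assert (VWs : vanishes (fun s => / s * W s)).
  { apply (vanishes_mult_bounded _ _ 1 1 VW). intros s Hs. rewrite Rabs_right.
    - rewrite <- Rinv_1. apply Rinv_le_contravar; lra.
    - apply Rle_ge, Rlt_le, Rinv_0_lt_compat. lra. }
  assert (VCt : vanishes Ct).
  { apply (vanishes_ext (fun s => C s + / s * W s) _ 1); [|now apply vanishes_plus].
    intros s Hs. unfold Ct. field. lra. }
  assert (HM : 0 <= 20 * K * B) by nra.
  assert (U1 : forall s, S1 <= s -> Ct s <= 2 * (20 * K * B) / sqrt s).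
  { apply (decay_of_derive_ge Ct S1); [lra|exact HM|exact VCt|].
    intros s Hs. destruct (rigid_Ct B s HB ltac:(lra) (HD s Hs)) as [d [Dd Bd]]. exists d. split; [exact Dd|].
    apply Rabs_le_between in Bd. lra. }
  assert (U2 : forall s, S1 <= s -> - Ct s <= 2 * (20 * K * B) / sqrt s).
  { apply (decay_of_derive_ge (fun s => - Ct s) S1); [lra|exact HM|now apply vanishes_opp|].
    intros s Hs. destruct (rigid_Ct B s HB ltac:(lra) (HD s Hs)) as [d [Dd Bd]]. exists (- d).
    split; [now apply (is_derive_opp (V := R_NormedModule))|].
    apply Rabs_le_between in Bd. lra. }
  intros s Hs. specialize (U1 s Hs). specialize (U2 s Hs). specialize (HD s Hs).
  assert (Hs1 : 1 <= s) by lra. pose proof (sqrt_ge_1 s Hs1) as Hq1. pose proof (sqrt_le_self s Hs1) as Hqs.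
  assert (BW : Rabs (W s / s) <= K * B / sqrt s).
  { unfold Rdiv at 1. rewrite Rabs_mult, (Rabs_right (/ s)) by (apply Rle_ge, Rlt_le, Rinv_0_lt_compat; lra).
    apply Rmult_le_compat; [apply Rabs_pos|left; apply Rinv_0_lt_compat; lra| |apply Rinv_le_contravar; lra].
    unfold D in HD. pose proof (Rabs_pos (Q s)). pose proof (Rabs_pos (C s)). nra. }
  replace (C s) with (Ct s - W s / s) by (unfold Ct; ring).
  replace (41 * K * B / sqrt s) with (2 * (20 * K * B) / sqrt s + K * B / sqrt s) by (field; lra).
  unfold Rminus. eapply Rle_trans; [apply Rabs_triang|]. rewrite Rabs_Ropp.
  apply Rplus_le_compat; [|exact BW]. apply Rabs_le_between. lra.
Qed.

(** In (Q - C)' the term Q/s cancels against (Q - C)/s from C', leaving C/s; the factor 1 + 2 om/s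
    cancels the frequency term of W'. Every surviving term of order 1/s contains C, which [rigid_C]
    makes O(1/sqrt s), so N' is integrable. *)
Lemma rigid_N B S1 : 0 <= B -> S <= S1 -> (forall s, S1 <= s -> D s <= B) ->
  forall s, S1 <= s -> exists d, is_derive N s d /\ - (3000 * K ^ 2 * B ^ 2 / (s * sqrt s)) <= d.
Proof.
  intros HB HS1 HD s Hs. pose proof (rigid_C B S1 HB HS1 HD s Hs) as HCs. specialize (HD s Hs).
  assert (HsS : S <= s) by lra.
  destruct (HW s HsS) as [dW [DW BW]]. destruct (HC s HsS) as [dC [DC BC]].
  pose proof (HQ s HsS) as DQ. specialize (Hp s HsS).
  assert (Hs1 : 1 <= s) by lra. pose proof (sqrt_ge_1 s Hs1) as Hq1. pose proof (sqrt_le_self s Hs1) as Hqs.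
  assert (BD : Rabs (Q s) <= B /\ Rabs (W s) <= B /\ Rabs (C s) <= B).
  { unfold D in HD. pose proof (Rabs_pos (Q s)). pose proof (Rabs_pos (W s)). pose proof (Rabs_pos (C s)). lra. }
  destruct BD as [BQ [BWs BCs]].
  assert (Dx : is_derive (fun s => Q s - C s) s (W s + Q s / s - dC)) by (apply is_derive_Rminus; assumption).
  assert (Dco : is_derive (fun s => 1 + 2 * om / s) s (- (2 * om / (s * s)))).
  { auto_derive; [lra|]. field. lra. }
  eexists. split.
  { unfold N. apply is_derive_Rplus; apply is_derive_Rmult; [exact Dco| |exact DW|exact DW].
    apply is_derive_Rmult; exact Dx. }
  cbv beta.
  set (e1 := dC - (Q s - C s) / s) in *.
  set (e2 := dW + (Q s - C s) + (4 * p s * C s + 2 * om * Q s) / s) in *.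
  set (r := s * sqrt s). assert (Hr : 0 < r) by (unfold r; nra).
  assert (Hrs : r <= s * s) by (unfold r; nra).
  set (iss := / (s * s)). set (ir := / r).
  assert (Hiss : 0 < iss <= ir).
  { split; [apply Rinv_0_lt_compat; nra|]. apply Rinv_le_contravar; lra. }
  assert (Hir1 : ir <= 1).
  { unfold ir. rewrite <- Rinv_1. apply Rinv_le_contravar; [lra|]. unfold r. nra. }
  set (x := Q s - C s) in *.
  assert (Bx : Rabs x <= 2 * B).
  { unfold x. pose proof (Rabs_triang (Q s) (- C s)). rewrite Rabs_Ropp in *. unfold Rminus. lra. }
  assert (Be1 : Rabs e1 <= K * B * ir).
  { eapply Rle_trans; [exact BC|]. unfold Rdiv. fold iss. apply Rmult_le_compat; [|lra| |lra].
    - apply Rmult_le_pos; [lra|]. unfold D. pose proof (Rabs_pos (Q s)). pose proof (Rabs_pos (W s)). pose proof (Rabs_pos (C s)). lra.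
    - apply Rmult_le_compat_l; lra. }
  assert (Be2 : Rabs e2 <= K * B * ir).
  { eapply Rle_trans; [exact BW|]. unfold Rdiv. fold r ir. apply Rmult_le_compat_r; [lra|].
    apply Rmult_le_compat_l; lra. }
  set (y := C s / s).
  assert (By : Rabs y <= 41 * K * B * ir).
  { unfold y, Rdiv. rewrite Rabs_mult, (Rabs_right (/ s)) by (apply Rle_ge, Rlt_le, Rinv_0_lt_compat; lra).
    replace (41 * K * B * ir) with (41 * K * B / sqrt s * / s) by (unfold ir, r; field; lra).
    apply Rmult_le_compat_r; [left; apply Rinv_0_lt_compat; lra|exact HCs]. }
  set (k := 2 * om / s).
  assert (Bk : Rabs k <= 2 * K).
  { unfold k, Rdiv. rewrite !Rabs_mult, (Rabs_right 2), (Rabs_right (/ s)) by (try apply Rle_ge, Rlt_le, Rinv_0_lt_compat; lra).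
    assert (/ s <= 1) by (rewrite <- Rinv_1; apply Rinv_le_contravar; lra).
 pose proof (Rabs_pos om). nra. }
  assert (EdC : dC = e1 + x / s) by (unfold e1; ring).
  assert (EdW : dW = e2 - x - k * x - (4 * p s + 2 * om) * y).
  { unfold e2, k, y, x. field. lra. }
  match goal with |- _ <= ?d => replace d with
    (- (2 * om * iss * (x * x)) + 2 * (1 + k) * x * (y - e1) + 2 * W s * (e2 - (4 * p s + 2 * om) * y)) end.
  2:{ as_R. rewrite EdC, EdW. replace (W s + Q s / s - (e1 + x / s)) with (W s + y - e1).
      - fold k. replace (2 * om / (s * s)) with (2 * om * iss) by reflexivity. ring.
      - unfold y, x. field. lra. }
  assert (M : forall a b A1 B1, Rabs a <= A1 -> Rabs b <= B1 -> Rabs (a * b) <= A1 * B1).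
  { intros a b A1 B1 Ha Hb. rewrite Rabs_mult. apply Rmult_le_compat; try assumption; apply Rabs_pos. }
  assert (P : forall a b A1 B1, Rabs a <= A1 -> Rabs b <= B1 -> Rabs (a + b) <= A1 + B1).
  { intros a b A1 B1 Ha Hb. pose proof (Rabs_triang a b). lra. }
  assert (Mi : forall a b A1 B1, Rabs a <= A1 -> Rabs b <= B1 -> Rabs (a - b) <= A1 + B1).
  { intros a b A1 B1 Ha Hb. unfold Rminus. apply P; [assumption|]. now rewrite Rabs_Ropp. }
  assert (Op : forall a A1, Rabs a <= A1 -> Rabs (- a) <= A1) by (intros; now rewrite Rabs_Ropp).

  assert (R1 : Rabs 1 <= 1) by (rewrite Rabs_right; lra).
  assert (Ri : Rabs iss <= ir) by (rewrite Rabs_right; lra).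
  match goal with |- _ <= ?d => assert (Hd : Rabs d <= 3000 * K ^ 2 * B ^ 2 / r) end.
  { eapply Rle_trans.
    { clearbody e1 e2 x y k iss. repeat first [eassumption|apply P|apply Mi|apply Op|apply M]. }
    unfold Rdiv. fold ir.
    assert (HKK : K <= K ^ 2) by (simpl; nra).
    set (w := B ^ 2 * ir). assert (Hw : 0 <= w) by (unfold w; apply Rmult_le_pos; [apply pow2_ge_0|lra]).
    replace (3000 * K ^ 2 * B ^ 2 * ir) with (3000 * (K ^ 2 * w)) by (unfold w; ring).
    (* The collected coefficients of the termwise bounds; with K <= K^2 their sum 1006 stays below
       3000. *)
    match goal with |- ?l <= _ => replace l with (828 * (K ^ 2 * w) + 178 * (K * w)) by (unfold w; ring) end.
    nra. }
  apply Rabs_le_between in Hd. lra.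
Qed.

Lemma rigid_N_vanishes B S1 : S <= S1 -> (forall s, S1 <= s -> D s <= B) -> vanishes N.
Proof.
  intros HS1 HD.
  assert (BD : forall s, S1 <= s -> Rabs (Q s) <= B /\ Rabs (W s) <= B /\ Rabs (C s) <= B).
  { intros s Hs. specialize (HD s Hs). unfold D in HD.
    pose proof (Rabs_pos (Q s)). pose proof (Rabs_pos (W s)). pose proof (Rabs_pos (C s)). lra. }
  assert (Vx : vanishes (fun s => Q s + - C s)) by (apply vanishes_plus; [exact VQ|now apply vanishes_opp]).
  assert (Bx : forall s, S1 <= s -> Rabs (Q s + - C s) <= 2 * B).
  { intros s Hs. destruct (BD s Hs) as [B1 [B2 B3]]. pose proof (Rabs_triang (Q s) (- C s)).
    rewrite (Rabs_Ropp (C s)) in *. lra. }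
  apply (vanishes_ext (fun s => (1 + 2 * om / s) * ((Q s + - C s) * (Q s + - C s)) + W s * W s) _ S1).
  { intros s Hs. unfold N. ring. }
  apply vanishes_plus.
  - apply (vanishes_mult_bounded _ _ (1 + 2 * K) S1).
    + now apply (vanishes_mult_bounded _ _ (2 * B) S1).
    + intros s Hs. eapply Rle_trans; [apply Rabs_triang|]. rewrite Rabs_R1. apply Rplus_le_compat_l.
      unfold Rdiv. rewrite !Rabs_mult, (Rabs_right 2), (Rabs_right (/ s)) by (try apply Rle_ge, Rlt_le, Rinv_0_lt_compat; lra).
      assert (/ s <= 1) by (rewrite <- Rinv_1; apply Rinv_le_contravar; lra).
 pose proof (Rabs_pos om). nra.
  - apply (vanishes_mult_bounded _ _ B S1 VW). intros s Hs. now apply BD.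
Qed.

(** Integrating from infinity improves a bound by half on the same half-line [S1, oo), with S'
    independent of B. The step can thus be iterated indefinitely without losing ground, which forces
    D = 0. *)
Lemma rigid_step : exists S', S <= S' /\ forall S1 B, S' <= S1 -> 0 <= B ->
  (forall s, S1 <= s -> D s <= B) -> forall s, S1 <= s -> D s <= B / 2.
Proof.
  (* For sqrt s >= Z the bounds become N <= 0.006 B^2 and |C| <= 0.001 B, which leave |Q - C| <= 0.2
     B and |W| <= 0.1 B, hence D < B/2. *)
  set (Z := 1000000 * K ^ 2).
  assert (HZ : 1000000 * K <= Z) by (unfold Z; simpl; nra).
  exists (Rmax S (Z * Z)). pose proof (Rmax_l S (Z * Z)) as L1. pose proof (Rmax_r S (Z * Z)) as L2.
  split; [exact L1|]. intros S1 B HS' HB HD s Hs. apply (Rle_trans _ _ _ L1) in HS' as L1'.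
  clear L1. rename L1' into L1. apply (Rle_trans _ _ _ L2) in HS' as L2'.
  assert (Hsq : Z <= sqrt s).
  { rewrite <- (sqrt_square Z) by lra. apply sqrt_le_1_alt. lra. }
  pose proof (rigid_C B S1 HB L1 HD s Hs) as HCs.
  pose proof (decay_of_derive_ge N S1 (3000 * K ^ 2 * B ^ 2) ltac:(lra)
    ltac:(pose proof (pow2_ge_0 K); pose proof (pow2_ge_0 B); nra) (rigid_N_vanishes B S1 L1 HD) (rigid_N B S1 HB L1 HD) s Hs) as HN.
  assert (HN2 : N s <= B ^ 2 * (6 / 1000)).
  { eapply Rle_trans; [exact HN|]. apply div_le_of_le_mul; [lra|].
    apply Rle_trans with (B ^ 2 * (6 / 1000) * Z).
    - unfold Z. right. field.
    - apply Rmult_le_compat_l; [|exact Hsq]. pose proof (pow2_ge_0 B). lra. }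
  assert (HC2 : Rabs (C s) <= B * (1 / 1000)).
  { eapply Rle_trans; [exact HCs|]. apply div_le_of_le_mul; [lra|].
    apply Rle_trans with (B * (1 / 1000) * (1000000 * K)); [nra|]. apply Rmult_le_compat_l; [lra|lra]. }
  assert (Hk : Rabs (2 * om / s) <= 1 / 2).
  { unfold Rdiv at 1. rewrite !Rabs_mult, (Rabs_right 2), (Rabs_right (/ s)) by (try apply Rle_ge, Rlt_le, Rinv_0_lt_compat; lra).
    apply (div_le_of_le_mul (2 * Rabs om) (1 / 2) s); [lra|]. nra. }
  apply Rabs_le_between in Hk. unfold N in HN2.
  set (x := Q s - C s) in *.

  assert (Hx : Rabs x <= B * (2 / 10)).
  { apply Rabs_le_between. split; nra. }
  assert (HWb : Rabs (W s) <= B * (1 / 10)).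
  { apply Rabs_le_between. split; nra. }
  unfold D. replace (Q s) with (x + C s) by (unfold x; ring).
  pose proof (Rabs_triang x (C s)). lra.
Qed.

Lemma rigid_zero : exists S1, forall s, S1 <= s -> D s = 0.
Proof.
  destruct rigid_step as [S1 [HS1 Hstep]].
  destruct (VQ (1 / 3) ltac:(lra)) as [X1 H1]. destruct (VW (1 / 3) ltac:(lra)) as [X2 H2].
  destruct (VC (1 / 3) ltac:(lra)) as [X3 H3].
  set (S2 := Rmax S1 (Rmax X1 (Rmax X2 X3))).
  pose proof (Rmax_l S1 (Rmax X1 (Rmax X2 X3))) as L1. pose proof (Rmax_r S1 (Rmax X1 (Rmax X2 X3))) as L2.
  fold S2 in L1, L2. minmax.
  assert (Hn : forall n s, S2 <= s -> D s <= (1 / 2) ^ n).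
  { induction n as [|n IH]; intros s Hs.
    - simpl. unfold D. specialize (H1 s ltac:(lra)). specialize (H2 s ltac:(lra)). specialize (H3 s ltac:(lra)). lra.
    - simpl. replace (1 / 2 * (1 / 2) ^ n) with ((1 / 2) ^ n / 2) by field.
      apply (Hstep S2); [exact L1|apply pow_le; lra|exact IH|exact Hs]. }
  exists S2. intros s Hs. apply Rle_antisym.
  - apply le_epsilon. intros eps He. destruct (geom_half_lim 1 eps He) as [n Hnn].
    specialize (Hnn n (Nat.le_refl n)). specialize (Hn n s Hs). lra.
  - unfold D. pose proof (Rabs_pos (Q s)). pose proof (Rabs_pos (W s)). pose proof (Rabs_pos (C s)). lra.
Qed.

End Rigidity.
Open Scope C_scope.

(** * The imaginary part of the ray system *)

(** Bounded functions whose imaginary part is at most linear in D. They form an algebra containing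
    real constants, q, c, Y and 1/(Y - 1), so the imaginary part of any nonlinear remainder is
    controlled mechanically. *)
Definition im_controlled (S : R) (D : R -> R) (g : R -> C) : Prop :=
  exists K : R, (0 <= K)%R /\ forall s, (S <= s)%R -> (Cmod (g s) <= K)%R /\ (Rabs (Im (g s)) <= K * D s)%R.

Lemma im_controlled_const S D (r : R) : (forall s, 0 <= D s)%R -> im_controlled S D (fun _ => RtoC r).
Proof.
  intro HD. exists (Rabs r). split; [apply Rabs_pos|]. intros s _. split; [apply Cmod_R_le|].
  simpl. rewrite Rabs_R0. apply Rmult_le_pos; [apply Rabs_pos|apply HD].
Qed.

Lemma im_controlled_plus S D f g : im_controlled S D f -> im_controlled S D g ->
  im_controlled S D (fun s => f s + g s).
Proof.
  intros [K1 [HK1 H1]] [K2 [HK2 H2]]. exists (K1 + K2)%R. split; [lra|]. intros s Hs.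
  destruct (H1 s Hs) as [A1 B1]. destruct (H2 s Hs) as [A2 B2]. split; [now apply Cmod_plus_le|].
  rewrite im_plus. eapply Rle_trans; [apply Rabs_triang|]. lra.
Qed.

Lemma im_controlled_opp S D f : im_controlled S D f -> im_controlled S D (fun s => - f s).
Proof.
  intros [K1 [HK1 H1]]. exists K1. split; [exact HK1|]. intros s Hs. destruct (H1 s Hs) as [A1 B1].
  split; [now apply Cmod_opp_le|]. simpl. rewrite Rabs_Ropp. exact B1.
Qed.

Lemma im_controlled_minus S D f g : im_controlled S D f -> im_controlled S D g ->
  im_controlled S D (fun s => f s - g s).
Proof. intros H1 H2. apply im_controlled_plus; [exact H1|now apply im_controlled_opp]. Qed.

Lemma im_controlled_mult S D f g : im_controlled S D f -> im_controlled S D g ->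
  im_controlled S D (fun s => f s * g s).
Proof.
  intros [K1 [HK1 H1]] [K2 [HK2 H2]]. exists (2 * (K1 * K2))%R. split; [nra|]. intros s Hs.
  destruct (H1 s Hs) as [A1 B1]. destruct (H2 s Hs) as [A2 B2].
  split; [pose proof (Cmod_mult_le _ _ _ _ A1 A2); nra|].
  rewrite im_mult. eapply Rle_trans; [apply Rabs_triang|]. rewrite !Rabs_mult.
  pose proof (re_le_Cmod (f s)). pose proof (re_le_Cmod (g s)).
  assert (Rabs (Re (f s)) * Rabs (Im (g s)) <= K1 * (K2 * D s))%R
    by (apply Rmult_le_compat; try apply Rabs_pos; lra).
  assert (Rabs (Im (f s)) * Rabs (Re (g s)) <= (K1 * D s) * K2)%R
    by (apply Rmult_le_compat; try apply Rabs_pos; lra).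
  nra.
Qed.

(** |Im 1/(Y - 1)| = |Im Y| / |Y - 1|^2, and 9/4 is the square of the bound 3/2 on 1/|Y - 1|. *)
Lemma im_controlled_inv_minus1 S D Y : (forall s, 0 <= D s)%R -> (forall s, (S <= s)%R -> (Cmod (Y s) < 1 / 3)%R) ->
  im_controlled S D Y -> im_controlled S D (fun s => / (Y s - 1)).
Proof.
  intros HDp HY [K [HK H]]. exists (3 / 2 + 9 / 4 * K)%R. split; [lra|]. intros s Hs.
  destruct (H s Hs) as [A B]. pose proof (Cmod_inv_minus1_le _ (HY s Hs)) as Hi.
  destruct (Cmod_lt1_minus1_nz _ (HY s Hs)) as [Hnz _].
  split; [lra|].
  assert (E : Im (/ (Y s - 1)) = (- Im (Y s) * (Cmod (/ (Y s - 1)) * Cmod (/ (Y s - 1))))%R).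
  { rewrite Cmod_inv by exact Hnz. rewrite <- Rinv_mult.
    replace (Cmod (Y s - 1) * Cmod (Y s - 1))%R with (Cmod (Y s - 1) ^ 2)%R by ring.
    rewrite Cmod2_alt. unfold Cinv, Im, Re. cbn [fst snd]. unfold Rdiv.
    replace (snd (Y s - 1)) with (snd (Y s)) by (simpl; ring). reflexivity. }
  rewrite E, Rabs_mult, Rabs_Ropp, (Rabs_right (_ * _)).
  2:{ apply Rle_ge.  nra. }
  pose proof (Cmod_ge_0 (/ (Y s - 1))) as H0. set (w := Cmod (/ (Y s - 1))) in *.
  assert (w * w <= 9 / 4)%R by nra.
  assert (Rabs (Im (Y s)) * (w * w) <= K * D s * (9 / 4))%R by (apply Rmult_le_compat; try apply Rabs_pos; nra).
  specialize (HDp s). nra.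
Qed.

(** The 1/s part of V' is -4 q c - 2 T q + 2 be. With c close to b its imaginary part is -(4 b + 2
    T) Q - 4 Re(q) C, which explains the relation 2 om = 4 b + 2 T; the assumed rate K / sqrt s for
    c - b makes the error integrable. *)
Lemma ray_reality (T al be om b S K : R) (Y V c : R -> C) :
  (1 <= S)%R -> (2 * om = 4 * b + 2 * T)%R ->
  (forall s, (S <= s)%R ->
     (Cmod (Y s) < 1 / 3)%R /\
     is_cderiv Y s (V s / RtoC s) /\
     is_cderiv V s (rhsV (RtoC T) (RtoC al) (RtoC be) (RtoC s) (Y s) (c s)) /\
     is_cderiv c s (rhsC (RtoC T) (RtoC s) (Y s) (c s)) /\
     (Cmod (RtoC s * Y s) <= K)%R /\ (Cmod (c s) <= K)%R /\
     (Cmod (c s - RtoC b) <= K / sqrt s)%R) ->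
  vanishes (fun s => Im (RtoC s * Y s)) -> vanishes (fun s => Im (V s)) -> vanishes (fun s => Im (c s)) ->
  exists S1, forall s, (S1 <= s)%R -> Im (Y s) = 0%R.
Proof.
  intros HS Hom H VQ VW VC.
  set (q := fun s => RtoC s * Y s).
  set (Q := fun s => Im (q s)). set (W := fun s => Im (V s)). set (C := fun s => Im (c s)).
  set (D := fun s => (Rabs (Q s) + Rabs (W s) + Rabs (C s))%R).
  assert (HD : forall s, (0 <= D s)%R).
  { intro s. unfold D. pose proof (Rabs_pos (Q s)). pose proof (Rabs_pos (W s)). pose proof (Rabs_pos (C s)). lra. }
  assert (HQD : forall s, (Rabs (Q s) <= D s)%R).
  { intro s. unfold D.  pose proof (Rabs_pos (W s)). pose proof (Rabs_pos (C s)). lra. }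
  assert (HCD : forall s, (Rabs (C s) <= D s)%R).
  { intro s. unfold D. pose proof (Rabs_pos (Q s)). pose proof (Rabs_pos (W s)).  lra. }
  assert (HK0 : (0 <= K)%R).
  { destruct (H S ltac:(lra)) as [_ [_ [_ [_ [Hq _]]]]]. eapply Rle_trans; [apply Cmod_ge_0|exact Hq]. }
  assert (Iq : im_controlled S D q).
  { exists (K + 1)%R. split; [lra|]. intros s Hs. destruct (H s Hs) as [_ [_ [_ [_ [Hq _]]]]].
    split; [unfold q; lra|]. fold (Q s). specialize (HQD s). specialize (HD s). nra. }
  assert (Ic : im_controlled S D c).
  { exists (K + 1)%R. split; [lra|]. intros s Hs. destruct (H s Hs) as [_ [_ [_ [_ [_ [Hc _]]]]]].
    split; [lra|]. fold (C s). specialize (HCD s). specialize (HD s). nra. }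
  assert (IY : im_controlled S D Y).
  { exists 1%R. split; [lra|]. intros s Hs. destruct (H s Hs) as [HY _]. split; [lra|].
    specialize (HQD s). unfold Q, q in HQD. rewrite im_scal_l, Rabs_mult, (Rabs_right s) in HQD by lra.
    pose proof (Rabs_pos (Im (Y s))). nra. }
  pose proof (fun r => im_controlled_const S D r HD) as Ik.
  assert (Ii : im_controlled S D (fun s => / (Y s - 1))).
  { apply im_controlled_inv_minus1; [exact HD|intros s Hs; apply H; exact Hs|exact IY]. }
  (* [B3] and [B2] are the coefficients of 1/s^2 in V' and c': every term of [remV] and [remC]
     containing a factor Y gives up one 1/s through Y = q/s. *)
  set (B3 := fun s => q s * (3 * q s * (c s + RtoC T) + 2 * RtoC al * (Y s - 1) * (2 * Y s - 1) - 2 * RtoC be)).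
  set (B2 := fun s => - (RtoC T * q s * / (Y s - 1)) + q s * q s * (2 - Y s) * (/ (Y s - 1) * / (Y s - 1))).
  assert (IB3 : im_controlled S D B3).
  { unfold B3.
    repeat first [exact Iq|exact Ic|exact IY|apply Ik|apply im_controlled_minus|apply im_controlled_plus|apply im_controlled_mult]. }
  assert (IB2 : im_controlled S D B2).
  { unfold B2.
    repeat first [exact Iq|exact Ic|exact IY|exact Ii|apply Ik|apply im_controlled_minus|apply im_controlled_opp|apply im_controlled_plus|apply im_controlled_mult]. }
  destruct IB3 as [K3 [HK3 HB3]]. destruct IB2 as [K2 [HK2 HB2]].
  set (KK := (1 + 4 * K + Rabs om + K3 + K2)%R).
  pose proof (Rabs_pos om) as Hom0.
  destruct (rigid_zero Q W C (fun s => Re (q s)) om KK S) as [S1 HS1].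
  - unfold KK. lra.
  - exact HS.
  - intros s Hs. destruct (H s Hs) as [_ [_ [_ [_ [Hq _]]]]]. pose proof (re_le_Cmod (q s)). unfold q in *. unfold KK. lra.
  - unfold KK. lra.
  - intros s Hs. destruct (H s Hs) as [_ [DY _]].
    pose proof (RtoC_pos_neq_0 s ltac:(lra)) as Hsn.
    assert (Dq : is_cderiv q s (V s + q s * RtoC (/ s))).
    { unfold q. eapply is_cderiv_eq; [|apply is_cderiv_mult; [apply is_cderiv_id|exact DY]].
      rewrite RtoC_inv by lra. field. exact Hsn. }
    destruct Dq as [_ Dq]. eapply is_derive_eq; [|exact Dq]. as_R.
    rewrite im_plus, im_scal_r. reflexivity.
  - intros s Hs. destruct (H s Hs) as [HY [_ [DV [_ [Hq [Hc Hcb]]]]]].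
    assert (Hsp : (0 < s)%R) by lra.
    pose proof (RtoC_pos_neq_0 s Hsp) as Hsn.
    pose proof (sqrt_ge_1 s ltac:(lra)) as Hq1. pose proof (sqrt_le_self s ltac:(lra)) as Hqs.
    destruct DV as [_ DV]. eexists. split; [exact DV|].
    replace (rhsV (RtoC T) (RtoC al) (RtoC be) (RtoC s) (Y s) (c s)) with
      (c s - q s + (- (RtoC 4 * (q s * c s)) - RtoC (2 * T) * q s + RtoC (2 * be) + B3 s * RtoC (/ s)) * RtoC (/ s)).
    2:{ rewrite rhsV_split by exact Hsp. unfold remV, B3, q. rewrite !RtoC_mult, RtoC_inv by lra. field. exact Hsn. }
    destruct (HB3 s Hs) as [_ HI].
    rewrite im_plus, im_scal_r, !im_plus, !Im_minus, im_opp, im_scal_r, !im_scal_l, im_mult, im_RtoC.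
    fold (Q s) (C s).
    (* The terms prescribed by [rigid_zero] cancel; what is left is small because c - b is O(1/sqrt
       s) and because [B3] carries a second 1/s. *)
    match goal with |- (Rabs ?x <= _)%R => replace x with ((- 4 * Q s * Re (c s - RtoC b) + Im (B3 s) * / s) * / s)%R end.
    2:{ rewrite Re_minus, re_RtoC. replace om with ((4 * b + 2 * T) / 2)%R by lra. unfold Rdiv. fold (Q s). ring_simplify. field. lra. }
    rewrite Rabs_mult, (Rabs_right (/ s)) by (apply Rle_ge, Rlt_le, Rinv_0_lt_compat; lra).
    replace (KK * (Rabs (Q s) + Rabs (W s) + Rabs (C s)) / (s * sqrt s))%R with (KK * D s / sqrt s * / s)%R by (unfold D; field; lra).
    apply Rmult_le_compat_r; [left; apply Rinv_0_lt_compat; lra|].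
    pose proof (re_le_Cmod (c s - RtoC b)) as Hre.
    eapply Rle_trans; [apply Rabs_triang|].
    assert (Z1 : (Rabs (-4 * Q s * Re (c s - RtoC b)) <= 4 * K * D s / sqrt s)%R).
    { rewrite !Rabs_mult. replace (Rabs (-4)) with 4%R by (rewrite Rabs_left; lra).
      replace (4 * K * D s / sqrt s)%R with (4 * D s * (K / sqrt s))%R by (field; lra).
      apply Rmult_le_compat; try lra; [|apply Rabs_pos|].
      - pose proof (Rabs_pos (Q s)). lra.
      - specialize (HQD s). lra. }
    assert (Z2 : (Rabs (Im (B3 s) * / s) <= K3 * D s / sqrt s)%R).
    { rewrite Rabs_mult, (Rabs_right (/ s)) by (apply Rle_ge, Rlt_le, Rinv_0_lt_compat; lra).
      apply Rmult_le_compat; [apply Rabs_pos|left; apply Rinv_0_lt_compat; lra|exact HI|].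
      apply Rinv_le_contravar; lra. }
    assert (Z3 : (4 * K * D s / sqrt s + K3 * D s / sqrt s <= KK * D s / sqrt s)%R); [|lra].
    replace (4 * K * D s / sqrt s + K3 * D s / sqrt s)%R with ((4 * K + K3) * D s / sqrt s)%R by (field; lra).
    apply Rmult_le_compat_r; [left; apply Rinv_0_lt_compat; lra|].
    apply Rmult_le_compat_r; [apply HD|]. unfold KK. lra.
  - intros s Hs. destruct (H s Hs) as [HY [_ [_ [DC _]]]].
    assert (Hsp : (0 < s)%R) by lra.
    pose proof (RtoC_pos_neq_0 s Hsp) as Hsn.
    destruct (Cmod_lt1_minus1_nz _ HY) as [Hnz _].
    destruct DC as [_ DC]. eexists. split; [exact DC|].
    replace (rhsC (RtoC T) (RtoC s) (Y s) (c s)) with ((q s - c s + B2 s * RtoC (/ s)) * RtoC (/ s)).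
    2:{ unfold rhsC, B2, q. rewrite RtoC_inv by lra. field. now split. }
    destruct (HB2 s Hs) as [_ HI].
    rewrite im_scal_r, im_plus, Im_minus, im_scal_r. fold (Q s) (C s).
    match goal with |- (Rabs ?x <= _)%R => replace x with (Im (B2 s) * / (s * s))%R end.
    2:{ fold (Q s). unfold Rdiv. field. lra. }
    assert (0 < / (s * s))%R by (apply Rinv_0_lt_compat; nra).
    rewrite Rabs_mult, (Rabs_right (/ (s * s))) by lra.
    apply Rmult_le_compat_r; [lra|]. eapply Rle_trans; [exact HI|].
    apply Rmult_le_compat_r; [apply HD|]. unfold KK. lra.
  - exact VQ.
  - exact VW.
  - exact VC.
  - exists (Rmax S1 1). intros s Hs. minmax.
    specialize (HS1 s ltac:(lra)).
    pose proof (HQD s) as HQ1. unfold D in HQ1. rewrite HS1 in HQ1.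
    unfold Q, q in HQ1. rewrite im_scal_l, Rabs_mult, (Rabs_right s) in HQ1 by lra.
    pose proof (Rabs_pos (Im (Y s))).
    assert (Rabs (Im (Y s)) = 0)%R by nra. now apply Rabs_eq_0.
Qed.

(** * The exponential carrier of the leading term *)

Definition cis (x : R) : C := RtoC (cos x) + Ci * RtoC (sin x).

Lemma Re_cis x : Re (cis x) = cos x.
Proof. unfold cis. simpl. ring. Qed.
Lemma Im_cis x : Im (cis x) = sin x.
Proof. unfold cis. simpl. ring. Qed.

Lemma Cmod_cis x : Cmod (cis x) = 1%R.
Proof.
  assert (H : (Cmod (cis x) ^ 2 = 1)%R).
  { rewrite Cmod2_alt, Re_cis, Im_cis. pose proof (sin2_cos2 x). unfold Rsqr in H. nra. }
  pose proof (Cmod_ge_0 (cis x)). nra.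
Qed.

Lemma cis_plus x y : cis (x + y) = cis x * cis y.
Proof.
  apply C_ext.
  - rewrite re_mult, !Re_cis, !Im_cis. apply cos_plus.
  - rewrite im_mult, !Re_cis, !Im_cis, sin_plus. ring.
Qed.

Lemma Cexp_cis (t : C) : Cexp t = RtoC (exp (Re t)) * cis (Im t).
Proof. reflexivity. Qed.

Lemma Cmod_Cexp t : Cmod (Cexp t) = exp (Re t).
Proof.
  rewrite Cexp_cis, Cmod_mult, Cmod_cis, Cmod_R, Rabs_right; [ring|]. left. apply exp_pos.
Qed.

Lemma Cexp_plus a b : Cexp (a + b) = Cexp a * Cexp b.
Proof. rewrite !Cexp_cis, re_plus, im_plus, exp_plus, cis_plus, RtoC_mult. ring. Qed.

Lemma Cexp_nz t : Cexp t <> 0.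
Proof. apply Cmod_gt_0. rewrite Cmod_Cexp. apply exp_pos. Qed.

Lemma cos_2atan x : cos (2 * atan x) = ((1 - x ^ 2) / (1 + x ^ 2))%R.
Proof.
  rewrite cos_2a, cos_atan, sin_atan.
  assert (Hs : (sqrt (1 + x²) * sqrt (1 + x²) = 1 + x ^ 2)%R).
  { rewrite sqrt_sqrt; unfold Rsqr; simpl; nra. }
  set (w := sqrt (1 + x²)) in *.
  assert (w <> 0)%R by (intro E; rewrite E in Hs; nra).
  rewrite <- Hs. field. assumption.
Qed.

Lemma sin_2atan x : sin (2 * atan x) = (2 * x / (1 + x ^ 2))%R.
Proof.
  rewrite sin_2a, cos_atan, sin_atan.
  assert (Hs : (sqrt (1 + x²) * sqrt (1 + x²) = 1 + x ^ 2)%R).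
  { rewrite sqrt_sqrt; unfold Rsqr; simpl; nra. }
  set (w := sqrt (1 + x²)) in *.
  assert (w <> 0)%R by (intro E; rewrite E in Hs; nra).
  rewrite <- Hs. field. assumption.
Qed.

Lemma Carg_polar (c : C) : c <> 0 -> c = RtoC (Cmod c) * cis (Carg c).
Proof.
  intro Hc. pose proof (proj1 (Cmod_gt_0 c) Hc) as Hm.
  pose proof (Cmod2_alt c) as H2. set (r := Cmod c) in *. set (x := Re c) in *. set (y := Im c) in *.
  assert (Hgen : (0 < r + x)%R -> c = RtoC r * cis (2 * atan (y / (r + x)))).
  { intro Hp. apply C_ext.
    - rewrite re_scal_l, Re_cis, cos_2atan. fold x.
      replace (1 + (y / (r + x)) ^ 2)%R with (2 * r / (r + x))%R.
      2:{ replace (1 + (y / (r + x)) ^ 2)%R with (((r + x) ^ 2 + y ^ 2) / (r + x) ^ 2)%R by (field; lra).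
          replace ((r + x) ^ 2 + y ^ 2)%R with (2 * r * (r + x))%R by nra. field. lra. }
      replace (1 - (y / (r + x)) ^ 2)%R with (2 * x / (r + x))%R.
      2:{ replace (1 - (y / (r + x)) ^ 2)%R with (((r + x) ^ 2 - y ^ 2) / (r + x) ^ 2)%R by (field; lra).
          replace ((r + x) ^ 2 - y ^ 2)%R with (2 * x * (r + x))%R by nra. field. lra. }
      field. lra.
    - rewrite im_scal_l, Im_cis, sin_2atan. fold y.
      replace (1 + (y / (r + x)) ^ 2)%R with (2 * r / (r + x))%R.
      2:{ replace (1 + (y / (r + x)) ^ 2)%R with (((r + x) ^ 2 + y ^ 2) / (r + x) ^ 2)%R by (field; lra).
          replace ((r + x) ^ 2 + y ^ 2)%R with (2 * r * (r + x))%R by nra. field. lra. }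
      field. lra. }
  unfold Carg. fold r x y. destruct (Rlt_dec x 0) as [Hx|Hx]; [destruct (Req_EM_T y 0) as [Hy|Hy]|].
  - rewrite Hy in H2. assert (r = - x)%R by nra.
    apply C_ext.
    + rewrite re_scal_l, Re_cis, cos_PI. fold x. lra.
    + rewrite im_scal_l, Im_cis, sin_PI. fold y. lra.
  - apply Hgen. assert (0 < y ^ 2)%R by nra. nra.
  - apply Hgen. lra.
Qed.

Lemma atan_lipschitz x y : (Rabs (atan x - atan y) <= Rabs (x - y))%R.
Proof.
  destruct (MVT_gen atan y x (fun t => / (1 + t ^ 2))%R) as [c [_ E]].
  - intros t _. apply is_derive_Reals. apply derivable_pt_lim_atan.
  - intros t _. apply derivable_continuous_pt, derivable_pt_atan.
  - rewrite E, Rabs_mult. assert (H : (0 < 1 + c ^ 2)%R) by nra.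
    rewrite (Rabs_right (/ (1 + c ^ 2))) by (apply Rle_ge, Rlt_le, Rinv_0_lt_compat, H).
    pose proof (Rabs_pos (x - y)).
    assert (/ (1 + c ^ 2) <= 1)%R by (rewrite <- Rinv_1; apply Rinv_le_contravar; nra). nra.
Qed.

Lemma ln_lipschitz x y a : (0 < a -> a <= x -> a <= y -> Rabs (ln x - ln y) <= Rabs (x - y) / a)%R.
Proof.
  intros Ha Hx Hy. destruct (MVT_gen ln y x (fun t => / t)%R) as [c [Hc E]].
  - intros t Ht. apply is_derive_Reals, derivable_pt_lim_ln.
    unfold Rmin in Ht. destruct (Rle_dec y x); lra.
  - intros t Ht. apply derivable_continuous_pt. exists (/ t)%R. apply derivable_pt_lim_ln.
    unfold Rmin in Ht. destruct (Rle_dec y x); lra.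
  - assert (a <= c)%R by (unfold Rmin in Hc; destruct (Rle_dec y x); lra).
    rewrite E, Rabs_mult, Rmult_comm. apply Rmult_le_compat_l; [apply Rabs_pos|].
    rewrite Rabs_right by (apply Rle_ge, Rlt_le, Rinv_0_lt_compat; lra).
    apply Rinv_le_contravar; lra.
Qed.

Lemma Cexp_near_0 eps : (0 < eps)%R -> exists del, (0 < del)%R /\
  forall h, (Cmod h < del)%R -> (Cmod (Cexp h - 1) < eps)%R.
Proof.
  intro He.
  assert (Hc : forall f : R -> R, continuous f 0 -> exists del, (0 < del)%R /\ forall x, (Rabs x < del)%R -> (Rabs (f x - f 0%R) < eps / 3)%R).
  { intros f Hf. destruct (proj1 (continuous_R_eps f 0) Hf (eps / 3)%R ltac:(lra)) as [d [Hd H]].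
    exists d. split; [exact Hd|]. intros x Hx. apply H. now rewrite Rminus_0_r. }
  destruct (Hc exp) as [d1 [Hd1 H1]]; [apply (is_derive_Rcontinuous exp 0 (exp 0)), is_derive_Reals, derivable_pt_lim_exp|].
  destruct (Hc cos) as [d2 [Hd2 H2]]; [apply (is_derive_Rcontinuous cos 0 (- sin 0)%R), is_derive_Reals, derivable_pt_lim_cos|].
  destruct (Hc sin) as [d3 [Hd3 H3]]; [apply (is_derive_Rcontinuous sin 0 (cos 0)), is_derive_Reals, derivable_pt_lim_sin|].
  exists (Rmin d1 (Rmin d2 d3)). split; [now repeat apply Rmin_pos|]. intros h Hh.
  minmax.
  pose proof (re_le_Cmod h). pose proof (im_le_Cmod h).
  specialize (H1 (Re h) ltac:(lra)). specialize (H2 (Im h) ltac:(lra)). specialize (H3 (Im h) ltac:(lra)).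
  rewrite exp_0 in H1. rewrite cos_0 in H2. rewrite sin_0, Rminus_0_r in H3.
  replace (Cexp h - 1) with (RtoC (exp (Re h) - 1) * cis (Im h) + (RtoC (cos (Im h) - 1) + Ci * RtoC (sin (Im h)))).
  2:{ rewrite Cexp_cis, !RtoC_minus. unfold cis. ring. }
  eapply Rle_lt_trans; [apply Cmod_triangle|]. rewrite Cmod_mult, Cmod_cis, Cmod_R, Rmult_1_r.
  pose proof (Cmod_triangle (RtoC (cos (Im h) - 1)) (Ci * RtoC (sin (Im h)))) as K.
  rewrite Cmod_mult, Cmod_Ci, !Cmod_R in K. lra.
Qed.

(** A Lipschitz estimate uniform in s: the argument moves by at most 24 r / s and the logarithm of
    the modulus by at most r. *)
Lemma Clog_near_ray (sigma s r : R) (t : C) : sigma = 1%R \/ sigma = (-1)%R ->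
  (0 < r <= 1 / 2)%R -> (4 <= s)%R -> (Cmod (Ci * RtoC sigma * RtoC s - t) < 2 * r)%R ->
  (Cmod (Clog t - Clog (Ci * RtoC sigma * RtoC s)) <= 26 * r)%R.
Proof.
  intros Hsg Hr Hs Ht. pose proof (Cmod_Ci_sign sigma Hsg) as Hv.
  set (v := Ci * RtoC sigma) in *.
  assert (Hvs : Cmod (v * RtoC s) = s) by (rewrite Cmod_mult, Hv, Cmod_R, Rabs_right; lra).
  assert (Hss : (Rabs sigma = 1)%R) by (destruct Hsg as [-> | ->]; unfold Rabs; destruct Rcase_abs; lra).
  assert (Hmod : (Rabs (Cmod t - s) <= 2 * r)%R).
  { rewrite <- Hvs. pose proof (Cmod_triangle (v * RtoC s - t) t) as K1.
    pose proof (Cmod_triangle (- (v * RtoC s - t)) (v * RtoC s)) as K2. rewrite Cmod_opp in K2.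
    replace (v * RtoC s - t + t) with (v * RtoC s) in K1 by ring.
    replace (- (v * RtoC s - t) + v * RtoC s) with t in K2 by ring.
    apply Rabs_le_between. lra. }
  assert (Hre : (Rabs (Re t) <= 2 * r)%R).
  { pose proof (re_le_Cmod (v * RtoC s - t)) as K. rewrite Re_minus in K.
    replace (Re (v * RtoC s)) with 0%R in K by (unfold v; simpl; ring).
    unfold Rminus in K. rewrite Rplus_0_l, Rabs_Ropp in K. lra. }
  assert (Him : (Rabs (Im t - sigma * s) <= 2 * r)%R).
  { pose proof (im_le_Cmod (v * RtoC s - t)) as K. rewrite Im_minus in K.
    replace (Im (v * RtoC s)) with (sigma * s)%R in K by (unfold v; simpl; ring).
    rewrite Rabs_minus_sym in K. lra. }
  assert (Hden : (s / 2 <= Cmod t + Re t)%R).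
  { apply Rabs_le_between in Hmod. apply Rabs_le_between in Hre. lra. }
  (* This keeps t off the real axis, hence away from the exceptional branch of [Carg]. *)
  assert (HimN : Im t <> 0%R).
  { intro E. rewrite E in Him. unfold Rminus in Him. rewrite Rplus_0_l, Rabs_Ropp, Rabs_mult, Hss, (Rabs_right s) in Him by lra. lra. }
  assert (Harg : (Rabs (Carg t - Carg (v * RtoC s)) <= 24 * r / s)%R).
  { unfold v at 1. rewrite Carg_imaginary_axis by (assumption || lra).
    assert (Ea : Carg t = (2 * atan (Im t / (Cmod t + Re t)))%R).
    { unfold Carg. destruct (Rlt_dec (Re t) 0); [|reflexivity]. destruct (Req_EM_T (Im t) 0); [contradiction|reflexivity]. }
    rewrite Ea.
    assert (Es : (sigma * PI / 2 = 2 * atan sigma)%R).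
    { destruct Hsg as [-> | ->]; [rewrite atan_1; field|].
      replace (atan (-1)) with (- atan 1)%R by (rewrite <- atan_opp; f_equal; ring). rewrite atan_1. field. }
    rewrite Es, <- Rmult_minus_distr_l, Rabs_mult, (Rabs_right 2) by lra.
    pose proof (atan_lipschitz (Im t / (Cmod t + Re t)) sigma) as K.
    replace (Im t / (Cmod t + Re t) - sigma)%R with
      (((Im t - sigma * s) + sigma * (s - Cmod t) + - (sigma * Re t)) / (Cmod t + Re t))%R in K by (field; lra).
    unfold Rdiv in K at 2. rewrite Rabs_mult in K.
    rewrite (Rabs_right (/ (Cmod t + Re t))) in K by (apply Rle_ge, Rlt_le, Rinv_0_lt_compat; lra).
    assert (N : (Rabs (Im t - sigma * s + sigma * (s - Cmod t) + - (sigma * Re t)) <= 6 * r)%R).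
    { eapply Rle_trans; [apply Rabs_triang|]. rewrite Rabs_Ropp, Rabs_mult, Hss.
      pose proof (Rabs_triang (Im t - sigma * s) (sigma * (s - Cmod t))) as K3.
      rewrite Rabs_mult, Hss, (Rabs_minus_sym s) in K3. lra. }
    assert (Hinv : (/ (Cmod t + Re t) <= 2 / s)%R).
    { replace (2 / s)%R with (/ (s / 2))%R by (field; lra). apply Rinv_le_contravar; lra. }
    assert (0 < / (Cmod t + Re t))%R by (apply Rinv_0_lt_compat; lra).
    assert (Rabs (Im t - sigma * s + sigma * (s - Cmod t) + - (sigma * Re t)) * / (Cmod t + Re t) <= 6 * r * (2 / s))%R.
    { apply Rmult_le_compat; try lra. apply Rabs_pos. }
    replace (24 * r / s)%R with (2 * (6 * r * (2 / s)))%R by (field; lra). lra. }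
  assert (Hln : (Rabs (ln (Cmod t) - ln s) <= r)%R).
  { apply Rabs_le_between in Hmod as Hm2. eapply Rle_trans; [apply (ln_lipschitz _ _ 3); lra|].
    apply div_le_of_le_mul; lra. }
  assert (24 * r / s <= 6 * r)%R by (apply div_le_of_le_mul; nra).
  unfold Clog. rewrite Hvs.
  replace (RtoC (ln (Cmod t)) + Ci * RtoC (Carg t) - (RtoC (ln s) + Ci * RtoC (Carg (v * RtoC s))))
    with (RtoC (ln (Cmod t) - ln s) + Ci * RtoC (Carg t - Carg (v * RtoC s))) by (rewrite !RtoC_minus; ring).
  eapply Rle_trans; [apply Cmod_triangle|]. rewrite Cmod_mult, Cmod_Ci, !Cmod_R. lra.
Qed.

(** * The carrier on the ray and the choice of sampling points *)

Definition carrier (delta nu t : C) : C := delta * Cpower t nu * Cexp t.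

Definition ray_phase (sigma om1 : R) (delta : C) (s : R) : R := (sigma * s + om1 * ln s + Carg delta)%R.
(** The exponential comes from the argument sigma PI / 2 in t^(i om1). The modulus relation of the
    theorem says that twice this number is A. *)
Definition ray_modulus (sigma om1 : R) (delta : C) : R := (Cmod delta * exp (- (sigma * PI * om1 / 2)))%R.

Lemma Clog_ray sigma s : sigma = 1%R \/ sigma = (-1)%R -> (0 < s)%R ->
  Clog (Ci * RtoC sigma * RtoC s) = RtoC (ln s) + Ci * RtoC (sigma * PI / 2).
Proof.
  intros Hsg Hs. unfold Clog. rewrite Carg_imaginary_axis by assumption.
  rewrite Cmod_mult, Cmod_Ci_sign, Cmod_R, Rabs_right by (assumption || lra). now rewrite Rmult_1_l.
Qed.

Lemma Cmod_Cpower_ray sigma s (mu : C) : sigma = 1%R \/ sigma = (-1)%R -> (0 < s)%R ->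
  Cmod (Cpower (Ci * RtoC sigma * RtoC s) mu) = exp (Re mu * ln s - Im mu * (sigma * PI / 2)).
Proof.
  intros Hsg Hs. unfold Cpower. rewrite Clog_ray by assumption. rewrite Cmod_Cexp. f_equal.
  rewrite re_mult. simpl. ring.
Qed.

Lemma carrier_ray sigma om1 (delta : C) s : sigma = 1%R \/ sigma = (-1)%R -> delta <> 0 -> (0 < s)%R ->
  carrier delta (Ci * RtoC om1) (Ci * RtoC sigma * RtoC s)
  = RtoC (ray_modulus sigma om1 delta) * cis (ray_phase sigma om1 delta s).
Proof.
  intros Hsg Hd Hs. unfold carrier, Cpower. rewrite Clog_ray by assumption.
  rewrite !Cexp_cis.
  replace (Re (Ci * RtoC om1 * (RtoC (ln s) + Ci * RtoC (sigma * PI / 2)))) with (- (sigma * PI * om1 / 2))%R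
    by (rewrite re_mult; simpl; field).
  replace (Im (Ci * RtoC om1 * (RtoC (ln s) + Ci * RtoC (sigma * PI / 2)))) with (om1 * ln s)%R
    by (rewrite im_mult; simpl; field).
  replace (Re (Ci * RtoC sigma * RtoC s)) with 0%R by (simpl; ring).
  replace (Im (Ci * RtoC sigma * RtoC s)) with (sigma * s)%R by (simpl; ring).
  rewrite exp_0. rewrite (Carg_polar delta Hd) at 1.
  unfold ray_modulus, ray_phase. rewrite RtoC_mult.
  replace (sigma * s + om1 * ln s + Carg delta)%R with (Carg delta + (om1 * ln s + sigma * s))%R by ring.
  rewrite !cis_plus. ring.
Qed.

Lemma is_cderiv_cis (f : R -> R) s d : is_derive f s d -> is_cderiv (fun x => cis (f x)) s (Ci * RtoC d * cis (f s)).
Proof.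
  intro H. split.
  - apply (is_derive_ext (fun x => cos (f x))); [intro x; symmetry; apply Re_cis|].
    eapply is_derive_eq; [|apply (is_derive_comp cos f s _ _ (proj2 (is_derive_Reals _ _ _) (derivable_pt_lim_cos (f s))) H)].
    as_R. change (scal d (- sin (f s))%R) with (d * - sin (f s))%R. unfold cis. simpl. ring.
  - apply (is_derive_ext (fun x => sin (f x))); [intro x; symmetry; apply Im_cis|].
    eapply is_derive_eq; [|apply (is_derive_comp sin f s _ _ (proj2 (is_derive_Reals _ _ _) (derivable_pt_lim_sin (f s))) H)].
    as_R. change (scal d (cos (f s))%R) with (d * cos (f s))%R. unfold cis. simpl. ring.
Qed.

Lemma carrier_ray_deriv sigma om1 (delta : C) s : sigma = 1%R \/ sigma = (-1)%R -> (0 < s)%R ->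
  let E := fun s : R => RtoC (ray_modulus sigma om1 delta) * cis (ray_phase sigma om1 delta s) in
  is_cderiv E s (Ci * RtoC sigma * RtoC (1 + sigma * om1 / s) * E s).
Proof.
  intros Hsg Hs E.
  assert (Hp : is_derive (ray_phase sigma om1 delta) s (sigma + om1 / s)%R).
  { unfold ray_phase. auto_derive; [exact Hs|]. field. lra. }
  eapply is_cderiv_eq; [|unfold E; apply is_cderiv_mult; [apply is_cderiv_const|apply (is_cderiv_cis _ _ _ Hp)]].
  unfold E. cbv beta.
  replace (RtoC (sigma + om1 / s)) with (RtoC sigma * RtoC (1 + sigma * om1 / s)); [ring|].
  rewrite <- RtoC_mult. f_equal. destruct Hsg as [-> | ->]; field; lra.
Qed.

Lemma ray_modulus_pos sigma om1 (delta : C) : delta <> 0 -> (0 < ray_modulus sigma om1 delta)%R.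
Proof. intro H. apply Rmult_lt_0_compat; [now apply Cmod_gt_0|apply exp_pos]. Qed.

Lemma cis_period x n : cis (x + 2 * INR n * PI) = cis x.
Proof. unfold cis. now rewrite cos_period, sin_period. Qed.

Lemma cis_opp x : cis (- x) = Cconj (cis x).
Proof. apply C_ext; rewrite ?re_conj, ?im_conj, ?Re_cis, ?Im_cis; [apply cos_neg|apply sin_neg]. Qed.

Lemma cis_sign_period sigma x n : sigma = 1%R \/ sigma = (-1)%R ->
  cis (sigma * (x + 2 * INR n * PI)) = cis (sigma * x).
Proof.
  intros [-> | ->].
  - rewrite !Rmult_1_l. apply cis_period.
  - replace (-1 * (x + 2 * INR n * PI))%R with (- (x + 2 * INR n * PI))%R by ring.
    replace (-1 * x)%R with (- x)%R by ring. now rewrite !cis_opp, cis_period.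
Qed.

(** The phase has slope at least 1/2 far out, so over a window of length 19 it gains 19/2, more than
    2 PI even with the crude bound PI <= 4; it therefore takes the value psi modulo 2 PI. Ending the
    window at s - 1 leaves room to move the point slightly. *)
Lemma phase_sampling sigma om1 (delta : C) psi : sigma = 1%R \/ sigma = (-1)%R ->
  exists X, (22 <= X)%R /\ forall s, (X <= s)%R -> exists a, (s - 20 <= a <= s - 1)%R /\
    cis (ray_phase sigma om1 delta a) = cis (sigma * psi).
Proof.
  intro Hsg.
  set (om := (sigma * om1)%R). set (k0 := (sigma * Carg delta)%R).
  set (Psi := fun x => (x + om * ln x + k0)%R).
  assert (Hss : (sigma * sigma = 1)%R) by (destruct Hsg as [-> | ->]; ring).
  assert (Hph : forall x, ray_phase sigma om1 delta x = (sigma * Psi x)%R).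
  { intro x. unfold ray_phase, Psi, om, k0.
    replace (sigma * (x + sigma * om1 * ln x + sigma * Carg delta))%R
      with (sigma * x + sigma * sigma * om1 * ln x + sigma * sigma * Carg delta)%R by ring.
    rewrite Hss. ring. }
  set (X := (22 + 4 * Rabs om + 2 * Rabs k0 + 2 * Rabs psi)%R).
  pose proof (Rabs_pos om) as Ho.  pose proof (Rabs_pos psi) as Hp.
  assert (Hder : forall x : R, (1 <= x)%R -> is_derive Psi x (1 + om / x)%R).
  { intros x Hx. unfold Psi. auto_derive; [lra|]. field. lra. }
  assert (Hder2 : forall x, (2 * Rabs om <= x)%R -> (1 <= x)%R -> (1 / 2 <= 1 + om / x)%R).
  { intros x Hx Hx1. assert (Rabs (om / x) <= 1 / 2)%R.
    { unfold Rdiv at 1. rewrite Rabs_mult, (Rabs_right (/ x)) by (apply Rle_ge, Rlt_le, Rinv_0_lt_compat; lra).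
      apply (div_le_of_le_mul (Rabs om) (1/2) x); lra. }
    pose proof (Rle_abs (- (om / x))). rewrite Rabs_Ropp in H0. lra. }
  set (x0 := (1 + 2 * Rabs om)%R).
  assert (Hinc : forall x y, (x0 <= x)%R -> (x <= y)%R -> ((y - x) / 2 <= Psi y - Psi x)%R).
  { intros x y Hx Hxy. destruct (MVT_bound Psi (fun x => 1 + om / x)%R x y Hxy) as [c [Hc E]].
    - intros z Hz. apply Hder. unfold x0 in Hx. lra.
    - rewrite E. specialize (Hder2 c). unfold x0 in Hx. specialize (Hder2 ltac:(lra) ltac:(lra)). nra. }
  exists (Rmax 22 (x0 + 22 + 2 * Rabs (Psi x0) + 2 * Rabs psi))%R. split; [apply Rmax_l|].
  intros s Hs. pose proof (Rmax_r 22 (x0 + 22 + 2 * Rabs (Psi x0) + 2 * Rabs psi)).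
  set (lo := (s - 20)%R). set (hi := (s - 1)%R).
  assert (Elo : lo = (s - 20)%R) by reflexivity. assert (Ehi : hi = (s - 1)%R) by reflexivity.
  pose proof (Rabs_pos (Psi x0)).
  assert (Hlo : (psi <= Psi lo)%R).
  { pose proof (Hinc x0 lo ltac:(lra) ltac:(unfold lo; lra)) as K.
    pose proof (Rle_abs psi). pose proof (Rle_abs (- Psi x0)). rewrite Rabs_Ropp in *. lra. }
  assert (Hgap : (19 / 2 <= Psi hi - Psi lo)%R).
  { pose proof (Hinc lo hi ltac:(unfold lo; lra) ltac:(unfold lo, hi; lra)) as K. lra. }
  pose proof PI_RGT_0 as HPI. pose proof PI_4 as HPI4.
  destruct (nfloor_ex ((Psi lo - psi) / (2 * PI))) as [n [Hn1 Hn2]].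
  { apply Rdiv_le_0_compat; lra. }
  assert (Hn3 : (INR n * (2 * PI) <= Psi lo - psi)%R).
  { apply Rmult_le_compat_r with (r := (2 * PI)%R) in Hn1; [|lra].
    replace ((Psi lo - psi) / (2 * PI) * (2 * PI))%R with (Psi lo - psi)%R in Hn1 by (field; lra). exact Hn1. }
  assert (Hn4 : (Psi lo - psi < (INR n + 1) * (2 * PI))%R).
  { apply Rmult_lt_compat_r with (r := (2 * PI)%R) in Hn2; [|lra].
    replace ((Psi lo - psi) / (2 * PI) * (2 * PI))%R with (Psi lo - psi)%R in Hn2 by (field; lra). exact Hn2. }
  set (target := (psi + 2 * INR (S n) * PI)%R).
  destruct (IVT_interv (fun x => Psi x - target)%R lo hi) as [a [Ha Ea]].
  - intros x Hx. apply continuity_pt_filterlim.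
    apply (is_derive_Rcontinuous (fun x => Psi x - target)%R x (1 + om / x - 0)%R).
    apply is_derive_Rminus; [|apply (is_derive_const (V := R_NormedModule))]. apply Hder. assert (1 <= x0)%R by (unfold x0; lra). lra.
  - lra.
  - unfold target. rewrite S_INR. nra.
  - unfold target. rewrite S_INR. nra.
  - exists a. split; [exact Ha|]. rewrite Hph. replace (Psi a) with target by lra.
    unfold target. now apply cis_sign_period.
Qed.

(** Two values cannot exhaust three distinct points of the circle, at angles 0, PI and PI/2. *)
Lemma circle_point_avoiding (sigma rho : R) (ka kb : C) : sigma = 1%R \/ sigma = (-1)%R -> (0 < rho)%R ->
  exists psi, RtoC rho * cis (sigma * psi) <> ka /\ RtoC rho * cis (sigma * psi) <> kb.
Proof.
  intros Hsg Hrho.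
  assert (P1 : RtoC rho * cis (sigma * 0) = RtoC rho).
  { rewrite Rmult_0_r. unfold cis. rewrite cos_0, sin_0. ring. }
  assert (P2 : RtoC rho * cis (sigma * PI) = - RtoC rho).
  { apply C_ext; rewrite ?re_scal_l, ?im_scal_l, ?Re_cis, ?Im_cis; destruct Hsg as [-> | ->];
      rewrite ?Rmult_1_l; replace (-1 * PI)%R with (- PI)%R by ring; rewrite ?cos_neg, ?sin_neg, ?cos_PI, ?sin_PI; simpl; ring. }
  assert (P3 : Re (RtoC rho * cis (sigma * (PI / 2))) = 0%R).
  { rewrite re_scal_l, Re_cis. destruct Hsg as [-> | ->]; rewrite ?Rmult_1_l;
      replace (-1 * (PI / 2))%R with (- (PI / 2))%R by ring; rewrite ?cos_neg, cos_PI2; ring. }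
  assert (N12 : RtoC rho <> - RtoC rho).
  { intro E. apply (f_equal Re) in E. simpl in E. lra. }
  assert (N13 : RtoC rho * cis (sigma * (PI / 2)) <> RtoC rho).
  { intro E. rewrite E in P3. simpl in P3. lra. }
  assert (N23 : RtoC rho * cis (sigma * (PI / 2)) <> - RtoC rho).
  { intro E. rewrite E in P3. simpl in P3. lra. }
  apply NNPP. intro Hno.
  assert (K : forall psi, RtoC rho * cis (sigma * psi) = ka \/ RtoC rho * cis (sigma * psi) = kb).
  { intro psi. apply NNPP. intro Hn. apply Hno. exists psi. tauto. }
  pose proof (K 0%R) as K1. pose proof (K PI) as K2. pose proof (K (PI / 2)%R) as K3.
  rewrite P1 in K1. rewrite P2 in K2.
  destruct K1 as [K1|K1], K2 as [K2|K2], K3 as [K3|K3]; try congruence.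
Qed.

(** The ratio of the carrier at two nearby points is e^h with h small uniformly in s. Where the
    carrier equals e on the ray, points taking a value at distance 2 eta from e thus stay a fixed
    distance away, however large s is. *)
Lemma carrier_exclusion sigma om1 (delta e : C) (eta : R) :
  sigma = 1%R \/ sigma = (-1)%R -> (0 < eta)%R ->
  exists r, (0 < r <= 1 / 2)%R /\ forall s, (4 <= s)%R ->
    carrier delta (Ci * RtoC om1) (Ci * RtoC sigma * RtoC s) = e ->
    forall kappa t, (2 * eta <= Cmod (e - kappa))%R -> carrier delta (Ci * RtoC om1) t = kappa ->
      (2 * r <= Cmod (Ci * RtoC sigma * RtoC s - t))%R.
Proof.
  intros Hsg Heta. pose proof (Cmod_ge_0 e) as He. pose proof (Rabs_pos om1) as Ho.
  destruct (Cexp_near_0 (2 * eta / (Cmod e + 1))) as [ze [Hze H]]; [apply Rdiv_lt_0_compat; lra|].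
  (* In h below the logarithms contribute at most 26 r |om1| and t - v s less than 2 r. *)
  set (r := Rmin (1 / 2) (ze / (26 * Rabs om1 + 4))).
  assert (Hr0 : (0 < ze / (26 * Rabs om1 + 4))%R) by (apply Rdiv_lt_0_compat; lra).
  assert (Hr : (0 < r <= 1 / 2)%R) by (split; [apply Rmin_pos; lra|apply Rmin_l]).
  assert (Hrz : (r * (26 * Rabs om1 + 4) <= ze)%R).
  { apply Rle_trans with (ze / (26 * Rabs om1 + 4) * (26 * Rabs om1 + 4))%R.
    - apply Rmult_le_compat_r; [lra|apply Rmin_r].
    - right. field. lra. }
  exists r. split; [exact Hr|]. intros s Hs Es kappa t Hk Et.
  apply Rnot_lt_le. intro Hlt.
  pose proof (Clog_near_ray sigma s r t Hsg Hr Hs Hlt) as HL.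
  set (v := Ci * RtoC sigma) in *.
  set (h := Ci * RtoC om1 * (Clog t - Clog (v * RtoC s)) + (t - v * RtoC s)).
  assert (Hh : (Cmod h < ze)%R).
  { eapply Rle_lt_trans; [apply Cmod_triangle|]. rewrite !Cmod_mult, Cmod_Ci, Cmod_R.
    replace (t - v * RtoC s) with (- (v * RtoC s - t)) by ring. rewrite Cmod_opp. nra. }
  specialize (H h Hh).
  assert (Ek : kappa = e * Cexp h).
  { rewrite <- Et, <- Es. unfold carrier, Cpower. rewrite <- !Cmult_assoc. f_equal.
    rewrite <- !Cexp_plus. f_equal. unfold h. ring. }
  rewrite Ek in Hk. replace (e - e * Cexp h) with (- (e * (Cexp h - 1))) in Hk by ring.
  rewrite Cmod_opp, Cmod_mult in Hk.
  apply mul_lt_of_lt_div in H; [|lra].  nra.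
Qed.

Lemma R1_zero_carrier (Too phi delta t theta : C) (om1 : R) :
  nu1 Too phi = Ci * RtoC om1 -> delta <> 0 ->
  R1 Too phi delta t theta = 0 -> carrier delta (Ci * RtoC om1) t = phi - theta.
Proof.
  intros Hnu Hd H. unfold R1 in H. rewrite Hnu in H. fold (carrier delta (Ci * RtoC om1) t) in H.
  assert (Hc : carrier delta (Ci * RtoC om1) t <> 0).
  { unfold carrier, Cpower. apply Cmult_neq_0; [apply Cmult_neq_0; [exact Hd|apply Cexp_nz]|apply Cexp_nz]. }
  set (E := carrier delta (Ci * RtoC om1) t) in *.
  replace (phi - theta) with ((1 - (1 - (phi - theta) / E)) * E) by (field; exact Hc).
  rewrite H. ring.
Qed.

(** With epsilon = 1 the excluded discs have the constant radius r. A sample keeps distance 2 r from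
    all zeros of R1, so points within r of it still lie in the domain. *)
Lemma D1_near_sample (sigma om1 : R) (T0 T1 Too phi delta e : C) (eta : R) :
  sigma = 1%R \/ sigma = (-1)%R -> delta <> 0 -> nu1 Too phi = Ci * RtoC om1 -> (0 < eta)%R ->
  (2 * eta <= Cmod (e - (phi - T0 / 2)))%R -> (2 * eta <= Cmod (e - (phi - (T1 + Too) / 2)))%R ->
  exists r, (0 < r <= 1 / 2)%R /\ forall s a, (4 <= s)%R -> (4 <= a)%R ->
    carrier delta (Ci * RtoC om1) (Ci * RtoC sigma * RtoC s) = e -> (Rabs (a - s) <= r)%R ->
    D1 T0 T1 Too phi delta 1 r 1 (Ci * RtoC sigma * RtoC a).
Proof.
  intros Hsg Hd Hnu Heta Ha Hb.
  destruct (carrier_exclusion sigma om1 delta e eta Hsg Heta) as [r [Hr H]].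
  exists r. split; [exact Hr|]. intros s a Hs4 Ha4 Es Has.
  pose proof (Cmod_Ci_sign sigma Hsg) as Hv.
  split; [|split].
  - replace (Re (Ci * RtoC sigma * RtoC a)) with 0%R by (simpl; ring). rewrite Rabs_R0. lra.
  - apply imaginary_axis_slit; [exact Hsg|lra].
  - intros t _ _ Hz. replace (1 - 1)%R with 0%R by ring. rewrite Rpower_O.
    2:{ rewrite Cmod_mult, Hv, Cmod_R, Rabs_right by lra. lra. }
    assert (K : (2 * r <= Cmod (Ci * RtoC sigma * RtoC s - t))%R).
    { destruct Hz as [Hz|Hz]; apply (R1_zero_carrier _ _ _ _ _ om1) in Hz; try assumption;
        eapply (H s Hs4 Es); [exact Ha|exact Hz|exact Hb|exact Hz]. }
    pose proof (Cmod_triangle (Ci * RtoC sigma * RtoC s - Ci * RtoC sigma * RtoC a) (Ci * RtoC sigma * RtoC a - t)) as K2.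
    rewrite Cmod_line in K2 by exact Hv.
    replace (Ci * RtoC sigma * RtoC s - Ci * RtoC sigma * RtoC a + (Ci * RtoC sigma * RtoC a - t))
      with (Ci * RtoC sigma * RtoC s - t) in K2 by ring.
    rewrite Rabs_minus_sym in Has. lra.
Qed.

(** * The data at points away from the zeros of R1 *)

Lemma ln_ge_1 s : (3 <= s)%R -> (1 <= ln s)%R.
Proof.
  intro Hs. rewrite <- (ln_exp 1). pose proof exp_le_3. pose proof (exp_pos 1).
  destruct (Req_dec (exp 1) s) as [->|Hne]; [lra|]. left. apply ln_increasing; lra.
Qed.

Lemma ln_le_2sqrt s : (1 <= s)%R -> (ln s <= 2 * sqrt s)%R.
Proof.
  intro Hs. assert (H : (0 < sqrt s)%R) by (apply sqrt_lt_R0; lra).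
  rewrite <- (sqrt_sqrt s) at 1 by lra. rewrite ln_mult by assumption.
  pose proof (exp_ineq1_le (ln (sqrt s))) as K. rewrite exp_ln in K by exact H. lra.
Qed.

Lemma lnx_x_le_sqrt s : (1 <= s)%R -> (ln s / s <= 2 / sqrt s)%R.
Proof.
  intro Hs. assert (H : (0 < sqrt s)%R) by (apply sqrt_lt_R0; lra).
  pose proof (ln_le_2sqrt s Hs). replace (2 / sqrt s)%R with (2 * sqrt s / s)%R.
  - apply Rmult_le_compat_r; [left; apply Rinv_0_lt_compat; lra|assumption].
  - rewrite <- (sqrt_sqrt s) at 2 by lra. field. lra.
Qed.

Lemma lnx_x_small eps : (0 < eps)%R -> exists X, (3 <= X)%R /\ forall s, (X <= s)%R -> (ln s / s < eps)%R.
Proof.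
  intro He. exists (Rmax 3 ((3 / eps) * (3 / eps)))%R. split; [apply Rmax_l|]. intros s Hs.
  minmax.
  assert (H3 : (0 < 3 / eps)%R) by (apply Rdiv_lt_0_compat; lra).
  assert (Hq : (3 / eps <= sqrt s)%R).
  { rewrite <- (sqrt_square (3 / eps)) by lra. apply sqrt_le_1_alt. lra. }
  eapply Rle_lt_trans; [apply lnx_x_le_sqrt; lra|].
  apply Rlt_div_l; [lra|]. assert (eps * (3 / eps) = 3)%R by (field; lra). nra.
Qed.

Lemma lnx_x_nonneg s : (3 <= s)%R -> (/ s <= ln s / s)%R /\ (0 < ln s / s)%R.
Proof.
  intro Hs. pose proof (ln_ge_1 s Hs). assert (0 < / s)%R by (apply Rinv_0_lt_compat; lra).
  unfold Rdiv. split; nra.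
Qed.

(** Agreement up to O(ln s / s) on P, with boundedness built in so that the relation is stable under
    products, and under inverses where both sides are bounded below. *)
Definition appr (P : R -> Prop) (f g : R -> C) : Prop :=
  exists K : R, (0 <= K)%R /\ forall s, P s ->
    (Cmod (f s) <= K)%R /\ (Cmod (g s) <= K)%R /\ (Cmod (f s - g s) <= K * (ln s / s))%R.

Section Appr.
Variable P : R -> Prop.
Hypothesis HP : forall s, P s -> (3 <= s)%R.

Lemma appr_const (c : C) : appr P (fun _ => c) (fun _ => c).
Proof.
  exists (Cmod c). split; [apply Cmod_ge_0|]. intros s Hs. split; [lra|split; [lra|]].
  replace (c - c) with (RtoC 0) by ring. rewrite Cmod_0.
  destruct (lnx_x_nonneg s (HP s Hs)). apply Rmult_le_pos; [apply Cmod_ge_0|lra].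
Qed.

Lemma appr_plus f1 g1 f2 g2 : appr P f1 g1 -> appr P f2 g2 -> appr P (fun s => f1 s + f2 s) (fun s => g1 s + g2 s).
Proof.
  intros [K1 [HK1 H1]] [K2 [HK2 H2]]. exists (K1 + K2)%R. split; [lra|]. intros s Hs.
  destruct (H1 s Hs) as [A1 [B1 C1]]. destruct (H2 s Hs) as [A2 [B2 C2]].
  split; [now apply Cmod_plus_le|split; [now apply Cmod_plus_le|]].
  replace (f1 s + f2 s - (g1 s + g2 s)) with ((f1 s - g1 s) + (f2 s - g2 s)) by ring.
  rewrite Rmult_plus_distr_r. now apply Cmod_plus_le.
Qed.

Lemma appr_opp f g : appr P f g -> appr P (fun s => - f s) (fun s => - g s).
Proof.
  intros [K1 [HK1 H1]]. exists K1. split; [lra|]. intros s Hs. destruct (H1 s Hs) as [A1 [B1 C1]].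
  split; [now apply Cmod_opp_le|split; [now apply Cmod_opp_le|]].
  replace (- f s - - g s) with (- (f s - g s)) by ring. now apply Cmod_opp_le.
Qed.

Lemma appr_minus f1 g1 f2 g2 : appr P f1 g1 -> appr P f2 g2 -> appr P (fun s => f1 s - f2 s) (fun s => g1 s - g2 s).
Proof. intros H1 H2. apply appr_plus; [exact H1|now apply appr_opp]. Qed.

Lemma appr_mult f1 g1 f2 g2 : appr P f1 g1 -> appr P f2 g2 -> appr P (fun s => f1 s * f2 s) (fun s => g1 s * g2 s).
Proof.
  intros [K1 [HK1 H1]] [K2 [HK2 H2]]. exists (2 * (K1 * K2))%R. split; [nra|]. intros s Hs.
  destruct (H1 s Hs) as [A1 [B1 C1]]. destruct (H2 s Hs) as [A2 [B2 C2]].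
  pose proof (Cmod_mult_le _ _ _ _ A1 A2). pose proof (Cmod_mult_le _ _ _ _ B1 B2).
  assert (0 <= K1 * K2)%R by nra.
  split; [lra|split; [lra|]].
  replace (f1 s * f2 s - g1 s * g2 s) with ((f1 s - g1 s) * f2 s + g1 s * (f2 s - g2 s)) by ring.
  eapply Rle_trans; [apply Cmod_plus_le; apply Cmod_mult_le; eassumption|]. right. ring.
Qed.

Lemma appr_inv (f g : R -> C) eta : (0 < eta)%R -> (forall s, P s -> (eta <= Cmod (f s))%R /\ (eta <= Cmod (g s))%R) ->
  appr P f g -> appr P (fun s => / f s) (fun s => / g s).
Proof.
  intros He Hl [K1 [HK1 H1]].
  assert (Hie : (0 < / eta)%R) by now apply Rinv_0_lt_compat.
  exists (/ eta + K1 * (/ eta * / eta))%R.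
  split; [apply Rplus_le_le_0_compat; [lra|repeat apply Rmult_le_pos; lra]|]. intros s Hs.
  destruct (H1 s Hs) as [A1 [B1 C1]]. destruct (Hl s Hs) as [L1 L2].
  assert (N1 : f s <> 0) by (apply Cmod_gt_0; lra). assert (N2 : g s <> 0) by (apply Cmod_gt_0; lra).
  assert (I1 : (Cmod (/ f s) <= / eta)%R) by (rewrite Cmod_inv by exact N1; apply Rinv_le_contravar; lra).
  assert (I2 : (Cmod (/ g s) <= / eta)%R) by (rewrite Cmod_inv by exact N2; apply Rinv_le_contravar; lra).
  assert (0 <= K1 * (/ eta * / eta))%R by (repeat apply Rmult_le_pos; lra).
  split; [lra|split; [lra|]].
  replace (/ f s - / g s) with ((- (f s - g s)) * (/ f s * / g s)) by (field; now split).
  destruct (lnx_x_nonneg s (HP s Hs)) as [_ Hln].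
  eapply Rle_trans; [apply Cmod_mult_le; [apply Cmod_opp_le, C1|apply Cmod_mult_le; eassumption]|].
  nra.
Qed.

Lemma appr_ext f g f' g' : (forall s, P s -> f s = f' s) -> (forall s, P s -> g s = g' s) -> appr P f g -> appr P f' g'.
Proof.
  intros E1 E2 [K [HK H]]. exists K. split; [exact HK|]. intros s Hs. rewrite <- E1, <- E2 by exact Hs. now apply H.
Qed.

Variables (T0 a d v T b ka kb : C) (E Y Z : R -> C) (eta rho : R).
Hypothesis Hvv : v * v = - (1).
Hypothesis Hv : Cmod v = 1%R.
Hypothesis Hd : d = kb - ka.
Hypothesis Hb : v * b = - (ka + kb).
Hypothesis Heta : (0 < eta)%R.
Hypothesis Hrho : (0 < rho)%R.
Hypothesis HE : forall s, P s -> Cmod (E s) = rho.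

Let m : C := ka * kb.
Let ql (s : R) : C := b + (E s + m / E s) / v.
Let vl (s : R) : C := E s - m / E s.
Let zl (s : R) : C := - T0 - ka * (1 - kb / E s).
Let q (s : R) : C := RtoC s * Y s.

Hypothesis HY : forall s, P s -> (Cmod (Y s) < 1 / 3)%R.
Hypothesis Hq : appr P q ql.
Hypothesis Hz : appr P Z zl.
Hypothesis Hlow : forall s, P s -> (eta <= Cmod (q s))%R /\ (eta <= Cmod (ql s))%R.

Lemma appr_Y_0 : appr P Y (fun _ => 0).
Proof.
  destruct Hq as [K [HK H]]. exists (K + 1)%R. split; [lra|]. intros s Hs. pose proof (HP s Hs).
  destruct (H s Hs) as [A _]. specialize (HY s Hs). rewrite Cmod_0.
  split; [lra|split; [lra|]]. replace (Y s - 0) with (Y s) by ring.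
  unfold q in A. rewrite Cmod_mult, Cmod_R, Rabs_right in A by lra.
  destruct (lnx_x_nonneg s ltac:(lra)) as [L1 L2].
  apply Rle_trans with (K * / s)%R.
  - apply (le_div_of_mul_le (Cmod (Y s)) K s); [lra|]. lra.
  - nra.
Qed.

Lemma lead_E_neq_0 s : P s -> E s <> 0.
Proof. intro Hs. apply Cmod_gt_0. rewrite HE; assumption. Qed.

Lemma lead_v_neq_0 : v <> 0.
Proof. apply Cmod_gt_0. rewrite Hv. lra. Qed.

(** To leading order one puts Y = 0, s Y = ql and Z = zl in [isoA]; the relations for d and v b turn
    the result into E - m/E. *)
Lemma data_speed : appr P (fun s => isoA T0 a d v s (Y s) (Z s)) vl.
Proof.
  apply (appr_ext (fun s => v * q s - 2 * Z s * ((Y s - 1) * (Y s - 1)) - (Y s - 1) * (a * Y s - (2 * T0 - d)))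
    (fun s => v * ql s - 2 * zl s * ((0 - 1) * (0 - 1)) - (0 - 1) * (a * 0 - (2 * T0 - d)))).
  - intros s Hs. unfold isoA, q. ring.
  - intros s Hs. pose proof (lead_E_neq_0 s Hs) as HEn. pose proof lead_v_neq_0.
    unfold ql, zl, vl. rewrite Hd. replace (v * (b + (E s + m / E s) / v)) with (v * b + (E s + m / E s)) by (field; now split).
    rewrite Hb. unfold m. field. exact HEn.
  - pose proof appr_Y_0 as HY0. pose proof appr_const as Hc.
    repeat first [exact HY0|exact Hq|exact Hz|apply Hc|apply appr_minus|apply appr_mult].
Qed.

Lemma data_invariant : appr P (fun s => isoInvariant T0 a d v T s (Y s) (Z s)) (fun _ => b).
Proof.
  set (Q := fun s => 2 * Z s * (Y s - 1) + a * Y s - (2 * T0 - d)).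
  set (Q0 := fun s => 2 * zl s * (0 - 1) + a * 0 - (2 * T0 - d)).
  apply (appr_ext (fun s => - (v * (Q s - v * T) * / (Y s - 1)) + (Q s * Q s - a * a * Y s * Y s - d * d) * / (2 * q s) - T)
    (fun s => - (v * (Q0 s - v * T) * / (0 - 1)) + (Q0 s * Q0 s - a * a * 0 * 0 - d * d) * / (2 * ql s) - T)).
  - intros s Hs. pose proof (RtoC_pos_neq_0 s ltac:(pose proof (HP s Hs); lra)) as Hsn.
    destruct (Cmod_lt1_minus1_nz _ (HY s Hs)) as [HY1 _].
    assert (HYn : Y s <> 0).
    { intro E0. destruct (Hlow s Hs) as [L _]. unfold q in L. rewrite E0, Cmult_0_r, Cmod_0 in L. lra. }
    unfold isoInvariant, q. fold (Q s). field. now repeat split.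
  - intros s Hs. pose proof (lead_E_neq_0 s Hs) as HEn. pose proof lead_v_neq_0 as Hvn.
    assert (Hqn : ql s <> 0) by (apply Cmod_gt_0; destruct (Hlow s Hs); lra).
    assert (EQ0 : Q0 s = ka + kb - 2 * m / E s).
    { unfold Q0, zl. rewrite Hd. unfold m. field. exact HEn. }
    assert (Eql : v * ql s = E s - (ka + kb) + m / E s).
    { unfold ql. replace (v * (b + (E s + m / E s) / v)) with (v * b + (E s + m / E s)) by (field; now split).
      rewrite Hb. ring. }
    (* The numerator over Y factors through ql, so the division by 2 ql cancels and the oscillating
       parts drop out, leaving the constant b. *)
    assert (EN : Q0 s * Q0 s - a * a * 0 * 0 - d * d = 4 * m / E s * (v * ql s)).
    { rewrite EQ0, Eql, Hd. unfold m. field. exact HEn. }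
    rewrite EN.
    replace (4 * m / E s * (v * ql s) * / (2 * ql s)) with (2 * m / E s * v) by (field; now split).
    replace (/ (0 - 1)) with (- (1) : C) by field. rewrite EQ0.
    replace (- (v * (ka + kb - 2 * m / E s - v * T) * - (1)) + 2 * m / E s * v - T)
      with (v * (ka + kb) - (v * v) * T - T) by (field; exact HEn).
    replace (ka + kb) with (- (v * b)) by (rewrite Hb; ring).
    replace (v * - (v * b)) with (- (v * v) * b) by ring. rewrite Hvv. ring.
  - pose proof appr_Y_0 as HY0. pose proof appr_const as Hc.
    assert (HY1 : appr P (fun s => Y s - 1) (fun _ => 0 - 1)) by (apply (appr_minus Y (fun _ => 0)); [exact HY0|apply Hc]).
    assert (HQ : appr P Q Q0).
    { unfold Q, Q0. repeat first [exact HY0|exact Hz|apply Hc|apply appr_minus|apply appr_plus|apply appr_mult]. }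
    assert (HiY : appr P (fun s => / (Y s - 1)) (fun _ => / (0 - 1))).
    { apply (appr_inv (fun s => Y s - 1) (fun _ => 0 - 1) (2 / 3)); [lra| |exact HY1].
      intros s Hs. specialize (HY s Hs). split.
      - pose proof (Cmod_triangle (- (Y s - 1)) (Y s)) as K. rewrite Cmod_opp in K.
        replace (- (Y s - 1) + Y s) with (RtoC 1) in K by ring. rewrite Cmod_1 in K. lra.
      - replace (0 - 1) with (- (1) : C) by ring. rewrite Cmod_m1. lra. }
    assert (Hiq : appr P (fun s => / (2 * q s)) (fun s => / (2 * ql s))).
    { apply (appr_inv (fun s => 2 * q s) (fun s => 2 * ql s) eta Heta).
      - intros s Hs. destruct (Hlow s Hs). rewrite !Cmod_mult, Cmod_R, Rabs_right by lra. lra.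
      - apply (appr_mult (fun _ => RtoC 2) (fun _ => RtoC 2)); [apply Hc|exact Hq]. }
    repeat first [exact HY0|exact HQ|exact HiY|exact Hiq|apply Hc|apply appr_minus|apply appr_opp|apply appr_plus|apply appr_mult].
Qed.

End Appr.

(** * The type-1 asymptotics restricted to the ray *)

Lemma vertical_end_ray sigma (D P : C -> Prop) : sigma = 1%R \/ sigma = (-1)%R ->
  vertical_end sigma D P ->
  exists M, (3 <= M)%R /\ forall s, (M <= s)%R -> D (Ci * RtoC sigma * RtoC s) -> P (Ci * RtoC sigma * RtoC s).
Proof.
  intros Hsg [M [eta [Heta H]]]. exists (Rmax 3 (M + 1)). split; [apply Rmax_l|]. intros s Hs HD.
  minmax. apply H; [exact HD| |].
  - rewrite Cmod_mult, Cmod_Ci_sign, Cmod_R, Rabs_right by (assumption || lra). lra.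
  - rewrite Carg_imaginary_axis by (assumption || lra). rewrite Rminus_diag, Rabs_R0. exact Heta.
Qed.

Lemma Clog_ray_bound sigma s : sigma = 1%R \/ sigma = (-1)%R -> (3 <= s)%R ->
  (Cmod (Clog (Ci * RtoC sigma * RtoC s)) <= 3 * ln s)%R.
Proof.
  intros Hsg Hs. rewrite Clog_ray by (assumption || lra). pose proof (ln_ge_1 s Hs) as Hl.
  pose proof PI_4. pose proof PI_RGT_0.
  eapply Rle_trans; [apply Cmod_triangle|]. rewrite Cmod_mult, Cmod_Ci, !Cmod_R.
  rewrite (Rabs_right (ln s)) by lra.
  assert (Rabs (sigma * PI / 2) <= 2)%R; [|lra].
  destruct Hsg as [-> | ->]; apply Rabs_le_between; lra.
Qed.

(** For purely imaginary nu all exponents in the error terms have real part -1, so every error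
    becomes O(ln s / s). *)
Lemma power_log_ray_bound sigma (mu : C) : sigma = 1%R \/ sigma = (-1)%R -> Re mu = (-1)%R ->
  exists K, (0 <= K)%R /\ forall s, (3 <= s)%R ->
    (Cmod (Cpower (Ci * RtoC sigma * RtoC s) mu * Clog (Ci * RtoC sigma * RtoC s)) <= K * (ln s / s))%R.
Proof.
  intros Hsg Hmu. exists (3 * exp (- (Im mu * (sigma * PI / 2))))%R.
  pose proof (exp_pos (- (Im mu * (sigma * PI / 2)))) as Hpos. split; [lra|]. intros s Hs.
  pose proof (Clog_ray_bound sigma s Hsg Hs) as HL.
  rewrite Cmod_mult, Cmod_Cpower_ray, Hmu by (assumption || lra).
  replace (-1 * ln s - Im mu * (sigma * PI / 2))%R with (- (Im mu * (sigma * PI / 2)) + - ln s)%R by ring.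
  rewrite exp_plus, exp_Ropp with (x := ln s), exp_ln by lra.
  set (e := exp (- (Im mu * (sigma * PI / 2)))) in *.
  replace (3 * e * (ln s / s))%R with (e * / s * (3 * ln s))%R by (field; lra).
  apply Rmult_le_compat_l; [|exact HL]. apply Rmult_le_pos; [lra|left; apply Rinv_0_lt_compat; lra].
Qed.

Lemma bigO_ray sigma (D : C -> Prop) (f g : C -> C) K0 : sigma = 1%R \/ sigma = (-1)%R ->
  (0 <= K0)%R ->
  (forall s, (3 <= s)%R -> (Cmod (g (Ci * RtoC sigma * RtoC s)%C) <= K0 * (ln s / s))%R) ->
  bigO (vertical_end sigma D) f g ->
  exists K M, (0 <= K)%R /\ (3 <= M)%R /\ forall s, (M <= s)%R -> D (Ci * RtoC sigma * RtoC s) ->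
    (Cmod (f (Ci * RtoC sigma * RtoC s)%C) <= K * (ln s / s))%R.
Proof.
  intros Hsg HK0 Hg [K H]. destruct (vertical_end_ray _ _ _ Hsg H) as [M [HM HH]].
  exists (Rabs K * K0)%R, M. pose proof (Rabs_pos K). split; [nra|split; [exact HM|]].
  intros s Hs HD. eapply Rle_trans; [apply HH; assumption|]. specialize (Hg s ltac:(lra)).
  pose proof (Rle_abs K). pose proof (Cmod_ge_0 (g (Ci * RtoC sigma * RtoC s))).
  rewrite Rmult_assoc. apply Rle_trans with (Rabs K * Cmod (g (Ci * RtoC sigma * RtoC s)%C))%R.
  - now apply Rmult_le_compat_r.
  - now apply Rmult_le_compat_l.
Qed.

Lemma type1_ray_data sigma (T0 T1 Too phi delta uhat : C) (y z u : C -> C) (om1 r : R) :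
  sigma = 1%R \/ sigma = (-1)%R -> nu1 Too phi = Ci * RtoC om1 -> (0 < r)%R ->
  type1_solution sigma T0 T1 Too phi delta uhat y z u ->
  exists K M, (0 <= K)%R /\ (3 <= M)%R /\ forall s, (M <= s)%R ->
    D1 T0 T1 Too phi delta 1 r 1 (Ci * RtoC sigma * RtoC s) ->
    let t := Ci * RtoC sigma * RtoC s in
    let E := carrier delta (Ci * RtoC om1) t in
    let Ra := 1 - (phi - T0 / 2) / E in
    let Rb := 1 - (phi - (T1 + Too) / 2) / E in
    (Cmod (y t * t - E * Ra * Rb) <= K * (ln s / s))%R /\
    (Cmod (z t - (- T0 - (phi - T0 / 2) * Rb)) <= K * (ln s / s))%R /\
    exists p q : C, (Cmod p <= K * (ln s / s))%R /\ (Cmod q <= K * (ln s / s))%R /\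
      u t = uhat / delta * (Cpower t (2 * phi) * (1 + p) / (Rb + q)).
Proof.
  intros Hsg Hnu Hr [_ [_ Hasym]].
  specialize (Hasym 1%R r 1%R ltac:(lra) Hr ltac:(lra)).
  unfold type1_asymptotics in Hasym. rewrite Hnu in Hasym.
  set (D := D1 T0 T1 Too phi delta 1 r 1) in *.
  destruct Hasym as [[o1 [o2 [B1 [B2 Hy]]]] [[p1 [p2 [B3 [B4 Hz]]]] [q1 [q2 [q3 [q4 [B5 [B6 [B7 [B8 Hu]]]]]]]]]].
  destruct (power_log_ray_bound sigma (- (3 * (Ci * RtoC om1)) - 1) Hsg ltac:(simpl; ring)) as [k3 [Hk3 G3]].
  destruct (power_log_ray_bound sigma (Ci * RtoC om1 - 1) Hsg ltac:(simpl; ring)) as [k1 [Hk1 G1]].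
  destruct (power_log_ray_bound sigma (- (2 * (Ci * RtoC om1)) - 1) Hsg ltac:(simpl; ring)) as [k2 [Hk2 G2]].
  destruct (power_log_ray_bound sigma (- (Ci * RtoC om1) - 1) Hsg ltac:(simpl; ring)) as [k4 [Hk4 G4]].
  assert (Gi : forall s, (3 <= s)%R -> (Cmod (/ (Ci * RtoC sigma * RtoC s)) <= 1 * (ln s / s))%R).
  { intros s Hs. destruct (lnx_x_nonneg s Hs) as [L _].
    assert (Hm : Cmod (Ci * RtoC sigma * RtoC s) = s).
    { rewrite Cmod_mult, Cmod_Ci_sign, Cmod_R, Rabs_right by (assumption || lra). ring. }
    rewrite Cmod_inv, Hm by (apply Cmod_gt_0; rewrite Hm; lra). lra. }
  assert (Gil : forall s, (3 <= s)%R -> (Cmod (/ (Ci * RtoC sigma * RtoC s) * Clog (Ci * RtoC sigma * RtoC s)) <= 3 * (ln s / s))%R).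
  { intros s Hs. pose proof (Clog_ray_bound sigma s Hsg Hs).
    assert (Hm : Cmod (Ci * RtoC sigma * RtoC s) = s).
    { rewrite Cmod_mult, Cmod_Ci_sign, Cmod_R, Rabs_right by (assumption || lra). ring. }
    rewrite Cmod_mult, Cmod_inv, Hm by (apply Cmod_gt_0; rewrite Hm; lra).
    replace (3 * (ln s / s))%R with (/ s * (3 * ln s))%R by (field; lra).
    apply Rmult_le_compat_l; [left; apply Rinv_0_lt_compat; lra|assumption]. }
  destruct (bigO_ray sigma D _ _ _ Hsg Hk3 G3 B1) as [K1 [M1 [HK1 [HM1 F1]]]].
  destruct (bigO_ray sigma D _ _ _ Hsg Hk1 G1 B2) as [K2 [M2 [HK2 [HM2 F2]]]].
  destruct (bigO_ray sigma D _ _ _ Hsg Rle_0_1 Gi B3) as [K3 [M3 [HK3 [HM3 F3]]]].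
  destruct (bigO_ray sigma D _ _ _ Hsg Hk3 G3 B4) as [K4 [M4 [HK4 [HM4 F4]]]].
  destruct (bigO_ray sigma D _ _ 3 Hsg ltac:(lra) Gil B5) as [K5 [M5 [HK5 [HM5 F5]]]].
  destruct (bigO_ray sigma D _ _ _ Hsg Hk2 G2 B6) as [K6 [M6 [HK6 [HM6 F6]]]].
  destruct (bigO_ray sigma D _ _ _ Hsg Hk4 G4 B7) as [K7 [M7 [HK7 [HM7 F7]]]].
  destruct (bigO_ray sigma D _ _ _ Hsg Hk3 G3 B8) as [K8 [M8 [HK8 [HM8 F8]]]].
  destruct (vertical_end_ray _ _ _ Hsg Hy) as [M9 [HM9 F9]].
  destruct (vertical_end_ray _ _ _ Hsg Hz) as [M10 [HM10 F10]].
  destruct (vertical_end_ray _ _ _ Hsg Hu) as [M11 [HM11 F11]].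
  exists (K1 + K2 + K3 + K4 + K5 + K6 + K7 + K8)%R,
    (M1 + M2 + M3 + M4 + M5 + M6 + M7 + M8 + M9 + M10 + M11)%R.
  split; [lra|split; [lra|]]. intros s Hs HD t E Ra Rb.
  destruct (lnx_x_nonneg s ltac:(lra)) as [_ Hln].
  specialize (F1 s ltac:(lra) HD). specialize (F2 s ltac:(lra) HD). specialize (F3 s ltac:(lra) HD).
  specialize (F4 s ltac:(lra) HD). specialize (F5 s ltac:(lra) HD). specialize (F6 s ltac:(lra) HD).
  specialize (F7 s ltac:(lra) HD). specialize (F8 s ltac:(lra) HD). specialize (F9 s ltac:(lra) HD).
  specialize (F10 s ltac:(lra) HD). specialize (F11 s ltac:(lra) HD).
  cbv beta in F9, F10, F11. unfold R1 in F9, F10, F11. rewrite Hnu in F9, F10, F11.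
  fold t in F1, F2, F3, F4, F5, F6, F7, F8, F9, F10, F11.
  fold (carrier delta (Ci * RtoC om1) t) in F9, F10, F11. fold E in F9, F10, F11. fold Ra Rb in F9, F10, F11.
  set (w := (ln s / s)%R) in *.
  assert (0 <= K1 * w /\ 0 <= K2 * w /\ 0 <= K3 * w /\ 0 <= K4 * w /\ 0 <= K5 * w /\ 0 <= K6 * w /\ 0 <= K7 * w /\ 0 <= K8 * w)%R as Hw
    by (repeat split; apply Rmult_le_pos; lra).
  split; [|split].
  - rewrite F9. replace (E * Ra * Rb + o1 t + o2 t - E * Ra * Rb) with (o1 t + o2 t) by ring.
    eapply Rle_trans; [apply Cmod_plus_le; eassumption|]. lra.
  - rewrite F10. match goal with |- (Cmod ?x <= _)%R => replace x with (p1 t + p2 t) by ring end.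
    eapply Rle_trans; [apply Cmod_plus_le; eassumption|]. lra.
  - exists (q1 t + q2 t), (q3 t + q4 t). split; [|split].
    + eapply Rle_trans; [apply Cmod_plus_le; eassumption|]. lra.
    + eapply Rle_trans; [apply Cmod_plus_le; eassumption|]. lra.
    + rewrite F11, !Cplus_assoc. reflexivity.
Qed.

(** * The type-1 solution on the imaginary axis *)

Section Type1Solution.

Variables (sigma : R) (T0 T1 Too phi delta uhat : C) (y z u : C -> C) (T01 omega1 al be : R).
Hypothesis Htype : type1_solution sigma T0 T1 Too phi delta uhat y z u.
Hypothesis Hpar : ray_params sigma T0 T1 Too T01 al be.
Hypothesis Hnu : nu1 Too phi = Ci * RtoC omega1.

Let v : C := Ci * RtoC sigma.
Let a0 : C := (T0 - T1 + Too) / 2.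
Let d0 : C := (T0 - T1 - Too) / 2.
Let T : R := (sigma * T01)%R.
Let om : R := (sigma * omega1)%R.
(** The ray variable is s = sigma tau > 0, so q = s Y is sigma times tau y; hence the factor sigma
    here and in [T] and [om]. *)
Let b : R := (sigma * ((omega1 - T01) / 2))%R.
Let ka : C := phi - T0 / 2.
Let kb : C := phi - (T1 + Too) / 2.
Let m : C := ka * kb.
Let rho : R := ray_modulus sigma omega1 delta.
Let E (s : R) : C := RtoC rho * cis (ray_phase sigma omega1 delta s).
Let Y (s : R) : C := y (v * RtoC s).
Let Z (s : R) : C := z (v * RtoC s).
Let V (s : R) : C := raySpeed Y s.
Let c (s : R) : C := rayInvariant (RtoC T) (RtoC al) (RtoC be) Y s.
Let q (s : R) : C := RtoC s * Y s.
Let ql (s : R) : C := RtoC b + (E s + m / E s) / v.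
Let vl (s : R) : C := E s - m / E s.

Lemma sigma_sign : sigma = 1%R \/ sigma = (-1)%R.
Proof. apply Hpar. Qed.

Lemma delta_neq_0 : delta <> 0.
Proof. apply Htype. Qed.

Lemma type1_isomonodromy : isomonodromy_solution T0 T1 Too y z u.
Proof. apply Htype. Qed.

Lemma direction_facts : Cmod v = 1%R /\ v * v = - (1) /\ v <> 0.
Proof.
  pose proof (Cmod_Ci_sign sigma sigma_sign) as Hv. split; [exact Hv|]. split.
  - apply (ray_params_facts _ _ _ _ _ _ _ Hpar).
  - apply Cmod_gt_0. unfold v. rewrite Hv. lra.
Qed.

Lemma rho_pos : (0 < rho)%R.
Proof. apply ray_modulus_pos, delta_neq_0. Qed.

Lemma Cmod_E s : Cmod (E s) = rho.
Proof.
  unfold E. rewrite Cmod_mult, Cmod_cis, Cmod_R, Rabs_right; [ring|]. left. apply rho_pos.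
Qed.

Lemma E_neq_0 s : E s <> 0.
Proof. apply Cmod_gt_0. rewrite Cmod_E. apply rho_pos. Qed.

Lemma carrier_E s : (0 < s)%R -> carrier delta (Ci * RtoC omega1) (v * RtoC s) = E s.
Proof. intro Hs. apply carrier_ray; [apply sigma_sign|apply delta_neq_0|exact Hs]. Qed.

Lemma d0_eq : d0 = kb - ka.
Proof. unfold d0, kb, ka. field. Qed.

Lemma v_mul_b : v * RtoC b = - (ka + kb).
Proof.
  pose proof (rp_gamma _ _ _ _ _ _ _ Hpar) as Hg. unfold gamma_hat in Hg. unfold nu1 in Hnu.
  assert (Hss : (sigma * sigma = 1)%R) by (destruct sigma_sign as [-> | ->]; ring).
  assert (E1 : v * RtoC b = (Ci * RtoC omega1 - Ci * RtoC T01) / 2).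
  { unfold v, b. rewrite RtoC_mult, RtoC_div, RtoC_minus by lra.
    replace (Ci * RtoC sigma * (RtoC sigma * ((RtoC omega1 - RtoC T01) / 2)))
      with (RtoC sigma * RtoC sigma * (Ci * ((RtoC omega1 - RtoC T01) / 2))) by ring.
    rewrite <- RtoC_mult, Hss. field. }
  rewrite E1, <- Hg, <- Hnu. unfold ka, kb. field.
Qed.

(** 4 ka kb = (ka + kb)^2 - (kb - ka)^2, where ka + kb = -v b has square -b^2 and kb - ka = d0 has
    square -2 be. *)
Lemma m_eq : m = RtoC (- (((omega1 - T01) / 2) ^ 2 - 2 * be) / 4).
Proof.
  destruct (ray_params_facts _ _ _ _ _ _ _ Hpar) as [_ [_ [_ Eb]]]. fold d0 in Eb.
  destruct direction_facts as [_ [Hvv _]].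
  assert (Ed : d0 * d0 = - (2 * RtoC be)) by (rewrite Eb; field).
  assert (Hss : (sigma * sigma = 1)%R) by (destruct sigma_sign as [-> | ->]; ring).
  assert (Hb2 : ((v * RtoC b) * (v * RtoC b)) = - RtoC (((omega1 - T01) / 2) ^ 2)).
  { replace (v * RtoC b * (v * RtoC b)) with ((v * v) * (RtoC b * RtoC b)) by ring.
    rewrite Hvv, <- RtoC_mult. unfold b.
    replace (sigma * ((omega1 - T01) / 2) * (sigma * ((omega1 - T01) / 2)))%R with
      (sigma * sigma * ((omega1 - T01) / 2) ^ 2)%R by ring.
    rewrite Hss, Rmult_1_l. ring. }
  assert (Em : m = ((ka + kb) * (ka + kb) - (kb - ka) * (kb - ka)) / 4) by (unfold m; field).
  rewrite Em, <- d0_eq, Ed.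
  replace (ka + kb) with (- (v * RtoC b)) by (rewrite v_mul_b; ring).
  replace (- (v * RtoC b) * - (v * RtoC b)) with ((v * RtoC b) * (v * RtoC b)) by ring.
  rewrite Hb2. rewrite RtoC_div, RtoC_opp, RtoC_minus, RtoC_mult by lra. field.
Qed.

Lemma v_mul_ql s : v * ql s = (E s - ka) * (E s - kb) / E s.
Proof.
  destruct direction_facts as [_ [_ Hvn]]. pose proof (E_neq_0 s).
  unfold ql. replace (v * (RtoC b + (E s + m / E s) / v)) with (v * RtoC b + (E s + m / E s)) by (field; now split).
  rewrite v_mul_b. unfold m. field. assumption.
Qed.

(** Distance of E from ka and kb keeps the leading term of q away from 0 and the denominator in the
    asymptotics of u nonzero. *)
Definition sampled (eta r M s : R) : Prop :=
  (M <= s)%R /\ D1 T0 T1 Too phi delta 1 r 1 (v * RtoC s) /\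
  (eta <= Cmod (E s - ka))%R /\ (eta <= Cmod (E s - kb))%R.

Lemma sampled_lead_low eta r M s : (0 < eta)%R -> sampled eta r M s -> (eta * eta / rho <= Cmod (ql s))%R.
Proof.
  intros He [_ [_ [H1 H2]]]. destruct direction_facts as [Hv _].
  replace (Cmod (ql s)) with (Cmod (v * ql s)) by (rewrite Cmod_mult, Hv; ring).
  rewrite v_mul_ql, Cmod_div, Cmod_mult, Cmod_E by apply E_neq_0.
  apply Rmult_le_compat_r; [left; apply Rinv_0_lt_compat, rho_pos|].
  apply Rmult_le_compat; lra.
Qed.

Lemma Cmod_ql_le s : (Cmod (ql s) <= Rabs b + rho + Cmod m / rho)%R.
Proof.
  destruct direction_facts as [Hv [_ Hvn]]. pose proof (Cmod_E s) as HEs.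
  unfold ql. rewrite Rplus_assoc. apply Cmod_plus_le; [apply Cmod_R_le|].
  rewrite Cmod_div, Hv by exact Hvn. unfold Rdiv at 1. rewrite Rinv_1, Rmult_1_r.
  apply Cmod_plus_le; [lra|]. rewrite Cmod_div, HEs by apply E_neq_0. lra.
Qed.

(** A whole interval around each sample is provided, because a single point might be a pole of z or
    u or a zero, where the system says nothing. *)
Lemma sampling_points :
  exists eta r X, (0 < eta)%R /\ (0 < r)%R /\ (22 <= X)%R /\ forall s, (X <= s)%R ->
    exists s1 e, (s - 20 <= s1 <= s - 1)%R /\ (0 < e <= 1 / 2)%R /\
      forall a M, (Rabs (a - s1) <= e)%R -> (M <= a)%R -> sampled eta r M a.
Proof.
  pose proof sigma_sign as Hsg. pose proof rho_pos as Hrho.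
  destruct (circle_point_avoiding sigma rho ka kb Hsg Hrho) as [psi [Na Nb]].
  set (e0 := RtoC rho * cis (sigma * psi)) in *.
  assert (Pa : (0 < Cmod (e0 - ka))%R).
  { apply Cmod_gt_0. intro Ez. apply Na. replace e0 with (e0 - ka + ka) by ring. rewrite Ez. ring. }
  assert (Pb : (0 < Cmod (e0 - kb))%R).
  { apply Cmod_gt_0. intro Ez. apply Nb. replace e0 with (e0 - kb + kb) by ring. rewrite Ez. ring. }
  set (eta := (Rmin (Cmod (e0 - ka)) (Cmod (e0 - kb)) / 2)%R).
  assert (Heta : (0 < eta)%R) by (unfold eta; pose proof (Rmin_pos _ _ Pa Pb); lra).
  assert (Ha2 : (2 * eta <= Cmod (e0 - ka))%R) by (unfold eta; pose proof (Rmin_l (Cmod (e0 - ka)) (Cmod (e0 - kb))); lra).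
  assert (Hb2 : (2 * eta <= Cmod (e0 - kb))%R) by (unfold eta; pose proof (Rmin_r (Cmod (e0 - ka)) (Cmod (e0 - kb))); lra).
  destruct (D1_near_sample sigma omega1 T0 T1 Too phi delta e0 eta Hsg delta_neq_0 Hnu Heta Ha2 Hb2) as [r [Hr HD]].
  destruct (phase_sampling sigma omega1 delta psi Hsg) as [X [HX Hs]].
  exists eta, r, (X + 10)%R. split; [exact Heta|split; [lra|split; [lra|]]]. intros s Hsx.
  destruct (Hs s ltac:(lra)) as [s1 [Hs1 Ec]].
  assert (Es1 : E s1 = e0) by (unfold E, e0; now rewrite Ec).
  pose proof (carrier_ray_deriv sigma omega1 delta s1 Hsg ltac:(lra)) as DE. cbv zeta in DE.
  apply is_cderiv_ccont in DE. fold rho in DE. change (ccont E s1) in DE.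
  pose proof (proj1 (ccont_eps _ _) DE eta Heta) as [e1 [He1 H1]].
  set (e := Rmin r (e1 / 2)).
  assert (He : (0 < e <= 1 / 2)%R) by (split; [apply Rmin_pos; lra|pose proof (Rmin_l r (e1 / 2)); unfold e; lra]).
  assert (Her : (e <= r)%R) by apply Rmin_l. assert (Hee : (e <= e1 / 2)%R) by apply Rmin_r.
  exists s1, e. split; [exact Hs1|split; [exact He|]]. intros a M Ha HM.
  specialize (H1 a ltac:(lra)). rewrite Es1 in H1.
  assert (Ha4 : (4 <= a)%R) by (apply Rabs_le_between in Ha; lra).
  assert (Hk : forall k, (2 * eta <= Cmod (e0 - k))%R -> (eta <= Cmod (E a - k))%R).
  { intros k Hk. pose proof (Cmod_triangle (- (E a - e0)) (E a - k)) as K. rewrite Cmod_opp in K.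
    replace (- (E a - e0) + (E a - k)) with (e0 - k) in K by ring. lra. }
  split; [exact HM|split; [|split; apply Hk; assumption]].
  apply (HD s1 a); try lra. fold v. rewrite carrier_E by lra. exact Es1.
Qed.

Lemma sampled_values eta r : (0 < eta)%R -> (0 < r)%R ->
  exists K M, (0 <= K)%R /\ (3 <= M)%R /\ forall s, sampled eta r M s ->
    (Cmod (q s - ql s) <= K * (ln s / s))%R /\
    (Cmod (Z s - (- T0 - ka * (1 - kb / E s))) <= K * (ln s / s))%R /\
    (eta * eta / rho / 2 <= Cmod (q s))%R /\ Y s <> 0 /\ u (v * RtoC s) <> 0.
Proof.
  intros Heta Hr. pose proof rho_pos as Hrho. destruct direction_facts as [Hv [_ Hvn]].
  destruct (type1_ray_data sigma T0 T1 Too phi delta uhat y z u omega1 r sigma_sign Hnu Hr Htype)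
    as [K [M [HK [HM H]]]].
  set (g := (eta * eta / rho / 2)%R).
  assert (Hg : (0 < g)%R) by (unfold g; repeat apply Rdiv_lt_0_compat; nra).
  (* The three entries keep, in turn, q, the denominator R1 + o(1) of u, and its factor 1 + o(1)
     away from 0. *)
  set (g2 := Rmin g (Rmin (eta / rho) 1)).
  assert (Hg2 : (0 < g2)%R) by (repeat apply Rmin_pos; try lra; now apply Rdiv_lt_0_compat).
  pose proof (Rmin_l g (Rmin (eta / rho) 1)) as G1. pose proof (Rmin_r g (Rmin (eta / rho) 1)) as G2.
  pose proof (Rmin_l (eta / rho) 1) as G3. pose proof (Rmin_r (eta / rho) 1) as G4. fold g2 in G1, G2.
  destruct (lnx_x_small (g2 / (K + 1))) as [X [HX Hsm]]; [apply Rdiv_lt_0_compat; lra|].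
  exists K, (Rmax M X). pose proof (Rmax_l M X) as L1. pose proof (Rmax_r M X) as L2.
  split; [exact HK|split; [lra|]]. intros s Hs.
  pose proof (sampled_lead_low eta r _ s Heta Hs) as Hlow.
  destruct Hs as [HsM [HD [Ha Hb]]].
  specialize (H s ltac:(lra) HD). cbv zeta in H. fold v in H.
  rewrite carrier_E in H by lra. destruct H as [H1 [H2 [p [w [H3 [H4 H5]]]]]].
  specialize (Hsm s ltac:(lra)). destruct (lnx_x_nonneg s ltac:(lra)) as [_ Hln].
  assert (HKle : (K * (ln s / s) < g2)%R).
  { apply mul_lt_of_lt_div in Hsm; [|lra]. nra. }
  pose proof (E_neq_0 s) as HEn.
  assert (Q1 : (Cmod (q s - ql s) <= K * (ln s / s))%R).
  { replace (Cmod (q s - ql s)) with (Cmod (v * (q s - ql s))) by (rewrite Cmod_mult, Hv; ring).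
    replace (v * (q s - ql s)) with (y (v * RtoC s) * (v * RtoC s) - E s * (1 - (phi - T0 / 2) / E s) * (1 - (phi - (T1 + Too) / 2) / E s)); [exact H1|].
    replace (v * (q s - ql s)) with (v * q s - v * ql s) by ring. rewrite v_mul_ql.
    unfold q. fold (Y s). fold ka kb. field. exact HEn. }
  assert (Qlow : (g <= Cmod (q s))%R).
  { pose proof (Cmod_triangle (- (q s - ql s)) (q s)) as Tr. rewrite Cmod_opp in Tr.
    replace (- (q s - ql s) + q s) with (ql s) in Tr by ring. unfold g in *. lra. }
  split; [exact Q1|split; [exact H2|split; [exact Qlow|split]]].
  - intro E0. unfold q in Qlow. rewrite E0, Cmult_0_r, Cmod_0 in Qlow. lra.
  - rewrite H5. fold kb.
    assert (N1 : 1 + p <> 0).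
    { apply Cmod_gt_0. pose proof (Cmod_triangle (1 + p) (- p)) as Tr. rewrite Cmod_opp in Tr.
      replace (1 + p + - p) with (RtoC 1) in Tr by ring. rewrite Cmod_1 in Tr. lra. }
    assert (N2 : 1 - kb / E s + w <> 0).
    { apply Cmod_gt_0. pose proof (Cmod_triangle (1 - kb / E s + w) (- w)) as Tr. rewrite Cmod_opp in Tr.
      replace (1 - kb / E s + w + - w) with ((E s - kb) / E s) in Tr by (field; exact HEn).
      rewrite Cmod_div, Cmod_E in Tr by exact HEn.
      assert (eta / rho <= Cmod (E s - kb) / rho)%R by (apply Rmult_le_compat_r; [left; now apply Rinv_0_lt_compat|exact Hb]).
      lra. }
    destruct Htype as [[_ [_ [Hu _]]] _].
    assert (Nuh : uhat / delta <> 0).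
    { intro E0. apply Hu. replace uhat with (uhat / delta * delta) by (field; apply delta_neq_0). rewrite E0. ring. }
    apply Cmult_neq_0; [exact Nuh|].
    apply (Cmult_neq_0 (Cpower (v * RtoC s) (2 * phi) * (1 + p)) (/ (1 - kb / E s + w))).
    + apply Cmult_neq_0; [apply Cexp_nz|exact N1].
    + intro E0. apply N2. set (x := 1 - kb / E s + w) in *.
      destruct (Ceq_dec x 0) as [Hx|Hx]; [exact Hx|]. exfalso. apply C1_nz. rewrite <- (Cinv_r x Hx), E0. ring.
Qed.

(** One sampled point shows that y and u do not vanish identically; the identity theorem along the
    ray then isolates the bad points. *)
Lemma good_point_punctured s0 : (0 < s0)%R -> punctured_ray (fun s => good_point y z u (v * RtoC s)) s0.
Proof.
  intro Hs0. destruct direction_facts as [Hv _].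
  destruct sampling_points as [eta [r [X [Heta [Hr [HX Hsp]]]]]].
  destruct (sampled_values eta r Heta Hr) as [K [M [HK [HM Hval]]]].
  destruct (Hsp (X + M + 20)%R ltac:(lra)) as [s1 [e [Hs1 [He Hs]]]].
  specialize (Hs s1 M ltac:(rewrite Rminus_diag, Rabs_R0; lra) ltac:(lra)).
  destruct (Hval s1 Hs) as [_ [_ [_ [Hy Hu]]]].
  assert (Hm : forall s, (0 < s)%R -> meromorphic_at y (v * RtoC s) /\ meromorphic_at z (v * RtoC s) /\ meromorphic_at u (v * RtoC s)).
  { intros s Hsp0. apply type1_isomonodromy. apply imaginary_axis_slit; [apply sigma_sign|exact Hsp0]. }
  pose proof (meromorphic_ray_nonzero y v s1 Hv (fun s H => proj1 (Hm s H)) ltac:(lra) Hy s0 Hs0) as Ny.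
  pose proof (meromorphic_ray_nonzero u v s1 Hv (fun s H => proj2 (proj2 (Hm s H))) ltac:(lra) Hu s0 Hs0) as Nu.
  destruct (Hm s0 Hs0) as [My [Mz Mu]].
  pose proof (meromorphic_ray_analytic y v s0 Hv My) as Ay.
  pose proof (meromorphic_ray_analytic z v s0 Hv Mz) as Az.
  pose proof (meromorphic_ray_analytic u v s0 Hv Mu) as Au.
  refine (punctured_ray_impl _ _ s0 _ (punctured_ray_and _ _ s0 Ay (punctured_ray_and _ _ s0 Az (punctured_ray_and _ _ s0 Au (punctured_ray_and _ _ s0 Ny Nu))))).
  intros s H. unfold good_point. tauto.
Qed.

Lemma sampled_data :
  exists K X, (0 <= K)%R /\ (40 <= X)%R /\ forall s, (X <= s)%R -> exists a, (s - 20 <= a <= s)%R /\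
    analytic_at y (v * RtoC a) /\
    (Cmod (q a - ql a) <= K * (ln a / a))%R /\
    (Cmod (V a - vl a) <= K * (ln a / a))%R /\
    (Cmod (c a - RtoC b) <= K * (ln a / a))%R.
Proof.
  pose proof rho_pos as Hrho. destruct direction_facts as [Hv [Hvv Hvn]].
  destruct (ray_params_facts _ _ _ _ _ _ _ Hpar) as [_ [HT [Ea Eb]]]. fold v a0 d0 T in HT, Ea, Eb.
  destruct sampling_points as [eta [r [X [Heta [Hr [HX Hsp]]]]]].
  destruct (sampled_values eta r Heta Hr) as [K [M [HK [HM Hval]]]].
  set (B := (Rabs b + rho + Cmod m / rho + K)%R).
  assert (HB : (0 <= B)%R).
  { unfold B. pose proof (Rabs_pos b). assert (0 <= Cmod m / rho)%R by (apply Rdiv_le_0_compat; [apply Cmod_ge_0|lra]). lra. }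
  (* The lower bound on a gives |Y| < 1/3 from |q| <= B. The neighbourhood of good points is what
     [iso_ray_system] uses to express V and c through Y and Z at a. *)
  set (P := fun a => sampled eta r M a /\ (3 * B + 3 < a)%R /\
     exists e, (0 < e)%R /\ forall x, (Rabs (x - a) < e)%R -> good_point y z u (v * RtoC x)).
  assert (HP3 : forall s, P s -> (3 <= s)%R) by (intros s [[Hs _] _]; lra).
  assert (Hle1 : forall s, (3 <= s)%R -> (ln s / s <= 1)%R).
  { intros s Hs. apply div_le_of_le_mul; [lra|]. pose proof (exp_ineq1_le (ln s)) as K1. rewrite exp_ln in K1; lra. }
  assert (Bq : forall s, P s -> (Cmod (q s) <= B)%R).
  { intros s Hs. destruct (Hval s (proj1 Hs)) as [H1 _]. pose proof (Cmod_ql_le s). specialize (Hle1 s (HP3 s Hs)).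
    replace (q s) with (ql s + (q s - ql s)) by ring. unfold B.
    eapply Rle_trans; [apply Cmod_plus_le; eassumption|]. nra. }
  assert (HY : forall s, P s -> (Cmod (Y s) < 1 / 3)%R).
  { intros s Hs. specialize (Bq s Hs).  destruct Hs as [_ [Hs _]].
    unfold q in Bq. rewrite Cmod_mult, Cmod_R, Rabs_right in Bq by lra.  nra. }
  assert (Hq : appr P q ql).
  { exists B. split; [exact HB|]. intros s Hs. destruct (Hval s (proj1 Hs)) as [H1 _].
    split; [now apply Bq|split].
    - eapply Rle_trans; [apply Cmod_ql_le|]. unfold B. lra.
    - destruct (lnx_x_nonneg s (HP3 s Hs)) as [_ Hln]. eapply Rle_trans; [exact H1|].
      apply Rmult_le_compat_r; [lra|]. unfold B. pose proof (Rabs_pos b).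
      assert (0 <= Cmod m / rho)%R by (apply Rdiv_le_0_compat; [apply Cmod_ge_0|lra]). lra. }
  assert (Hz : appr P Z (fun s => - T0 - ka * (1 - kb / E s))).
  { set (Bz := (Cmod T0 + Cmod ka * (1 + Cmod kb / rho) + K)%R).
    assert (Hbz : forall s, (Cmod (- T0 - ka * (1 - kb / E s)) <= Bz - K)%R).
    { intro s. unfold Bz. replace (Cmod T0 + Cmod ka * (1 + Cmod kb / rho) + K - K)%R with (Cmod T0 + Cmod ka * (1 + Cmod kb / rho))%R by ring.
      apply Cmod_minus_le; [rewrite Cmod_opp; lra|]. apply Cmod_mult_le; [lra|].
      apply Cmod_minus_le; [rewrite Cmod_1; lra|]. rewrite Cmod_div, Cmod_E by apply E_neq_0. lra. }
    pose proof (Hbz 1%R) as Hb1. pose proof (Cmod_ge_0 (- T0 - ka * (1 - kb / E 1))).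
    exists Bz. split; [lra|]. intros s Hs. destruct (Hval s (proj1 Hs)) as [_ [H2 _]].
    specialize (Hbz s). pose proof (Hle1 s (HP3 s Hs)) as Hl1. destruct (lnx_x_nonneg s (HP3 s Hs)) as [_ Hln].
    split; [|split; [lra|]].
    - replace (Z s) with ((- T0 - ka * (1 - kb / E s)) + (Z s - (- T0 - ka * (1 - kb / E s)))) by ring.
      eapply Rle_trans; [apply Cmod_plus_le; eassumption|]. nra.
    - eapply Rle_trans; [exact H2|]. apply Rmult_le_compat_r; lra. }
  set (g := (eta * eta / rho / 2)%R).
  assert (Hg : (0 < g)%R) by (unfold g; repeat apply Rdiv_lt_0_compat; nra).
  assert (Hlow : forall s, P s -> (g <= Cmod (q s))%R /\ (g <= Cmod (ql s))%R).
  { intros s Hs. destruct (Hval s (proj1 Hs)) as [_ [_ [H3 _]]]. split; [exact H3|].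
    pose proof (sampled_lead_low eta r M s Heta (proj1 Hs)) as H4. unfold g in *. lra. }
  pose proof (data_speed P HP3 T0 a0 d0 v (RtoC b) ka kb E Y Z rho Hv d0_eq v_mul_b Hrho (fun s _ => Cmod_E s) HY Hq Hz) as D1'.
  pose proof (data_invariant P HP3 T0 a0 d0 v (RtoC T) (RtoC b) ka kb E Y Z g rho Hvv Hv d0_eq v_mul_b Hg Hrho (fun s _ => Cmod_E s) HY Hq Hz Hlow) as D2'.
  destruct Hq as [K1 [HK1 A1]]. destruct D1' as [K2 [HK2 A2]]. destruct D2' as [K3 [HK3 A3]].
  exists (K1 + K2 + K3)%R, (X + M + 3 * B + 50)%R. split; [lra|split; [lra|]]. intros s Hs.
  destruct (Hsp s ltac:(lra)) as [s1 [e [Hs1 [He Hsa]]]].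
  destruct (good_point_punctured s1 ltac:(lra)) as [e2 [He2 Hgood]].
  (* Shifting s1 by w > 0 leaves a possibly bad point without leaving the sampled interval. *)
  set (w := (Rmin e e2 / 2)%R).
  assert (Hw : (0 < w)%R) by (unfold w; pose proof (Rmin_pos e e2 ltac:(lra) He2); lra).
  pose proof (Rmin_l e e2). pose proof (Rmin_r e e2). assert (Hwe : (w < e)%R) by (unfold w in *; lra).
  assert (Hwe2 : (w < e2)%R) by (unfold w in *; lra).
  set (a := (s1 + w)%R).
  assert (Haw : Rabs (a - s1) = w) by (unfold a; replace (s1 + w - s1)%R with w by ring; apply Rabs_right; lra).
  destruct (punctured_ray_inside _ s1 e2 a Hgood ltac:(lra)) as [e3 [He3 Hg3]].
  assert (Hsamp : sampled eta r M a).
  { apply Hsa; [lra|]. unfold a. lra. }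
  assert (HPa : P a).
  { split; [exact Hsamp|split; [unfold a; lra|]]. now exists e3. }
  assert (Haa : good_point y z u (v * RtoC a)) by (apply Hg3; rewrite Rminus_diag, Rabs_R0; exact He3).
  pose proof (HY a HPa) as HYa.
  assert (Hapos : (3 <= a)%R) by now apply HP3.
  destruct (raySpeed_deriv 0 0 0 y v a Hv ltac:(lra) (proj1 Haa) HYa) as [DYa _].
  pose proof (proj1 (ccont_eps _ _) (is_cderiv_ccont _ _ _ DYa) (1 / 3 - Cmod (Y a))%R ltac:(lra)) as [e4 [He4 Hc4]].
  set (e5 := Rmin e3 (Rmin e4 1)).
  assert (He5 : (0 < e5)%R) by (repeat apply Rmin_pos; lra).
  pose proof (Rmin_l e3 (Rmin e4 1)) as L1. pose proof (Rmin_r e3 (Rmin e4 1)) as L2. fold e5 in L1, L2.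
  pose proof (Rmin_l e4 1) as L3. pose proof (Rmin_r e4 1) as L4.
  destruct (iso_ray_system T0 a0 d0 v (RtoC T) Y Z a e5 Hvv HT ltac:(lra) He5) as [EV [Ec _]].
  { intros x Hx. assert (Hxp : (0 < x)%R) by (apply Rabs_def2 in Hx; lra).
    pose proof (Hg3 x ltac:(lra)) as Hgx.
    pose proof (isomonodromy_ray sigma T0 T1 Too y z u x sigma_sign Hxp type1_isomonodromy Hgx) as [J1 J2].
    split; [exact Hxp|split; [apply Hgx|split; [|split; [exact J1|exact J2]]]].
    specialize (Hc4 x ltac:(lra)). change (Cmod (Y x - Y a) < 1 / 3 - Cmod (Y a))%R in Hc4.
    pose proof (Cmod_triangle (Y x - Y a) (Y a)) as Tr. replace (Y x - Y a + Y a) with (Y x) in Tr by ring. lra. }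
  rewrite <- Ea, <- Eb in Ec.
  exists a. split; [unfold a; lra|]. split; [apply Haa|].
  destruct (A1 a HPa) as [_ [_ C1]]. destruct (A2 a HPa) as [_ [_ C2]]. destruct (A3 a HPa) as [_ [_ C3]].
  destruct (lnx_x_nonneg a Hapos) as [_ Hln].
  assert (0 <= K1 * (ln a / a) /\ 0 <= K2 * (ln a / a) /\ 0 <= K3 * (ln a / a))%R as Hnn
    by (repeat split; apply Rmult_le_pos; lra).
  unfold V. rewrite EV. unfold c. rewrite Ec.
  split; [eapply Rle_trans; [exact C1|]; lra|split; [eapply Rle_trans; [exact C2|]; lra|eapply Rle_trans; [exact C3|]; lra]].
Qed.

(** Every large s is at most 20 after a sampled point, so propagation over the fixed length 20 costs
    only a constant factor and preserves the rate ln s / s; the excluded discs and the possible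
    poles in the gaps disappear. *)
Lemma ray_asymptotics :
  exists K X, (0 <= K)%R /\ (3 <= X)%R /\ forall s, (X <= s)%R ->
    analytic_at y (v * RtoC s) /\ (Cmod (Y s) < 1 / 3)%R /\
    (Cmod (q s - ql s) <= K * (ln s / s))%R /\
    (Cmod (V s - vl s) <= K * (ln s / s))%R /\
    (Cmod (c s - RtoC b) <= K * (ln s / s))%R.
Proof.
  pose proof rho_pos as Hrho. destruct direction_facts as [Hv [Hvv Hvn]]. pose proof sigma_sign as Hsg.
  destruct sampled_data as [K [X [HK [HX Hdata]]]].
  set (K0 := (Rabs b + rho + Cmod m / rho + 1)%R).
  assert (HK0 : (1 <= K0)%R).
  { unfold K0. pose proof (Rabs_pos b). assert (0 <= Cmod m / rho)%R by (apply Rdiv_le_0_compat; [apply Cmod_ge_0|lra]). lra. }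
  set (Lam := (3 + 3 * (rem_bound T al be K0 + (Rabs om + 1) * (2 * K0)))%R).
  (* With eps = w = ln a / a, which is at least 1/a, the initial energy is at most (3 K^2 + 1)
     w^2. *)
  set (CC := ((3 * (K * K) + 1) * exp (Lam * 20))%R).
  assert (HCC : (0 < CC)%R) by (apply Rmult_lt_0_compat; [nra|apply exp_pos]).
  destruct (lnx_x_small (/ (CC + 1))) as [X2 [HX2 Hsm]]; [apply Rinv_0_lt_compat; lra|].
  set (S0 := (3 * K0 + 1)%R).
  assert (Hprop := propagation T al be om b v m Y V c E (fun s => analytic_at y (v * RtoC s)) S0 rho
    ltac:(unfold S0; lra) Hrho Hvv Hv (fun s _ => Cmod_E s)).
  specialize (Hprop (fun s Hs => carrier_ray_deriv sigma omega1 delta s Hsg (Rlt_le_trans 0 S0 s ltac:(unfold S0; lra) Hs))).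
  assert (Hreg : forall s, (S0 <= s)%R -> analytic_at y (v * RtoC s) -> (Cmod (Y s) < 1 / 3)%R ->
    is_cderiv Y s (V s / RtoC s) /\
    is_cderiv V s (rhsV (RtoC T) (RtoC al) (RtoC be) (RtoC s) (Y s) (c s)) /\
    is_cderiv c s (rhsC (RtoC T) (RtoC s) (Y s) (c s))).
  { intros s Hs Hy HY. assert (Hsp : (0 < s)%R) by (unfold S0 in Hs; lra).
    destruct (raySpeed_deriv (RtoC T) (RtoC al) (RtoC be) y v s Hv Hsp Hy HY) as [J1 [J2 _]].
    split; [exact J1|split; [exact J2|]].
    exact (rayInvariant_deriv sigma T0 T1 Too T01 al be y z u s Hpar type1_isomonodromy Hsp (good_point_punctured s Hsp) Hy HY). }
  specialize (Hprop Hreg).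
  assert (Hcont : forall s, (S0 <= s)%R -> analytic_at y (v * RtoC s) -> ccont Y s).
  { intros s Hs Hy. destruct (analytic_line_jets y v s Hv Hy) as [e [He H]].
    destruct (H s) as [J _]; [rewrite Rminus_diag, Rabs_R0; exact He|]. exact (is_cderiv_ccont _ _ _ J). }
  specialize (Hprop Hcont).
  assert (Hopen : forall s, (S0 <= s)%R -> analytic_at y (v * RtoC s) ->
    exists e, (0 < e)%R /\ forall x, (Rabs (x - s) < e)%R -> analytic_at y (v * RtoC x)).
  { intros s Hs Hy. destruct (analytic_at_open y _ Hy) as [e [He H]]. exists e. split; [exact He|].
    intros x Hx. apply H. now rewrite Cmod_line. }
  specialize (Hprop Hopen).
  assert (Hpole : forall s, (S0 <= s)%R -> ~ analytic_at y (v * RtoC s) ->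
    forall B : R, exists e, (0 < e)%R /\ forall x, (0 < Rabs (x - s) < e)%R -> (B < Cmod (Y x))%R).
  { intros s Hs Hn B. destruct (proj1 type1_isomonodromy (v * RtoC s)) as [[Hy|Hy] _].
    - apply imaginary_axis_slit; [exact Hsg|unfold S0 in Hs; lra].
    - contradiction.
    - destruct (pole_at_unbounded y _ B Hy) as [e [He H]]. exists e. split; [exact He|].
      intros x Hx. apply H. now rewrite Cmod_line. }
  specialize (Hprop Hpole).
  (* The factor 2 passes from ln a / a to ln s / s, as a >= s - 20 >= s/2; CC + 1 replaces the
     square root of CC. The last summand of the threshold yields |Y| < 1/3. *)
  exists (2 * (CC + 1))%R, (X + X2 + S0 + 40 + 3 * (K0 + 2 * (CC + 1)))%R.
  split; [lra|split; [unfold S0; lra|]]. intros s Hs.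
  destruct (Hdata s ltac:(unfold S0 in *; lra)) as [a [Ha [Hya [D1' [D2' D3']]]]].
  assert (Ha3 : (3 <= a)%R) by (unfold S0 in *; lra).
  destruct (lnx_x_nonneg a Ha3) as [Hia Hla].
  specialize (Hsm a ltac:(unfold S0 in *; lra)).
  set (w := (ln a / a)%R) in *.
  specialize (Hprop a 20%R w ltac:(lra) ltac:(unfold S0, K0; lra) Hia ltac:(lra) Hya).
  cbv beta in Hprop. fold K0 in Hprop. fold Lam in Hprop.
  change (RtoC a * Y a) with (q a) in Hprop. change (RtoC b + (E a + m / E a) / v) with (ql a) in Hprop.
  change (E a - m / E a) with (vl a) in Hprop.
  assert (Hfa : ((Cmod (q a - ql a) ^ 2 + Cmod (V a - vl a) ^ 2 + Cmod (c a - RtoC b) ^ 2 + w ^ 2) * exp (Lam * 20) <= CC * (w * w))%R).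
  { unfold CC. replace ((3 * (K * K) + 1) * exp (Lam * 20) * (w * w))%R with ((3 * (K * K) + 1) * (w * w) * exp (Lam * 20))%R by ring.
    apply Rmult_le_compat_r; [left; apply exp_pos|].
    assert (Sq : forall x, (0 <= x -> x <= K * w -> x ^ 2 <= K * K * (w * w))%R) by (intros x Hx0 Hx; simpl; nra).
    pose proof (Sq _ (Cmod_ge_0 _) D1'). pose proof (Sq _ (Cmod_ge_0 _) D2'). pose proof (Sq _ (Cmod_ge_0 _) D3').
    simpl in *. lra. }
  assert (Hw1 : (w * (CC + 1) < 1)%R).
  { apply (mul_lt_of_lt_div w 1 (CC + 1)); [lra|]. unfold Rdiv. rewrite Rmult_1_l. exact Hsm. }
  assert (HwCC : (CC * (w * w) < 1)%R).
  { assert (w < 1)%R by nra. assert (CC * w < 1)%R by nra. nra. }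
  destruct (Hprop ltac:(lra) s ltac:(lra)) as [Hys Hfs]. clear Hprop.
  change (RtoC s * Y s) with (q s) in Hfs. change (RtoC b + (E s + m / E s) / v) with (ql s) in Hfs.
  change (E s - m / E s) with (vl s) in Hfs.
  assert (Hs3 : (3 <= s)%R) by (unfold S0 in *; lra).
  destruct (lnx_x_nonneg s Hs3) as [_ Hls].
  assert (Hws : (w <= 2 * (ln s / s))%R).
  { unfold w. replace (2 * (ln s / s))%R with (ln s * (2 / s))%R by (field; lra).
    pose proof (ln_ge_1 a Ha3). unfold Rdiv at 1. apply Rmult_le_compat; [lra|left; apply Rinv_0_lt_compat; lra| |].
    - destruct (Req_dec a s) as [->|Hne]; [lra|]. left. apply ln_increasing; lra.
    - replace (2 / s)%R with (/ (s / 2))%R by (field; lra). apply Rinv_le_contravar; unfold S0 in *; lra. }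
  assert (Hfin : forall x, (0 <= x -> x ^ 2 <= CC * (w * w) -> x <= 2 * (CC + 1) * (ln s / s))%R).
  { intros x Hx0 Hx. apply Rle_trans with ((CC + 1) * w)%R; [|nra].
    apply Rnot_lt_le. intro Hlt. assert (0 < (CC + 1) * w)%R by nra.
    assert ((CC + 1) * w * ((CC + 1) * w) < x ^ 2)%R by (simpl; nra).
    assert (CC * (w * w) <= (CC + 1) * w * ((CC + 1) * w))%R.
    { replace ((CC + 1) * w * ((CC + 1) * w))%R with ((CC + 1) * (CC + 1) * (w * w))%R by ring.
      apply Rmult_le_compat_r; nra. }
    lra. }
  pose proof (pow2_ge_0 (Cmod (q s - ql s))). pose proof (pow2_ge_0 (Cmod (V s - vl s))).
  pose proof (pow2_ge_0 (Cmod (c s - RtoC b))). pose proof (pow2_ge_0 w).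
  assert (R1' : (Cmod (q s - ql s) <= 2 * (CC + 1) * (ln s / s))%R) by (apply Hfin; [apply Cmod_ge_0|lra]).
  split; [exact Hys|split; [|split; [exact R1'|split; apply Hfin; try apply Cmod_ge_0; lra]]].
  pose proof (Cmod_ql_le s) as Bql.
  assert (Hle1 : (ln s / s <= 1)%R).
  { apply div_le_of_le_mul; [lra|]. pose proof (exp_ineq1_le (ln s)) as K1. rewrite exp_ln in K1; lra. }
  assert (Bq : (Cmod (q s) <= K0 + 2 * (CC + 1))%R).
  { replace (q s) with (ql s + (q s - ql s)) by ring. eapply Rle_trans; [apply Cmod_plus_le; eassumption|].
    unfold K0. nra. }
  unfold q in Bq. rewrite Cmod_mult, Cmod_R, Rabs_right in Bq by lra.
   unfold S0 in Hs. nra.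
Qed.

(** At a pole of order n, t - v s0 = v (s - s0) gives Im Y = Im(v^(-n) g) / (s - s0)^n: the singular
    factor is real, so the dichotomy for analytic functions applies to v^(-n) g. *)
Lemma ray_Im_dichotomy s0 : (0 < s0)%R ->
  (exists e, (0 < e)%R /\ forall s, (0 < Rabs (s - s0) < e)%R -> Im (Y s) = 0%R) \/
  (exists e, (0 < e)%R /\ forall s, (0 < Rabs (s - s0) < e)%R -> Im (Y s) <> 0%R).
Proof.
  intro Hs0. destruct direction_facts as [Hv [_ Hvn]].
  destruct (proj1 type1_isomonodromy (v * RtoC s0) (imaginary_axis_slit sigma s0 sigma_sign Hs0)) as [[Hy|Hy] _].
  - destruct (Im_along_line_dichotomy y (v * RtoC s0) 1 v Hv Hy) as [[e [He H]]|[e [He H]]]; [left|right];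
      exists e; (split; [exact He|]); intros s Hs; specialize (H (s - s0)%R); rewrite Cmult_1_l in H;
      replace (v * RtoC s0 + v * RtoC (s - s0)) with (v * RtoC s) in H by (rewrite RtoC_minus; ring); apply H; lra.
  - destruct Hy as [n [g [Hn [Hg [_ Hf]]]]]. apply locally'_C in Hf. destruct Hf as [e1 [He1 Hf]].
    assert (HI : forall s, (0 < Rabs (s - s0) < e1)%R ->
      Im (Y s) = (Im (/ v ^ n * g (v * RtoC s))%C * / (s - s0) ^ n)%R /\ (/ (s - s0) ^ n <> 0)%R).
    { intros s Hs. assert (Hne : (s - s0 <> 0)%R) by (intro E0; rewrite E0, Rabs_R0 in Hs; lra).
      pose proof (pow_nonzero (s - s0) n Hne) as Hpn.
      split; [|now apply Rinv_neq_0_compat].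
      unfold Y. rewrite (Hf (v * RtoC s)) by (now rewrite Cmod_line).
      rewrite pow_n_Cpow.
      replace (v * RtoC s - v * RtoC s0) with (v * RtoC (s - s0)) by (rewrite RtoC_minus; ring).
      rewrite Cpow_mult_l, <- RtoC_pow, <- im_scal_r, RtoC_inv by exact Hpn. f_equal.
      assert (RtoC ((s - s0) ^ n) <> 0) by (intro E0; apply RtoC_inj in E0; contradiction).
      pose proof (Cpow_nz v n Hvn). field. now split. }
    destruct (Im_along_line_dichotomy g (v * RtoC s0) (/ v ^ n) v Hv Hg) as [[e [He H]]|[e [He H]]]; [left|right];
      exists (Rmin e e1); (split; [now apply Rmin_pos|]); intros s Hs;
      pose proof (Rmin_l e e1); pose proof (Rmin_r e e1);
      specialize (H (s - s0)%R);
      replace (v * RtoC s0 + v * RtoC (s - s0)) with (v * RtoC s) in H by (rewrite RtoC_minus; ring);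
      specialize (H ltac:(lra)); destruct (HI s ltac:(lra)) as [E0 Hnz]; rewrite E0.
    + rewrite H. ring.
    + now apply Rmult_integral_contrapositive_currified.
Qed.

Lemma ray_reality_continuation S1 : (forall s, (S1 <= s)%R -> Im (Y s) = 0%R) ->
  forall s, (0 < s)%R -> analytic_at y (v * RtoC s) -> Im (Y s) = 0%R.
Proof.
  intros H1 s Hs Hy. destruct direction_facts as [Hv _].
  set (L := fun s0 : R => exists e, (0 < e)%R /\ forall s, (0 < Rabs (s - s0) < e)%R -> Im (Y s) = 0%R).
  assert (HL : L s).
  { pose proof (Rmax_l 1 (S1 + 1)) as Rm1. pose proof (Rmax_r 1 (S1 + 1)) as Rm2.
    apply (locally_constant L) with (a := Rmax 1 (S1 + 1)); [|lra|exact Hs|].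
    - intros x Hx. destruct (ray_Im_dichotomy x Hx) as [[e [He H]]|[e [He H]]].
      + exists e. split; [exact He|]. intros w Hw. assert (Lx : L x) by now exists e.
        destruct (Req_dec w x) as [->|Hne]; [tauto|]. assert (Lw : L w); [|tauto].
        destruct (punctured_ray_inside _ x e w H) as [e2 [He2 H2]]; [split; [apply Rabs_pos_lt; lra|exact Hw]|].
        exists e2. split; [exact He2|]. intros r Hr. apply H2. lra.
      + assert (Hno : forall w, (Rabs (w - x) < e)%R -> ~ L w).
        { intros w Hw [e2 [He2 H2]].
          set (k := (Rmin e2 (e - Rabs (w - x)))%R).
          assert (Hk : (0 < k)%R) by (apply Rmin_pos; lra).
          assert (Hk1 : (k <= e2)%R) by apply Rmin_l. assert (Hk2 : (k <= e - Rabs (w - x))%R) by apply Rmin_r.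
          (* The test point is taken on the side of w away from x, which keeps it different from
             x. *)
          set (sg := if Rle_dec x w then (w + k / 2)%R else (w - k / 2)%R).
          assert (Hsg : Rabs (sg - w) = (k / 2)%R /\ (0 < Rabs (sg - x))%R).
          { unfold sg. destruct (Rle_dec x w).
            - split; [replace (w + k / 2 - w)%R with (k / 2)%R by ring; apply Rabs_right; lra|apply Rabs_pos_lt; lra].
            - split; [replace (w - k / 2 - w)%R with (- (k / 2))%R by ring; rewrite Rabs_Ropp; apply Rabs_right; lra|apply Rabs_pos_lt; lra]. }
          destruct Hsg as [G1 G2]. apply (H sg).
          - split; [exact G2|]. apply (near_shrink x w). lra.
          - apply H2. lra. }
        exists e. split; [exact He|]. intros w Hw. specialize (Hno w Hw) as N1.
        assert (N2 : ~ L x) by (apply Hno; rewrite Rminus_diag, Rabs_R0; exact He). tauto.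
    - exists 1%R. split; [lra|]. intros w Hw. apply H1. destruct Hw as [_ Hw]. apply Rabs_def2 in Hw. lra. }
  destruct HL as [e [He H]].
  apply NNPP. intro Hne. assert (Hpos : (0 < Rabs (Im (Y s)))%R) by now apply Rabs_pos_lt.
  destruct (analytic_at_continuous y _ Hy _ Hpos) as [e2 [He2 H2]].
  set (w := (s + Rmin e e2 / 2)%R).
  assert (Hm : (0 < Rmin e e2)%R) by now apply Rmin_pos.
  minmax.
  assert (Hw : Rabs (w - s) = (Rmin e e2 / 2)%R).
  { unfold w. replace (s + Rmin e e2 / 2 - s)%R with (Rmin e e2 / 2)%R by ring. apply Rabs_right. lra. }
  specialize (H w ltac:(lra)). specialize (H2 (v * RtoC w) ltac:(rewrite Cmod_line by exact Hv; lra)).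
  pose proof (im_le_Cmod (y (v * RtoC w) - y (v * RtoC s))) as K. rewrite Im_minus in K.
  fold (Y w) in K. fold (Y s) in K. rewrite H in K.
  unfold Rminus in K. rewrite Rplus_0_l, Rabs_Ropp in K. fold (Y w) (Y s) in H2. lra.
Qed.

(** * Reality on the half-axis and the modulus relation *)

Let Asq : R := (((omega1 - T01) / 2) ^ 2 - 2 * be)%R.
Let k : R := (Asq / (4 * rho))%R.
Let theta (s : R) : R := ray_phase sigma omega1 delta s.

(** As m is real and |E| = rho, the term m/E is -k times the conjugate of the unit phase. The
    leading term then has amplitude rho + k in its real part and rho - k in its imaginary part, so
    rho = k is the reality condition and 2 rho the resulting amplitude. *)
Lemma lead_parts s :
  Re (ql s) = (b + sigma * (rho + k) * sin (theta s))%R /\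
  Im (ql s) = (- (sigma * (rho - k) * cos (theta s)))%R /\
  Im (vl s) = ((rho - k) * sin (theta s))%R.
Proof.
  destruct direction_facts as [Hv [Hvv Hvn]]. pose proof rho_pos as Hrho.
  assert (Hcn : cis (theta s) * Cconj (cis (theta s)) = 1).
  { apply C_ext; rewrite ?re_mult, ?im_mult, ?re_conj, ?im_conj, ?Re_cis, ?Im_cis; simpl.
    - pose proof (sin2_cos2 (theta s)) as Q. unfold Rsqr in Q. lra.
    - ring. }
  assert (Hc0 : cis (theta s) <> 0) by (apply Cmod_gt_0; rewrite Cmod_cis; lra).
  assert (EmE : m / E s = RtoC (- k) * Cconj (cis (theta s))).
  { rewrite m_eq. fold Asq. unfold E. fold (theta s).
    replace (Cconj (cis (theta s))) with (/ cis (theta s)).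
    2:{ replace (Cconj (cis (theta s))) with (/ cis (theta s) * (cis (theta s) * Cconj (cis (theta s)))) by (field; exact Hc0).
        rewrite Hcn. ring. }
    assert (HrC : RtoC rho <> 0) by (intro E0; apply RtoC_inj in E0; lra).
    replace (RtoC (- Asq / 4)) with (RtoC (- k) * RtoC rho).
    - field. now split.
    - rewrite <- RtoC_mult. f_equal. unfold k. field. lra. }
  assert (Eiv : ql s = RtoC b + (E s + m / E s) * (- v)).
  { unfold ql, Cdiv at 1. f_equal. f_equal.
    replace (- v) with (/ v * (- (v * v))) by (field; exact Hvn). rewrite Hvv. ring. }
  assert (E1 : E s = RtoC rho * cis (theta s)) by reflexivity.
  rewrite Eiv. unfold vl. rewrite EmE, E1. unfold v.
  generalize (theta s). intro th.
  split; [|split]; unfold cis, Cconj; simpl; ring.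
Qed.

Hypothesis Hpos : (0 < Asq)%R.
Let A : R := sqrt Asq.

Lemma modulus_k : (2 * rho)%R = A -> rho = k.
Proof.
  intro H. pose proof rho_pos. unfold k.
  assert (E1 : (Asq = 2 * rho * (2 * rho))%R) by (rewrite H; unfold A; symmetry; apply sqrt_sqrt; lra).
  rewrite E1. field. lra.
Qed.

Lemma modulus_k_conv : rho = k -> (2 * rho)%R = A.
Proof.
  intro H. pose proof rho_pos as Hrho.
  assert (E1 : (Asq = 2 * rho * (2 * rho))%R).
  { unfold k in H. apply (f_equal (fun x => x * (4 * rho))%R) in H.
    replace (Asq / (4 * rho) * (4 * rho))%R with Asq in H by (field; lra). lra. }
  unfold A. rewrite E1. symmetry. apply sqrt_square. lra.
Qed.

Lemma ray_eventually_real : (2 * rho)%R = A -> exists S1, forall s, (S1 <= s)%R -> Im (Y s) = 0%R.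
Proof.
  intro Hmod. pose proof (modulus_k Hmod) as Hk.
  destruct direction_facts as [Hv [Hvv Hvn]].
  destruct ray_asymptotics as [K [X [HK [HX H]]]].
  assert (Hle1 : forall s, (3 <= s)%R -> (ln s / s <= 1)%R).
  { intros s Hs. apply div_le_of_le_mul; [lra|]. pose proof (exp_ineq1_le (ln s)) as K1. rewrite exp_ln in K1; lra. }
  assert (Hvan : forall f : R -> C, (forall s, (X <= s)%R -> (Rabs (Im (f s)) <= K * (ln s / s))%R) -> vanishes (fun s => Im (f s))).
  { intros f Hf eps He. destruct (lnx_x_small (eps / (K + 1))) as [X2 [HX2 Hs2]]; [apply Rdiv_lt_0_compat; lra|].
    exists (Rmax X X2). intros s Hs. minmax.
    specialize (Hf s ltac:(lra)). specialize (Hs2 s ltac:(lra)). apply mul_lt_of_lt_div in Hs2; [|lra].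
    destruct (lnx_x_nonneg s ltac:(lra)) as [_ Hl]. nra. }
  set (KK := (Rabs b + rho + Cmod m / rho + 2 * K)%R).
  assert (HKK : (0 <= Cmod m / rho)%R) by (apply Rdiv_le_0_compat; [apply Cmod_ge_0|apply rho_pos]).
  pose proof (Rabs_pos b) as Hb0. pose proof rho_pos as Hrho.
  apply (ray_reality T al be om b X KK Y V c); [lra| | | | |].
  - unfold om, b, T. field.
  - intros s Hs. destruct (H s Hs) as [Hy [HY [D1' [D2' D3']]]].
    assert (Hsp : (0 < s)%R) by lra.
    pose proof (Hle1 s ltac:(lra)) as Hl1. destruct (lnx_x_nonneg s ltac:(lra)) as [_ Hl].
    destruct (raySpeed_deriv (RtoC T) (RtoC al) (RtoC be) y v s Hv Hsp Hy HY) as [J1 [J2 _]].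
    split; [exact HY|split; [exact J1|split; [exact J2|split]]].
    + exact (rayInvariant_deriv sigma T0 T1 Too T01 al be y z u s Hpar type1_isomonodromy Hsp (good_point_punctured s Hsp) Hy HY).
    + split; [|split].
      * change (RtoC s * Y s) with (q s). replace (q s) with (ql s + (q s - ql s)) by ring.
        eapply Rle_trans; [apply Cmod_plus_le; [apply Cmod_ql_le|exact D1']|]. unfold KK. nra.
      * replace (c s) with (RtoC b + (c s - RtoC b)) by ring.
        eapply Rle_trans; [apply Cmod_plus_le; [apply Cmod_R_le|exact D3']|]. unfold KK. nra.
      * eapply Rle_trans; [exact D3'|]. pose proof (lnx_x_le_sqrt s ltac:(lra)) as Hq.
        unfold Rdiv in *. unfold KK. nra.
  - apply (Hvan q). intros s Hs. destruct (H s Hs) as [_ [_ [D1' _]]].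
    destruct (lead_parts s) as [_ [EI _]]. rewrite <- Hk in EI.
    pose proof (im_le_Cmod (q s - ql s)) as HI. rewrite Im_minus, EI in HI.
    replace (Im (q s) - - (sigma * (rho - rho) * cos (theta s)))%R with (Im (q s)) in HI by ring. lra.
  - apply (Hvan V). intros s Hs. destruct (H s Hs) as [_ [_ [_ [D2' _]]]].
    destruct (lead_parts s) as [_ [_ EI]]. rewrite <- Hk in EI.
    pose proof (im_le_Cmod (V s - vl s)) as HI. rewrite Im_minus, EI in HI.
    replace (Im (V s) - (rho - rho) * sin (theta s))%R with (Im (V s)) in HI by ring. lra.
  - apply (Hvan c). intros s Hs. destruct (H s Hs) as [_ [_ [_ [_ D3']]]].
    pose proof (im_le_Cmod (c s - RtoC b)) as HI. rewrite Im_minus, im_RtoC, Rminus_0_r in HI. lra.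
Qed.

Lemma sigma_tau tau : Ci * RtoC tau = v * RtoC (sigma * tau).
Proof.
  assert (Hss : (sigma * sigma = 1)%R) by (destruct sigma_sign as [-> | ->]; ring).
  unfold v. rewrite <- Cmult_assoc, <- RtoC_mult. do 2 f_equal.
  replace (sigma * (sigma * tau))%R with (sigma * sigma * tau)%R by ring. rewrite Hss. ring.
Qed.

Lemma real_on_axis_exists : (2 * rho)%R = A -> real_on_axis sigma y (fun tau => Re (y (Ci * RtoC tau))).
Proof.
  intros Hmod tau Ht Hy. destruct (ray_eventually_real Hmod) as [S1 H1].
  apply C_ext; [reflexivity|]. rewrite im_RtoC. rewrite sigma_tau in *.
  now apply (ray_reality_continuation S1).
Qed.

(** Along a sequence of points with phase 0 the cosine is 1, so a real q would leave the constant
    |rho - k| bounded by O(ln s / s). *)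
Lemma real_on_axis_modulus yt : real_on_axis sigma y yt -> (2 * rho)%R = A.
Proof.
  intro Hre. apply modulus_k_conv. pose proof sigma_sign as Hsg.
  assert (Hss : (sigma * sigma = 1)%R) by (destruct sigma_sign as [-> | ->]; ring).
  destruct ray_asymptotics as [K [X [HK [HX H]]]].
  destruct (phase_sampling sigma omega1 delta 0 Hsg) as [X1 [HX1 Hs1]].
  apply NNPP. intro Hne.
  assert (Hd : (0 < Rabs (rho - k))%R) by (apply Rabs_pos_lt; lra).
  destruct (lnx_x_small (Rabs (rho - k) / (K + 1))) as [X2 [HX2 Hs2]]; [apply Rdiv_lt_0_compat; lra|].
  destruct (Hs1 (X1 + X + X2 + 20)%R ltac:(lra)) as [a [Ha Ec]].
  destruct (H a ltac:(lra)) as [Hy [_ [D1' _]]].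
  specialize (Hs2 a ltac:(lra)). apply mul_lt_of_lt_div in Hs2; [|lra].
  destruct (lnx_x_nonneg a ltac:(lra)) as [_ Hl].
  destruct (lead_parts a) as [_ [EI _]].
  assert (Ecos : cos (theta a) = 1%R).
  { rewrite <- Re_cis. unfold theta. rewrite Ec, Rmult_0_r, Re_cis. apply cos_0. }
  rewrite Ecos, Rmult_1_r in EI.
  assert (EY : Im (q a) = 0%R).
  { unfold q. rewrite im_scal_l. unfold Y.
    assert (Et : v * RtoC a = Ci * RtoC (sigma * a)).
    { rewrite sigma_tau. do 2 f_equal. replace (sigma * (sigma * a))%R with (sigma * sigma * a)%R by ring. rewrite Hss. ring. }
    rewrite Et in *. rewrite (Hre (sigma * a)%R); [rewrite im_RtoC; ring| |exact Hy].
    replace (sigma * (sigma * a))%R with (sigma * sigma * a)%R by ring. rewrite Hss. lra. }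
  pose proof (im_le_Cmod (q a - ql a)) as HI. rewrite Im_minus, EI, EY in HI.
  replace (0 - - (sigma * (rho - k)))%R with (sigma * (rho - k))%R in HI by ring.
  rewrite Rabs_mult in HI.
  replace (Rabs sigma) with 1%R in HI by (destruct Hsg as [-> | ->]; unfold Rabs; destruct Rcase_abs; lra).
  nra.
Qed.

Lemma real_on_axis_asymptotics yt : real_on_axis sigma y yt ->
  real_asymptotics sigma y yt ((omega1 - T01) / 2) A omega1 (Carg delta).
Proof.
  intro Hre. pose proof (real_on_axis_modulus yt Hre) as Hmod. pose proof (modulus_k Hmod) as Hk.
  pose proof sigma_sign as Hsg.
  assert (Hss : (sigma * sigma = 1)%R) by (destruct sigma_sign as [-> | ->]; ring).
  destruct ray_asymptotics as [K [X [HK [HX H]]]].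
  (* The error is defined by the asymptotic formula itself, so only its size needs proof: it is
     sigma times the real part of q - ql. *)
  exists K, X, (fun tau => tau * yt tau - (omega1 - T01) / 2 - A * sin (tau + omega1 * ln (Rabs tau) + Carg delta))%R.
  intros tau Ht. set (s := (sigma * tau)%R) in *.
  destruct (H s ltac:(lra)) as [Hy [_ [D1' _]]].
  assert (Htau : tau = (sigma * s)%R).
  { unfold s. replace (sigma * (sigma * tau))%R with (sigma * sigma * tau)%R by ring. rewrite Hss. ring. }
  assert (Habs : Rabs tau = s).
  { rewrite Htau. destruct Hsg as [Hs1 | Hs1]; rewrite Hs1; unfold Rabs; destruct Rcase_abs; lra. }
  assert (Hne : tau <> 0%R) by (intro E0; rewrite E0, Rabs_R0 in Habs; lra).
  assert (Hy' : analytic_at y (Ci * RtoC tau)) by (rewrite sigma_tau; exact Hy).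
  split; [exact Hy'|]. split; [field; exact Hne|].
  assert (EY : Y s = RtoC (yt tau)).
  { unfold Y, s. rewrite <- sigma_tau. apply Hre; [fold s; lra|exact Hy']. }
  destruct (lead_parts s) as [ER _]. rewrite <- Hk in ER.
  assert (Eq : Re (q s) = (s * yt tau)%R) by (unfold q; rewrite EY, re_scal_l, re_RtoC; reflexivity).
  pose proof (re_le_Cmod (q s - ql s)) as HR. rewrite Re_minus, ER, Eq in HR.
  assert (Eth : theta s = (tau + omega1 * ln (Rabs tau) + Carg delta)%R).
  { unfold theta, ray_phase. rewrite Habs, <- Htau. reflexivity. }
  rewrite Eth in HR.
  replace (ln (Rabs tau) / tau)%R with (sigma * (ln s / s))%R.
  2:{ rewrite Habs, Htau. destruct Hsg as [Hs1 | Hs1]; rewrite Hs1; field; lra. }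
  rewrite Rabs_mult.
  assert (Hsa : Rabs sigma = 1%R) by (destruct Hsg as [-> | ->]; unfold Rabs; destruct Rcase_abs; lra).
  destruct (lnx_x_nonneg s ltac:(lra)) as [_ Hl].
  rewrite Hsa, (Rabs_right (ln s / s)) by lra.
  eapply Rle_trans; [|rewrite Rmult_1_l; exact D1'].
  eapply Rle_trans; [|exact HR]. rewrite <- (Rmult_1_l (Rabs (tau * yt tau - _ - _))), <- Hsa, <- Rabs_mult.
  right. f_equal. unfold b, s. rewrite <- Hmod. ring.
Qed.

End Type1Solution.

Theorem corollary3p2 :
  forall (sigma : R) (T0 T1 Too phi delta uhat : C) (y z u : C -> C)
         (T01 omega1 al be : R),
    sigma = 1%R \/ sigma = (-1)%R ->
    type1_solution sigma T0 T1 Too phi delta uhat y z u ->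
    gamma_hat T0 T1 = Ci * RtoC T01 ->
    nu1 Too phi = Ci * RtoC omega1 ->
    alpha_hat T0 T1 Too = RtoC al ->
    beta_hat T0 T1 Too = RtoC be ->
    (((omega1 - T01) / 2) ^ 2 > 2 * be)%R ->
    let b := ((omega1 - T01) / 2)%R in
    let A := sqrt (b ^ 2 - 2 * be) in
    let modulus_relation :=
      (2 * Cmod delta * exp (- (sigma * PI * omega1 / 2)) = A)%R in
    (0 < A)%R /\
    (modulus_relation ->
     exists yt : R -> R,
       real_on_axis sigma y yt /\
       real_asymptotics sigma y yt b A omega1 (Carg delta)) /\
    (forall yt : R -> R,
       real_on_axis sigma y yt ->
       modulus_relation /\
       real_asymptotics sigma y yt b A omega1 (Carg delta)).
Proof.
  intros sigma T0 T1 Too phi delta uhat y z u T01 omega1 al be Hsg Htype Hg Hnu Hal Hbe Hineq b A modulus_relation.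
  assert (Hpar : ray_params sigma T0 T1 Too T01 al be) by (now constructor).
  assert (Hpos : (0 < ((omega1 - T01) / 2) ^ 2 - 2 * be)%R) by lra.
  assert (Hmod : modulus_relation <-> (2 * ray_modulus sigma omega1 delta)%R = A).
  { unfold modulus_relation, ray_modulus. now rewrite Rmult_assoc. }
  split; [exact (sqrt_lt_R0 _ Hpos)|split].
  - intro H. apply Hmod in H.
    pose proof (real_on_axis_exists sigma T0 T1 Too phi delta uhat y z u T01 omega1 al be Htype Hpar Hnu Hpos H) as Hre.
    eexists. split; [exact Hre|].
    exact (real_on_axis_asymptotics sigma T0 T1 Too phi delta uhat y z u T01 omega1 al be Htype Hpar Hnu Hpos _ Hre).
  - intros yt Hre. split.
    + apply Hmod. exact (real_on_axis_modulus sigma T0 T1 Too phi delta uhat y z u T01 omega1 al be Htype Hpar Hnu yt Hre).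
    + exact (real_on_axis_asymptotics sigma T0 T1 Too phi delta uhat y z u T01 omega1 al be Htype Hpar Hnu Hpos yt Hre).
Qed.
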